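(* The Birkhoff factorization statement (BF) implies the Grothendieck splitting statement (G), where: (BF) For every integer $n\geq 1$, every real $R_0>0$ and every $\mathcal T\in \mathrm{GL}(n,\mathcal O(\mathscr D))$, where $\mathscr D=\{z\in\mathbb C:\ |z|>R_0\}$, there exist a matrix $\mathcal P\in \mathrm{GL}(n,\mathcal O(\Delta(0,1/R_0)))$, where $\Delta(0,1/R_0)=\{\zeta\in\mathbb C:\ |\zeta|<1/R_0\}$, a matrix $\mathcal E\in\mathrm{GL}(n,\mathcal O(\mathbb C))$, and integers $k_1\geq k_2\geq\dots\geq k_n$ such that, with $\Lambda(z)=\mathrm{diag}(z^{k_1},\dots,z^{k_n})$, $$\mathcal T(z)=\mathcal P\left(\tfrac1z\right)\Lambda(z)\,\mathcal E(z)\qquad\text{for all } z\in\mathscr D .$$ (G) For every integer $n\ge 1$ and every holomorphic vector bundle $E$ of rank $n$ on $\mathbb P^1(\mathbb C)$, there exist integers $a_1,\dots,a_n$ such that $$E\cong \mathcal O_{\mathbb P^1(\mathbb C)}(a_1)\oplus\cdots\oplus\mathcal O_{\mathbb P^1(\mathbb C)}(a_n).$$ Furthermore, for integers $a_1,\dots,a_n,b_1,\dots,b_l$, one has $\mathcal O_{\mathbb P^1(\mathbb C)}(a_1)\oplus\cdots\oplus\mathcal O_{\mathbb P^1(\mathbb C)}(a_n)\cong \mathcal O_{\mathbb P^1(\mathbb C)}(b_1)\oplus\cdots\oplus\mathcal O_{\mathbb P^1(\mathbb C)}(b_l)$ if and only if $n=l$ and, up to reordering, $a_i=b_i$ for all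 $i$.
   Context: For an open set $U\subseteq\mathbb C$, $\mathcal O(U)$ is the ring of holomorphic functions on $U$, and $\mathrm{GL}(n,\mathcal O(U))$ is the group of $n\times n$ matrices over $\mathcal O(U)$ that are invertible over $\mathcal O(U)$. $\mathbb P^1(\mathbb C)$ is the Riemann sphere, covered by $U_0=\{[z_0:z_1]: z_0\neq 0\}$ with coordinate $z=z_1/z_0$ and $U_1=\{[z_0:z_1]: z_1\neq0\}$ with coordinate $\tilde z=z_0/z_1$, so $\tilde z=1/z$ on $U_0\cap U_1\cong\mathbb C^\times$. For $k\in\mathbb Z$, $\mathcal O_{\mathbb P^1(\mathbb C)}(k)$ is the holomorphic line bundle with transition function $g_{01}(z)=z^k$ on $U_0\cap U_1$; i.e. its sections are pairs of holomorphic functions $s_0$ on $U_0$, $s_1$ on $U_1$ with $s_0(z)=z^k s_1(1/z)$ on $U_0\cap U_1$. Isomorphisms $\cong$ are isomorphisms of holomorphic vector bundles over $\mathbb P^1(\mathbb C)$. *)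

(* Defs.v *)
From HB Require Import structures.
From mathcomp Require Import all_boot all_order all_algebra.
From mathcomp Require Import complex.
From mathcomp Require Import all_classical all_reals all_analysis.

Set Implicit Arguments.
Unset Strict Implicit.
Unset Printing Implicit Defensive.

Import Order.TTheory GRing.Theory Num.Theory numFieldNormedType.Exports.

Local Open Scope classical_set_scope.
Local Open Scope ring_scope.
Local Open Scope complex_scope.

(** Functions holomorphic on a subset of C = R[i].  Elements of O(U) are
    represented by total functions, of which only the values on U matter.
    [derivable] over the scalar field K = C is differentiability in the complex
    sense; going through an arbitrary [numFieldType] gives access to the
    topology of K, which is not declared on the type R[i] itself. *)

Definition holo_on (K : numFieldType) (U : set K) (f : K -> K) : Prop :=
  forall z, U z -> derivable f z 1.

Definition open_in (K : numFieldType) (U : set K) : Prop := open U.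

Definition holo (R : realType) (U : set R[i]) (f : R[i] -> R[i]) : Prop :=
  holo_on U f.

Definition holo_mx (R : realType) (m n : nat) (U : set R[i])
    (M : R[i] -> 'M[R[i]]_(m, n)) : Prop :=
  forall i j, holo U (fun z => M z i j).

(** M \in GL(n, O(U)) *)
Definition GL_holo (R : realType) (n : nat) (U : set R[i])
    (M : R[i] -> 'M[R[i]]_n) : Prop :=
  holo_mx U M /\
  exists2 N : R[i] -> 'M[R[i]]_n, holo_mx U N &
    forall z, U z -> M z *m N z = 1%:M /\ N z *m M z = 1%:M.

(** The projective line: lines through the origin in C^2. *)

Definition P1 (R : realType) : Type :=
  {L : {vspace 'rV[R[i]]_2} | \dim L == 1%N}.

Definition hvec (R : realType) (z0 z1 : R[i]) : 'rV[R[i]]_2 :=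
  \row_j (if j == 0 then z0 else z1).

Lemma hvec1_neq0 (R : realType) (z : R[i]) : hvec 1 z != 0.
Proof. by apply/eqP => /rowP /(_ 0) /eqP; rewrite !mxE oner_eq0. Qed.

Lemma hvec_1_neq0 (R : realType) (w : R[i]) : hvec w 1 != 0.
Proof. by apply/eqP => /rowP /(_ 1) /eqP; rewrite !mxE oner_eq0. Qed.

Lemma hpoint_subproof (R : realType) (v : 'rV[R[i]]_2) :
  v != 0 -> \dim <[v]>%VS == 1%N.
Proof. by move=> v0; rewrite dim_vline v0. Qed.

Definition hpoint (R : realType) (v : 'rV[R[i]]_2) (v0 : v != 0) : P1 R :=
  exist _ <[v]>%VS (hpoint_subproof v0).

(** The inverses of the coordinates z = z1 / z0 on U_0 and z0 / z1 on U_1: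
    [affine0 z] is [1 : z] and [affine1 w] is [w : 1]. *)
Definition affine0 (R : realType) (z : R[i]) : P1 R := hpoint (hvec1_neq0 z).
Definition affine1 (R : realType) (w : R[i]) : P1 R := hpoint (hvec_1_neq0 w).

(** Some homogeneous coordinates (z0, z1) of a point. *)
Definition hcoord (R : realType) (x : P1 R) : 'rV[R[i]]_2 := vpick (val x).

Definition U0 (R : realType) : pred (P1 R) := fun x => hcoord x 0 0 != 0.
Definition U1 (R : realType) : pred (P1 R) := fun x => hcoord x 0 1 != 0.

Definition zcoord (R : realType) (x : P1 R) : R[i] :=
  hcoord x 0 1 / hcoord x 0 0.

Lemma hcoord_neq0 (R : realType) (x : P1 R) : hcoord x != 0.
Proof.
rewrite /hcoord vpick0 -dimv_eq0; case: x => L /= /eqP ->.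
by [].
Qed.

Lemma hcoord_line (R : realType) (x : P1 R) : val x = <[hcoord x]>%VS.
Proof.
apply/eqP; rewrite eq_sym eqEdim -memvE memv_pick dim_vline hcoord_neq0 /=.
by case: x => L /= /eqP ->.
Qed.

Lemma P1_eq (R : realType) (x : P1 R) (v : 'rV[R[i]]_2) (v0 : v != 0) (c : R[i]) :
  c != 0 -> hcoord x = c *: v -> x = hpoint v0.
Proof.
move=> c0 xE; apply: val_inj; rewrite /= hcoord_line xE; apply/eqP.
rewrite eqEdim -memvE memvZ ?memv_line //= !dim_vline v0.
by rewrite scaler_eq0 (negbTE c0) (negbTE v0).
Qed.

Lemma hcoord_hpoint (R : realType) (v : 'rV[R[i]]_2) (v0 : v != 0) :
  exists2 c : R[i], c != 0 & hcoord (hpoint v0) = c *: v.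
Proof.
have /vlineP[c cE] : hcoord (hpoint v0) \in <[v]>%VS by exact: memv_pick.
exists c => //; apply: contraNneq (hcoord_neq0 (hpoint v0)) => c0.
by rewrite cE c0 scale0r.
Qed.

Lemma U0_affine0 (R : realType) (z : R[i]) : U0 (affine0 z).
Proof.
rewrite /U0; have [c c0 ->] := hcoord_hpoint (hvec1_neq0 z).
by rewrite !mxE mulr1.
Qed.

Lemma zcoord_affine0 (R : realType) (z : R[i]) : zcoord (affine0 z) = z.
Proof.
rewrite /zcoord; have [c c0 ->] := hcoord_hpoint (hvec1_neq0 z).
by rewrite !mxE /= mulr1 mulrAC divff // mul1r.
Qed.

Lemma U1_affine1 (R : realType) (w : R[i]) : U1 (affine1 w).
Proof.
rewrite /U1; have [c c0 ->] := hcoord_hpoint (hvec_1_neq0 w).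
by rewrite !mxE mulr1.
Qed.

Lemma U0_affine1 (R : realType) (w : R[i]) : U0 (affine1 w) = (w != 0).
Proof.
rewrite /U0; have [c c0 ->] := hcoord_hpoint (hvec_1_neq0 w).
by rewrite !mxE /= mulf_eq0 (negbTE c0).
Qed.

Lemma U1_affine0 (R : realType) (z : R[i]) : U1 (affine0 z) = (z != 0).
Proof.
rewrite /U1; have [c c0 ->] := hcoord_hpoint (hvec1_neq0 z).
by rewrite !mxE /= mulf_eq0 (negbTE c0).
Qed.

Lemma zcoord_affine1 (R : realType) (w : R[i]) : zcoord (affine1 w) = w^-1.
Proof.
rewrite /zcoord; have [c c0 ->] := hcoord_hpoint (hvec_1_neq0 w).
by rewrite !mxE /= mulr1 invfM mulrA divff // mul1r.
Qed.

Lemma affine0K (R : realType) (x : P1 R) : U0 x -> affine0 (zcoord x) = x.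
Proof.
move=> x0; symmetry; apply: (@P1_eq _ _ _ _ _ x0); apply/rowP => j.
rewrite !mxE; case: eqP => [->|/eqP j0]; first by rewrite mulr1.
have -> : j = 1 by apply: val_inj; case: j j0 => [[|[|]]].
by rewrite mulrC divfK.
Qed.

Lemma affine1K (R : realType) (x : P1 R) : U1 x ->
  affine1 (hcoord x 0 0 / hcoord x 0 1) = x.
Proof.
move=> x1; symmetry; apply: (@P1_eq _ _ _ _ _ x1); apply/rowP => j.
rewrite !mxE; case: eqP => [->|/eqP j0]; first by rewrite mulrC divfK.
have -> : j = 1 by apply: val_inj; case: j j0 => [[|[|]]].
by rewrite mulr1.
Qed.

Lemma U0_or_U1 (R : realType) (x : P1 R) : U0 x || U1 x.
Proof.
rewrite -negb_and; apply: contra (hcoord_neq0 x) => /andP[/eqP h0 /eqP h1].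
apply/eqP/rowP => j; rewrite mxE; case: (eqVneq j 0) => [->//|j0].
by have -> : j = 1 by apply: val_inj; case: j j0 => [[|[|]]].
Qed.


Definition P1_open (R : realType) (W : set (P1 R)) : Prop :=
  open_in (@affine0 R @^-1` W) /\ open_in (@affine1 R @^-1` W).

Definition P1_holo_mx (R : realType) (m n : nat) (W : set (P1 R))
    (M : P1 R -> 'M[R[i]]_(m, n)) : Prop :=
  holo_mx (@affine0 R @^-1` W) (M \o @affine0 R) /\
  holo_mx (@affine1 R @^-1` W) (M \o @affine1 R).

(** Holomorphic vector bundles of rank n on P^1(C): a family of complex vector
    spaces together with an atlas of local trivializations, linear on fibers,
    whose transition matrices are holomorphic.  The topology and the complex
    structure of the total space are those for which the trivializations are
    biholomorphic; they are determined by the atlas.  The value of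
    [triv i x] is irrelevant when x is not in [dom i].  The invertibility of
    the transition matrices follows from [triv_bij]. *)
Record bundle (R : realType) (n : nat) := Bundle {
  fiber : P1 R -> lmodType R[i];
  chart : Type;
  dom : chart -> set (P1 R);
  triv : chart -> forall x, fiber x -> 'cV[R[i]]_n;
  dom_open : forall i, P1_open (dom i);
  dom_cover : forall x, exists i, dom i x;
  triv_linear : forall i x, dom i x -> linear (@triv i x);
  triv_bij : forall i x, dom i x -> bijective (@triv i x);
  triv_holo : forall i j, exists2 g : P1 R -> 'M[R[i]]_n,
    P1_holo_mx (dom i `&` dom j) g &
    forall x, dom i x -> dom j x ->
      forall v : fiber x, triv i v = g x *m triv j v }.

Definition bundle_hom (R : realType) (m n : nat) (E : bundle R m)
    (F : bundle R n) (f : forall x, fiber E x -> fiber F x) : Prop :=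
  (forall x, linear (f x)) /\
  forall (i : chart E) (j : chart F), exists2 A : P1 R -> 'M[R[i]]_(n, m),
    P1_holo_mx (dom i `&` dom j) A &
    forall x, dom i x -> dom j x ->
      forall v : fiber E x, triv j (f x v) = A x *m triv i v.

Definition bundle_iso (R : realType) (m n : nat) (E : bundle R m)
    (F : bundle R n) : Prop :=
  exists (f : forall x, fiber E x -> fiber F x)
         (g : forall x, fiber F x -> fiber E x),
    [/\ bundle_hom f, bundle_hom g &
        forall x, cancel (f x) (g x) /\ cancel (g x) (f x)].

Lemma holo_on_cst (K : numFieldType) (U : set K) (c : K) :
  holo_on U (fun=> c).
Proof. by move=> z _; exact: derivable_cst. Qed.

Lemma holo_on_exprz (K : numFieldType) (U : set K) (k : int) :
  (forall z, U z -> z != 0) -> holo_on U (fun z => z ^ k).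
Proof.
have hX (n : nat) (z : K) : derivable (fun z : K => z ^+ n) z 1.
  elim: n => [|n IH]; first exact: derivable_cst.
  have -> : (fun z : K => z ^+ n.+1) = (fun z => z * z ^+ n).
    by apply/funext => y; rewrite exprS.
  have H := @derivableM K K id (fun z => z ^+ n) z 1 (@derivable_id _ _ _ _) IH.
  exact H.
move=> Un0 z /Un0 z0; case: k => n; first exact: hX.
have H := @derivableV K K (fun z => z ^+ n.+1) z 1 (expf_neq0 _ z0) (hX _ _).
exact H.
Qed.

Lemma open_in_neq0 (K : numFieldType) : open_in [set z : K | z != 0].
Proof.
rewrite /open_in openE => z /= z0; apply/nbhs_ballP; exists `|z| => /=.
  by rewrite normr_gt0.
move=> y; rewrite -ball_normE /= => yz; apply: contraTneq yz => ->.
by rewrite subr0 ltxx.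
Qed.

Lemma open_inT (K : numFieldType) : open_in [set: K].
Proof. exact: openT. Qed.

Lemma open_inI (K : numFieldType) (U V : set K) :
  open_in U -> open_in V -> open_in (U `&` V).
Proof. exact: openI. Qed.

Lemma holo_mx_eq (R : realType) (m n : nat) (U : set R[i])
    (M N : R[i] -> 'M[R[i]]_(m, n)) : M =1 N -> holo_mx U M -> holo_mx U N.
Proof. by move=> /funext ->. Qed.

Lemma holo_mx_sub (R : realType) (m n : nat) (U V : set R[i])
    (M : R[i] -> 'M[R[i]]_(m, n)) : U `<=` V -> holo_mx V M -> holo_mx U M.
Proof. by move=> UV hM i j z /UV; exact: hM. Qed.

Lemma P1_holo_mx_sub (R : realType) (m n : nat) (U V : set (P1 R))
    (M : P1 R -> 'M[R[i]]_(m, n)) :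
  U `<=` V -> P1_holo_mx V M -> P1_holo_mx U M.
Proof.
move=> UV [h0 h1]; split; last by apply: holo_mx_sub h1 => z; exact: UV.
by apply: holo_mx_sub h0 => z; exact: UV.
Qed.

Lemma P1_holo_mx_cst (R : realType) (m n : nat) (W : set (P1 R))
    (M : 'M[R[i]]_(m, n)) : P1_holo_mx W (fun=> M).
Proof. by split=> i j; exact: holo_on_cst. Qed.

Lemma P1_open_setT (R : realType) : P1_open [set: P1 R].
Proof. by split; exact: open_inT. Qed.

Lemma P1_openI (R : realType) (V W : set (P1 R)) :
  P1_open V -> P1_open W -> P1_open (V `&` W).
Proof. by move=> [? ?] [? ?]; split; rewrite preimage_setI; exact: open_inI. Qed.

Lemma P1_open_U0 (R : realType) : P1_open [set x : P1 R | U0 x].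
Proof.
split.
  suff -> : @affine0 R @^-1` [set x | U0 x] = setT by exact: open_inT.
  by apply/seteqP; split=> z //= _; exact: U0_affine0.
suff -> : @affine1 R @^-1` [set x | U0 x] = [set z | z != 0] by exact: open_in_neq0.
by apply/seteqP; split=> z /=; rewrite U0_affine1.
Qed.

Lemma P1_open_U1 (R : realType) : P1_open [set x : P1 R | U1 x].
Proof.
split.
  suff -> : @affine0 R @^-1` [set x | U1 x] = [set z | z != 0] by exact: open_in_neq0.
  by apply/seteqP; split=> z /=; rewrite U1_affine0.
suff -> : @affine1 R @^-1` [set x | U1 x] = setT by exact: open_inT.
by apply/seteqP; split=> z //= _; exact: U1_affine1.
Qed.

Lemma P1_holo_zcoord (R : realType) (n : nat) (W : set (P1 R)) (k : int) :
  W `<=` [set x | U0 x /\ U1 x] ->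
  P1_holo_mx W (fun x => (zcoord x ^ k)%:M : 'M[R[i]]_n).
Proof.
have hS (U : set R[i]) (e : int) : (forall z, U z -> z != 0) ->
    holo_mx U (fun z => (z ^ e)%:M : 'M[R[i]]_n).
  move=> Un0 i j; have [ij|ij] := eqVneq i j.
    have -> : (fun z : R[i] => (z ^ e)%:M i j) = (fun z => z ^ e).
      by apply/funext => z; rewrite mxE ij eqxx.
    exact: holo_on_exprz.
  have -> : (fun z : R[i] => (z ^ e)%:M i j) = (fun=> 0).
    by apply/funext => z; rewrite mxE (negbTE ij).
  exact: holo_on_cst.
move=> WU; split.
  apply: (@holo_mx_eq _ _ _ _ (fun z => (z ^ k)%:M)).
    by move=> z; rewrite /= zcoord_affine0.
  by apply: hS => z /WU[_]; rewrite U1_affine0.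
apply: (@holo_mx_eq _ _ _ _ (fun z => (z ^ (- k))%:M)).
  by move=> z; rewrite /= zcoord_affine1 exprz_inv.
by apply: hS => z /WU[]; rewrite U0_affine1.
Qed.

(** O(k): the fiber is C at every point, the chart [false] is over U_0, the
    chart [true] over U_1.  A point of the fiber has components s_0 over U_0
    and s_1 over U_1, with s_0 = z^k s_1 over the intersection (see
    [O_transition]); the fiber is identified with C through s_0 over U_0, and
    through s_1 at the point [0 : 1]. *)

Definition O_dom (R : realType) (b : bool) : set (P1 R) :=
  if b then [set x | U1 x] else [set x | U0 x].

Definition O_factor (R : realType) (k : int) (b : bool) (x : P1 R) : R[i] :=
  if b && U0 x then zcoord x ^ (- k) else 1.

Definition O_triv (R : realType) (k : int) (b : bool) (x : P1 R)
    (s : (R[i]^o : lmodType R[i])) : 'cV[R[i]]_1 :=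
  (O_factor k b x * s)%:M.

Lemma zcoord_neq0 (R : realType) (x : P1 R) : U0 x -> U1 x -> zcoord x != 0.
Proof. by move=> x0 x1; rewrite mulf_neq0 ?invr_eq0. Qed.

Lemma O_factor_neq0 (R : realType) (k : int) (b : bool) (x : P1 R) :
  O_dom b x -> O_factor k b x != 0.
Proof.
rewrite /O_factor; case: b => /= x1; last by rewrite oner_eq0.
by case: ifPn => [x0|_]; rewrite ?oner_eq0 // expfz_neq0 // zcoord_neq0.
Qed.

Lemma O_transition (R : realType) (k : int) (x : P1 R) s :
  U0 x -> U1 x -> O_triv k false x s = zcoord x ^ k *: O_triv k true x s.
Proof.
move=> x0 x1; rewrite /O_triv /O_factor /= x0 scale_scalar_mx mul1r mulrA.
by rewrite -expfzDr ?zcoord_neq0 // subrr expr0z mul1r.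
Qed.

Lemma O_open (R : realType) (b : bool) : P1_open (@O_dom R b).
Proof. by case: b; [exact: P1_open_U1|exact: P1_open_U0]. Qed.

Lemma O_cover (R : realType) (x : P1 R) : exists b, O_dom b x.
Proof. by case/orP: (U0_or_U1 x) => h; [exists false|exists true]. Qed.

Lemma O_linear (R : realType) (k : int) (b : bool) (x : P1 R) :
  O_dom b x -> linear (@O_triv R k b x).
Proof.
move=> _ a u v; rewrite /O_triv scale_scalar_mx -raddfD /=.
by rewrite mulrDr mulrCA.
Qed.

Lemma O_bij (R : realType) (k : int) (b : bool) (x : P1 R) :
  O_dom b x -> bijective (@O_triv R k b x).
Proof.
move=> /(O_factor_neq0 k) c0.
exists (fun v : 'cV[R[i]]_1 => (O_factor k b x)^-1 * v 0 0) => v.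
  by rewrite /O_triv mxE eqxx mulr1n mulKf.
by rewrite /O_triv mulVKf // [RHS]mx11_scalar.
Qed.

Lemma O_holo (R : realType) (k : int) (b c : bool) :
  exists2 g : P1 R -> 'M[R[i]]_1, P1_holo_mx (O_dom b `&` O_dom c) g &
    forall x, O_dom b x -> O_dom c x ->
      forall v, @O_triv R k b x v = g x *m O_triv k c x v.
Proof.
case: b c => [] [].
- exists (fun=> 1%:M); first exact: P1_holo_mx_cst.
  by move=> x _ _ v; rewrite mul1mx.
- exists (fun x => (zcoord x ^ (- k))%:M).
    by apply: P1_holo_zcoord => x [].
  move=> x x1 x0 v; rewrite (O_transition k v x0 x1) mul_scalar_mx scalerA.
  by rewrite -expfzDr ?zcoord_neq0 // addNr expr0z scale1r.
- exists (fun x => (zcoord x ^ k)%:M).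
    by apply: P1_holo_zcoord => x [].
  by move=> x x0 x1 v; rewrite (O_transition k v x0 x1) mul_scalar_mx.
- exists (fun=> 1%:M); first exact: P1_holo_mx_cst.
  by move=> x _ _ v; rewrite mul1mx.
Qed.

Definition OP1 (R : realType) (k : int) : bundle R 1 :=
  Bundle (@O_open R) (@O_cover R) (@O_linear R k) (@O_bij R k) (@O_holo R k).

Section ZeroBundle.
Context (R : realType).

Definition zero_fiber (x : P1 R) : lmodType R[i] := 'cV[R[i]]_0.
Definition zero_triv (i : unit) (x : P1 R) : zero_fiber x -> 'cV[R[i]]_0 := id.
Definition zero_dom (i : unit) : set (P1 R) := setT.

Lemma zero_open i : P1_open (zero_dom i). Proof. exact: P1_open_setT. Qed.
Lemma zero_cover x : exists i, zero_dom i x. Proof. by exists tt. Qed.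
Lemma zero_linear i x : zero_dom i x -> linear (@zero_triv i x). Proof. by []. Qed.
Lemma zero_bij i x : zero_dom i x -> bijective (@zero_triv i x). Proof. by move=> _; exists id. Qed.
Lemma zero_holo i j : exists2 g : P1 R -> 'M[R[i]]_0, P1_holo_mx (zero_dom i `&` zero_dom j) g &
  forall x, zero_dom i x -> zero_dom j x -> forall v : zero_fiber x, zero_triv i v = g x *m zero_triv j v.
Proof.
exists (fun=> 1%:M); first exact: P1_holo_mx_cst.
by move=> x _ _ v; rewrite mul1mx.
Qed.

Definition zero_bundle : bundle R 0 :=
  Bundle zero_open zero_cover zero_linear zero_bij zero_holo.

End ZeroBundle.

Section WhitneySum.
Context (R : realType) (m n : nat) (E : bundle R m) (F : bundle R n).

Definition sum_fiber (x : P1 R) : lmodType R[i] := (fiber E x * fiber F x)%type.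
Definition sum_chart : Type := (chart E * chart F)%type.
Definition sum_dom (i : sum_chart) : set (P1 R) := dom i.1 `&` dom i.2.
Definition sum_triv (i : sum_chart) (x : P1 R) (v : sum_fiber x) : 'cV[R[i]]_(m + n) :=
  col_mx (triv i.1 v.1) (triv i.2 v.2).

Lemma sum_open i : P1_open (sum_dom i).
Proof. by apply: P1_openI; exact: dom_open. Qed.

Lemma sum_cover x : exists i, sum_dom i x.
Proof.
by have [i ix] := dom_cover E x; have [j jx] := dom_cover F x; exists (i, j).
Qed.

Lemma sum_linear i x : sum_dom i x -> linear (@sum_triv i x).
Proof.
move=> [ix jx] a u v; rewrite /sum_triv (triv_linear ix) (triv_linear jx).
by rewrite scale_col_mx add_col_mx.
Qed.

Lemma sum_bij i x : sum_dom i x -> bijective (@sum_triv i x).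
Proof.
move=> [/triv_bij[f fK Kf] /triv_bij[g gK Kg]].
exists (fun w => (f (usubmx w), g (dsubmx w))) => [[u v]|w].
  by rewrite /sum_triv /= col_mxKu col_mxKd fK gK.
by rewrite /sum_triv /= Kf Kg vsubmxK.
Qed.

Lemma sum_holo i j : exists2 g : P1 R -> 'M[R[i]]_(m + n),
  P1_holo_mx (sum_dom i `&` sum_dom j) g &
  forall x, sum_dom i x -> sum_dom j x -> forall v : sum_fiber x, sum_triv i v = g x *m sum_triv j v.
Proof.
have [A hA AE] := triv_holo i.1 j.1; have [B hB BE] := triv_holo i.2 j.2.
exists (fun x => block_mx (A x) 0 0 (B x)); last first.
  move=> x [ix ix'] [jx jx'] v.
  by rewrite /sum_triv mul_block_col !mul0mx addr0 add0r -AE // -BE.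
have hb (U : set R[i]) (M : R[i] -> 'M[R[i]]_m) (N : R[i] -> 'M[R[i]]_n) :
    holo_mx U M -> holo_mx U N ->
    holo_mx U (fun z => block_mx (M z) 0 0 (N z)).
  move=> hM hN a b.
  case: (split_ordP a) => a' ->; case: (split_ordP b) => b' ->.
  - under [X in holo _ X]eq_fun do rewrite block_mxEul; exact: hM.
  - under [X in holo _ X]eq_fun do rewrite block_mxEur mxE.
    exact: holo_on_cst.
  - under [X in holo _ X]eq_fun do rewrite block_mxEdl mxE.
    exact: holo_on_cst.
  - under [X in holo _ X]eq_fun do rewrite block_mxEdr; exact: hN.
have sA : sum_dom i `&` sum_dom j `<=` dom i.1 `&` dom j.1 by move=> x [[? ?] []].
have sB : sum_dom i `&` sum_dom j `<=` dom i.2 `&` dom j.2 by move=> x [[? ?] []].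
have [A0 A1] := P1_holo_mx_sub sA hA; have [B0 B1] := P1_holo_mx_sub sB hB.
by split; [exact: (hb _ _ _ A0 B0)|exact: (hb _ _ _ A1 B1)].
Qed.

Definition whitney_sum : bundle R (m + n) :=
  Bundle sum_open sum_cover sum_linear sum_bij sum_holo.

End WhitneySum.

(** The iterated Whitney sum, started from the zero bundle. *)
Fixpoint direct_sum (R : realType) (n : nat) :
    ('I_n -> bundle R 1) -> bundle R n :=
  match n with
  | 0 => fun=> zero_bundle R
  | p.+1 => fun L =>
      whitney_sum (L ord0) (direct_sum (fun i : 'I_p => L (lift ord0 i)))
  end.

Definition OP1_sum (R : realType) (n : nat) (a : 'I_n -> int) : bundle R n :=
  direct_sum (fun i => OP1 R (a i)).

Definition zpow_diag (R : realType) (n : nat) (k : 'I_n -> int) (z : R[i]) :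
  'M[R[i]]_n := diag_mx (\row_i z ^ k i).

Definition birkhoff_factorization (R : realType) : Prop :=
  forall (n : nat) (R0 : R) (T : R[i] -> 'M[R[i]]_n),
    (1 <= n)%N -> 0 < R0 ->
    GL_holo [set z | R0%:C < `|z|] T ->
    exists (P E : R[i] -> 'M[R[i]]_n) (k : 'I_n -> int),
      [/\ GL_holo [set w | `|w| < (1 / R0)%:C] P,
          GL_holo setT E,
          forall i j : 'I_n, (i <= j)%N -> k j <= k i &
          forall z, R0%:C < `|z| -> T z = P (1 / z) *m zpow_diag k z *m E z].

Definition grothendieck_splitting (R : realType) : Prop :=
  (forall (n : nat) (E : bundle R n), (1 <= n)%N ->
    exists a : 'I_n -> int, bundle_iso E (OP1_sum R a)) /\
  (forall (n l : nat) (a : 'I_n -> int) (b : 'I_l -> int),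
    bundle_iso (OP1_sum R a) (OP1_sum R b) <->
    n = l /\ exists2 s : 'I_n -> 'I_l, bijective s & forall i, a i = b (s i)).

(* Main.v *)
(** The transition matrix T between frames over two adjacent rectangles, or over a
    large square and a neighbourhood of infinity, factors as T = a b with a and b
    holomorphic and invertible on either side (Cartan's lemma), so that frames can
    be glued.  Local frames of a bundle thus glue to a frame over any large square,
    by successive subdivision, and then to a frame over U_0 = C.  To prove Cartan's
    lemma, T is approximated on the overlap by a rational matrix, a Riemann sum of
    Cauchy integrals.  The quotient is close to 1 and is factored by a Newton
    iteration based on the additive splitting of functions by Cauchy integrals;
    the zeros of the determinant of the rational matrix are moved, one at a time,
    to the side on which they do no harm.  A Birkhoff factorization of the
    transition matrix between the frame over C and a frame near infinity yields
    frames over U_0 and U_1 related by diag(z^k).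

    For uniqueness, an isomorphism is given over U_0 by an invertible matrix of
    entire functions whose entry (i, j) vanishes, by Liouville's theorem, unless
    a_j <= b_i; symmetrically for its inverse.  Comparing nonzero terms in the
    expansions of the two determinants forces the weights to agree. *)

Require Import Defs.
From mathcomp Require Import all_boot all_order all_algebra.
From mathcomp Require Import fingroup perm complex ring lra.
From mathcomp Require Import all_classical all_reals all_analysis.

Set Implicit Arguments.
Unset Strict Implicit.
Unset Printing Implicit Defensive.

Import Order.TTheory GRing.Theory Num.Theory numFieldNormedType.Exports.

Local Open Scope classical_set_scope.
Local Open Scope ring_scope.
Local Open Scope complex_scope.

Local Notation Re := complex.Re.
Local Notation Im := complex.Im.

(** The obstacle is that writing a function on the overlap as a sum h1 + h2 costs a factor 1 / (t -
    s) when the domains shrink from parameter s to parameter t. The quadratic convergence of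
    Newton's iteration absorbs infinitely many such losses; this is why Cartan's lemma is stated for
    families [A s], [B s] rather than for two fixed domains. The iteration starts only near the
    identity. A rational matrix G close to T serves as an intermediate: T^-1 G is near the identity,
    while G is a polynomial matrix up to a scalar denominator, so that its poles and the zeros of
    its determinant are finite in number and each can be assigned to one side. Domains are
    rectangles and square annuli because their contours consist of segments, along which integrals
    reduce to one real variable. A chart at infinity already gives a frame outside a large square,
    so a single gluing along a square annulus leads from a square to the whole plane, instead of a
    limit over growing squares. *)

Lemma derivable_eps (K : numFieldType) (f : K -> K) (z : K) :
  derivable f z 1 -> forall e, 0 < e -> exists2 r, 0 < r &
    forall w, `|w - z| < r -> `|f w - f z - (w - z) * 'D_1 f z| <= e * `|w - z|.
Proof.
move=> fd e e0; move/cvgrPdist_le/(_ _ e0): fd.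
rewrite near_withinE => /nbhs_ballP[r /= r0 rP]; exists r => // w wz.
have [->|wz0] := eqVneq w z; first by rewrite !subrr mul0r subr0 normr0 mulr0.
have /(_ _ _) := rP (w - z); rewrite -ball_normE /= sub0r normrN => /(_ wz).
rewrite subr_eq0 => /(_ wz0); rewrite /= [_ *: 1]mulr1 subrK => le_e.
set d := 'D_1 f z; have {}le_e : `|d - (w - z)^-1 *: (f w - f z)| <= e by [].
have -> : f w - f z - (w - z) * d = - ((w - z) * (d - (w - z)^-1 *: (f w - f z))).
  by rewrite mulrBr /GRing.scale /= mulVKf ?subr_eq0// opprB.
by rewrite normrN normrM mulrC ler_wpM2r.
Qed.

(** The remainder form involves no division and includes [w = z], unlike the difference quotient;
    all later estimates start from it. *)
Lemma derivable_epsP (K : numFieldType) (f : K -> K) (z : K) :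
  derivable f z 1 <-> exists d : K, forall e, 0 < e -> exists2 r, 0 < r &
    forall w, `|w - z| < r -> `|f w - f z - (w - z) * d| <= e * `|w - z|.
Proof.
split=> [/derivable_eps fd|[d fd]]; first by exists ('D_1 f z).
apply/cvg_ex; exists d; apply/cvgrPdist_le => /= e e0.
have [r r0 rP] := fd _ e0.
rewrite near_withinE; apply/nbhs_ballP; exists r => //= h.
rewrite -ball_normE /= sub0r normrN => hr h0.
rewrite [h *: 1]mulr1.
have := rP (h + z); rewrite addrK => /(_ hr) le_e.
have -> : d - h^-1 *: (f (h + z) - f z) = - (h^-1 * (f (h + z) - f z - h * d)).
  by rewrite mulrBr mulKf// opprB.
by rewrite normrN normrM normfV [_^-1 * _]mulrC ler_pdivrMr ?normr_gt0.
Qed.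

Lemma open_in_epsP (K : numFieldType) (U : set K) :
  open_in U <-> forall z, U z -> exists2 r, 0 < r & forall w, `|w - z| < r -> U w.
Proof.
rewrite /open_in openE; split=> [oU z Uz|oU z Uz].
  have /nbhs_ballP[r /= r0 rU] := oU z Uz; exists r => // w wz; apply: rU.
  by rewrite -ball_normE /= distrC.
have [r r0 rU] := oU z Uz; apply/nbhs_ballP; exists r => //= w.
by rewrite -ball_normE /= distrC; exact: rU.
Qed.

(** * Moduli and complex derivatives *)

Section Modulus.
Context {R : realType}.
Implicit Types (z w : R[i]) (x y : R).

(** The modulus as a real number: the norm of R[i] takes its values in R[i],
    whose order is not total. *)
Definition cmod z : R := Normc.normc z.

Lemma normcE_cmod z : `|z| = (cmod z)%:C. Proof. by []. Qed.

Lemma cmodM z w : cmod (z * w) = cmod z * cmod w.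
Proof. exact: Normc.normcM. Qed.

Lemma cmodV z : cmod z^-1 = (cmod z)^-1.
Proof. exact: Normc.normcV. Qed.

Lemma cmodD z w : cmod (z + w) <= cmod z + cmod w.
Proof. exact: le_normcD. Qed.

Lemma cmodN z : cmod (- z) = cmod z.
Proof. exact: normcN. Qed.

Lemma cmod_distC z w : cmod (z - w) = cmod (w - z).
Proof. by rewrite -cmodN opprB. Qed.

Lemma cmodB z w : cmod (z - w) <= cmod z + cmod w.
Proof. by rewrite -(cmodN w); exact: cmodD. Qed.

Lemma cmod_ge0 z : 0 <= cmod z.
Proof. by case: z => a b; exact: sqrtr_ge0. Qed.

Lemma cmod0 : cmod 0 = 0. Proof. exact: Normc.normc0. Qed.

Lemma cmod1 : cmod 1 = 1. Proof. exact: Normc.normc1. Qed.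

Lemma cmod_eq0 z : (cmod z == 0) = (z == 0).
Proof. by apply/eqP/eqP => [/Normc.eq0_normc|->]; rewrite ?cmod0. Qed.

Lemma cmod_gt0 z : (0 < cmod z) = (z != 0).
Proof. by rewrite lt_def cmod_ge0 andbT cmod_eq0. Qed.

Lemma cmod_real x : cmod x%:C = `|x|.
Proof. by rewrite /cmod /= expr0n addr0 sqrtr_sqr. Qed.

Lemma cmod_Re z : `|Re z| <= cmod z.
Proof.
case: z => a b /=; rewrite -sqrtr_sqr ler_wsqrtr// lerDl.
exact: sqr_ge0.
Qed.

Lemma cmod_Im z : `|Im z| <= cmod z.
Proof.
case: z => a b /=; rewrite -[X in X <= _]sqrtr_sqr ler_wsqrtr// lerDr.
exact: sqr_ge0.
Qed.

Lemma cmod_ReIm z : cmod z <= `|Re z| + `|Im z|.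
Proof.
rewrite {1}[z]complexE; apply: le_trans (cmodD _ _) _.
rewrite cmodM !cmod_real; suff -> : cmod 'i = 1 by rewrite mul1r.
by rewrite /cmod /= expr0n expr1n add0r sqrtr1.
Qed.

Lemma cmodX z n : cmod (z ^+ n) = cmod z ^+ n.
Proof. by elim: n => [|n IH]; rewrite ?expr0 ?cmod1// !exprS cmodM IH. Qed.

Lemma cmod_le_dist z w : cmod z <= cmod w + cmod (w - z).
Proof.
rewrite cmod_distC addrC; apply: le_trans (cmodD _ _).
by rewrite subrK.
Qed.

Lemma ltC_cmod z x : (`|z| < x%:C) = (cmod z < x).
Proof. by rewrite normcE_cmod ltcR. Qed.

Lemma gtC_cmod z x : (x%:C < `|z|) = (x < cmod z).
Proof. by rewrite normcE_cmod ltcR. Qed.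

Lemma posC_real z : 0 < z -> exists2 x, 0 < x & z = x%:C.
Proof.
case: z => a b; rewrite ltcE /= => /andP[/eqP -> a0].
by exists a.
Qed.

(** The inequality is not strict, so that it also holds at [w = z]. The derivative is an argument,
    which lets the rules of calculus produce explicit primitives and integrands. *)
Definition cderiv (f : R[i] -> R[i]) z d := forall e : R, 0 < e ->
  exists2 r : R, 0 < r & forall w, cmod (w - z) < r ->
    cmod (f w - f z - (w - z) * d) <= e * cmod (w - z).

Lemma holo_cderivP (U : set R[i]) (f : R[i] -> R[i]) :
  holo U f <-> forall z, U z -> exists d, cderiv f z d.
Proof.
split=> fU z Uz.
  have [d fd] := (derivable_epsP _ _).1 (fU z Uz); exists d => e e0.
  have [|r r0 rP] := fd e%:C; first by rewrite ltcR.
  have [x x0 rE] := posC_real r0; exists x => // w wz.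
  have := rP w; rewrite rE ltC_cmod => /(_ wz).
  by rewrite !normcE_cmod -rmorphM lecR.
have [d fd] := fU z Uz; apply/derivable_epsP; exists d => e e0.
have [x x0 ->] := posC_real e0.
have [r r0 rP] := fd _ x0; exists r%:C; first by rewrite ltcR.
by move=> w; rewrite ltC_cmod => /rP; rewrite !normcE_cmod -rmorphM lecR.
Qed.

Definition copen (U : set R[i]) := forall z, U z ->
  exists2 r : R, 0 < r & forall w, cmod (w - z) < r -> U w.

Lemma open_in_copenP (U : set R[i]) :
  open_in (U : set (R[i] : numFieldType)) <-> copen U.
Proof.
rewrite open_in_epsP; split=> oU z /oU[r r0 rU].
  have [x x0 rE] := posC_real r0; exists x => // w wz; apply: rU.
  by rewrite rE ltC_cmod.
exists r%:C; first by rewrite ltcR.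
by move=> w; rewrite ltC_cmod; exact: rU.
Qed.

End Modulus.

(** * Subdivision arguments *)

Lemma exists_half_pow_lt (R : realType) (r : R) : 0 < r -> exists k, (2^-1) ^+ k < r.
Proof.
move=> r0; set k := Num.bound r^-1.
have rk : r^-1 < k%:R by apply: archi_boundP; rewrite invr_ge0 ltW.
exists k; rewrite exprVn -[ltRHS]invrK ltf_pV2 ?posrE ?invr_gt0 ?exprn_gt0//.
by apply: lt_le_trans rk _; rewrite -natrX ler_nat ltnW// ltn_expl.
Qed.

(** Subdividing a bad rectangle repeatedly yields bad rectangles of side s
    shrinking to a point (p, q): this stands in for compactness in Goursat's
    theorem and in passing from local to global frames. *)
Lemma quartering (R : realType) (w h x0 y0 : R) (P : R -> R -> R -> Prop) :
  0 <= w -> 0 <= h ->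
  (forall x y s, 0 < s -> P x y (s / 2) -> P (x + s / 2 * w) y (s / 2) ->
    P x (y + s / 2 * h) (s / 2) -> P (x + s / 2 * w) (y + s / 2 * h) (s / 2) ->
    P x y s) ->
  (forall p q, x0 <= p <= x0 + w -> y0 <= q <= y0 + h ->
    exists2 r, 0 < r & forall x y s, 0 < s < r ->
      x0 <= x -> x + s * w <= x0 + w -> y0 <= y -> y + s * h <= y0 + h ->
      x <= p <= x + s * w -> y <= q <= y + s * h -> P x y s) ->
  P x0 y0 1.
Proof.
move=> w0 h0 Pq Pl; apply: contrapT => nP.
(* Every triple gets a successor, as [choice] requires; one that is not a bad rectangle is its
   own. *)
have step (t : R * R * R) : exists t' : R * R * R, 0 < t.2 -> ~ P t.1.1 t.1.2 t.2 ->
    [/\ ~ P t'.1.1 t'.1.2 t'.2, t'.2 = t.2 / 2,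
      t.1.1 <= t'.1.1 /\ t'.1.1 + t'.2 * w <= t.1.1 + t.2 * w &
      t.1.2 <= t'.1.2 /\ t'.1.2 + t'.2 * h <= t.1.2 + t.2 * h].
  case: t => [[x y] s] /=.
  have [s0|s0] := pselect (0 < s); last by exists (x, y, s).
  have [nPs|nPs] := pselect (~ P x y s); last by exists (x, y, s).
  have sw : 0 <= s * w by apply: mulr_ge0 => //; exact: ltW.
  have sh : 0 <= s * h by apply: mulr_ge0 => //; exact: ltW.
  have [P1|P1] := pselect (P x y (s / 2)); last first.
    by exists (x, y, s / 2) => /= _ _; split => //; split; lra.
  have [P2|P2] := pselect (P (x + s / 2 * w) y (s / 2)); last first.
    by exists (x + s / 2 * w, y, s / 2) => /= _ _; split => //; split; lra.
  have [P3|P3] := pselect (P x (y + s / 2 * h) (s / 2)); last first.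
    by exists (x, y + s / 2 * h, s / 2) => /= _ _; split => //; split; lra.
  exists (x + s / 2 * w, y + s / 2 * h, s / 2) => /= _ _.
  split => //; [by move=> P4; apply: nPs; exact: Pq|by split; lra|by split; lra].
have [nxt nxtP] := choice step.
pose u k := iter k nxt (x0, y0, 1).
have uS k : u k.+1 = nxt (u k) by [].
have uP k : ~ P (u k).1.1 (u k).1.2 (u k).2 /\ (u k).2 = 2^-1 ^+ k.
  elim: k => [|k [nPk sk]]; first by rewrite expr0.
  have [|//|] := nxtP (u k); first by rewrite sk exprn_gt0 ?invr_gt0.
  by rewrite uS => ? E _ _; split; rewrite // E sk exprSr.
have uM k : [/\ (u k).1.1 <= (u k.+1).1.1,
    (u k.+1).1.1 + (u k.+1).2 * w <= (u k).1.1 + (u k).2 * w,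
    (u k).1.2 <= (u k.+1).1.2 &
    (u k.+1).1.2 + (u k.+1).2 * h <= (u k).1.2 + (u k).2 * h].
  have [nPk sk] := uP k.
  have [||_ _ [? ?] [? ?]] := nxtP (u k) => //; first by rewrite sk exprn_gt0 ?invr_gt0.
have nested (a : nat -> R) (l : R) : 0 <= l -> (forall k, a k <= a k.+1) ->
    (forall k, a k.+1 + (u k.+1).2 * l <= a k + (u k).2 * l) ->
    exists p, forall k, a k <= p <= a k + (u k).2 * l.
  (* Nested intervals: every left endpoint is below every right endpoint, so the supremum of the
     left endpoints lies in all of them. *)
  move=> l0 aM bM; exists (sup (range a)) => k.
  have aD i j : (i <= j)%N -> a i <= a j.
    by move=> /subnK <-; elim: (j - i)%N => // n /le_trans -> //; rewrite addSn.
  have bD i j : (i <= j)%N -> a j + (u j).2 * l <= a i + (u i).2 * l.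
    move=> /subnK <-; elim: (j - i)%N => // n; apply: le_trans.
    by rewrite addSn.
  have ab i j : a i <= a j + (u j).2 * l.
    apply: le_trans (aD _ _ (leq_maxl i j)) _.
    apply: le_trans _ (bD _ _ (leq_maxr i j)).
    by rewrite lerDl mulr_ge0// (uP _).2 exprn_ge0 ?invr_ge0.
  apply/andP; split; last by apply: ge_sup; [exists (a 0), 0|move=> _ [i _ <-]].
  apply: ub_le_sup; last by exists k.
  by exists (a k + (u k).2 * l) => _ [i _ <-].
have [p pP] : exists p, forall k, (u k).1.1 <= p <= (u k).1.1 + (u k).2 * w.
  by apply: (nested (fun k => (u k).1.1)) => // k; have [] := uM k.
have [q qP] : exists p, forall k, (u k).1.2 <= p <= (u k).1.2 + (u k).2 * h.
  by apply: (nested (fun k => (u k).1.2)) => // k; have [] := uM k.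
have [||r r0 rP] := Pl p q; [by have := pP 0; rewrite /= mul1r|by have := qP 0; rewrite /= mul1r|].
have [k kr] := exists_half_pow_lt r0.
have [nPk sk] := uP k; apply: nPk.
have bnd j : [/\ x0 <= (u j).1.1, (u j).1.1 + (u j).2 * w <= x0 + w, y0 <= (u j).1.2 &
   (u j).1.2 + (u j).2 * h <= y0 + h].
  elim: j => [|j [? ? ? ?]]; first by rewrite /= !mul1r.
  by have [? ? ? ?] := uM j; split; lra.
have [? ? ? ?] := bnd k.
by apply: rP => //; rewrite sk kr exprn_gt0.
Qed.

(** The one-dimensional case of [quartering], with rectangles of width 1 and height 0. *)
Lemma bisection (R : realType) (P : R -> R -> Prop) :
  (forall s m t, s < m < t -> P s m -> P m t -> P s t) ->
  (forall p, 0 <= p <= 1 -> exists2 r, 0 < r & forall s t, 0 <= s -> t <= 1 ->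
    s < t -> t - s < r -> s <= p <= t -> P s t) ->
  P 0 1.
Proof.
move=> Pq Pl; pose Q (x y s : R) := P x (x + s).
rewrite -[X in P 0 X]add0r -[P _ _]/(Q 0 0 1).
apply: (@quartering R 1 0 0 0 Q) => //.
  move=> x y s s0; rewrite /Q !mulr1 => P1 P2 _ _.
  have -> : x + s = x + s / 2 + s / 2 by lra.
  by apply: Pq P1 P2; lra.
move=> p q; rewrite add0r => p01 _; have [r r0 rP] := Pl p p01.
exists r => // x y s /andP[s0 sr] x0; rewrite mulr1 => xs _ _ xp _.
by apply: rP => //; lra.
Qed.

(** * Rules for continuity and complex derivatives *)

Section ComplexCalculus.
Context {R : realType}.
Implicit Types (z w d : R[i]) (f g : R[i] -> R[i]) (e r : R).

Definition ccont f z := forall e, 0 < e ->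
  exists2 r, 0 < r & forall w, cmod (w - z) < r -> cmod (f w - f z) <= e.

Lemma cderiv_lip f z d : cderiv f z d -> exists2 r, 0 < r &
  forall w, cmod (w - z) < r -> cmod (f w - f z) <= (cmod d + 1) * cmod (w - z).
Proof.
move=> /(_ 1 ltr01)[r r0 rP]; exists r => // w /rP le1.
have := cmodD (f w - f z - (w - z) * d) ((w - z) * d).
by rewrite subrK [cmod (_ * d)]cmodM; lra.
Qed.

Lemma cderiv_ccont f z d : cderiv f z d -> ccont f z.
Proof.
move=> /cderiv_lip[r r0 rP] e e0.
have d0 : 0 < cmod d + 1 by have := cmod_ge0 d; lra.
exists (Num.min r (e / (cmod d + 1))); first by rewrite lt_min r0 divr_gt0.
move=> w; rewrite lt_min => /andP[wr we]; apply: le_trans (rP w wr) _.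
by rewrite mulrC -ler_pdivlMr// ltW.
Qed.

Lemma ccont_cst c z : ccont (fun=> c) z.
Proof. by move=> e e0; exists 1 => // w _; rewrite subrr cmod0 ltW. Qed.

Lemma ccont_id z : ccont id z.
Proof. by move=> e e0; exists e => // w /ltW. Qed.

Lemma ccontD f g z : ccont f z -> ccont g z -> ccont (fun w => f w + g w) z.
Proof.
move=> fz gz e e0; have e20 : 0 < e / 2 by lra.
have [r r0 rP] := fz _ e20; have [r' r'0 r'P] := gz _ e20.
exists (Num.min r r'); first by rewrite lt_min r0.
move=> w; rewrite lt_min => /andP[/rP le1 /r'P le2].
rewrite opprD addrACA; apply: le_trans (cmodD _ _) _; lra.
Qed.

Lemma ccontM f g z : ccont f z -> ccont g z -> ccont (fun w => f w * g w) z.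
Proof.
move=> fz gz e e0.
set A := cmod (f z) + 1; set B := cmod (g z) + 1.
have A0 : 0 < A by have := cmod_ge0 (f z); rewrite /A; lra.
have B0 : 0 < B by have := cmod_ge0 (g z); rewrite /B; lra.
have [r1 r10 r1P] := fz _ ltr01.
have [|r r0 rP] := fz (e / 2 / B); first by rewrite !divr_gt0.
have [|r' r'0 r'P] := gz (e / 2 / A); first by rewrite !divr_gt0.
exists (Num.min r1 (Num.min r r')); first by rewrite !lt_min r10 r0.
move=> w; rewrite !lt_min => /and3P[/r1P le0 /rP le1 /r'P le2].
have -> : f w * g w - f z * g z = (f w - f z) * g z + f w * (g w - g z) by ring.
apply: le_trans (cmodD _ _) _; rewrite !cmodM [leRHS](splitr e) lerD//.
  by rewrite ler_pdivlMr// in le1; apply: le_trans le1; rewrite ler_wpM2l ?cmod_ge0// /B lerDl.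
have fA : cmod (f w) <= A.
  by rewrite /A -[f w](subrK (f z)); apply: le_trans (cmodD _ _) _; lra.
rewrite ler_pdivlMr// in le2.
apply: le_trans le2; rewrite mulrC ler_wpM2l ?cmod_ge0//.
Qed.

Lemma ccontV f z : f z != 0 -> ccont f z -> ccont (fun w => (f w)^-1) z.
Proof.
move=> fz0 fz e e0; set a := cmod (f z).
have a0 : 0 < a by rewrite cmod_gt0.
have [|r r0 rP] := fz (a / 2); first by rewrite divr_gt0.
have [|r' r'0 r'P] := fz (e * (a / 2 * a)); first by rewrite !mulr_gt0// divr_gt0.
exists (Num.min r r'); first by rewrite !lt_min r0.
move=> w; rewrite !lt_min => /andP[/rP le1 /r'P le2].
have fwa : a / 2 <= cmod (f w).
  by have := cmod_le_dist (f z) (f w); rewrite -/a; lra.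
have fw0 : f w != 0 by rewrite -cmod_gt0; lra.
have -> : (f w)^-1 - (f z)^-1 = - (f w - f z) / (f w * f z).
  by field; rewrite ?fw0 ?fz0.
rewrite cmodM cmodN cmodV cmodM ler_pdivrMr ?mulr_gt0 ?cmod_gt0//.
apply: le_trans le2 _; apply: ler_wpM2l; first exact: ltW.
by apply: ler_wpM2r => //; exact: ltW.
Qed.

Lemma cderiv_cst c z : cderiv (fun=> c) z 0.
Proof.
move=> e e0; exists 1 => // w _; rewrite subrr mulr0 subr0 cmod0.
by rewrite mulr_ge0 ?cmod_ge0 ?ltW.
Qed.

Lemma cderiv_id z : cderiv id z 1.
Proof.
move=> e e0; exists 1 => // w _; rewrite mulr1 subrr cmod0.
by rewrite mulr_ge0 ?cmod_ge0 ?ltW.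
Qed.

Lemma cderivD f g z d d' : cderiv f z d -> cderiv g z d' ->
  cderiv (fun w => f w + g w) z (d + d').
Proof.
move=> fz gz e e0; have e20 : 0 < e / 2 by lra.
have [r r0 rP] := fz _ e20; have [r' r'0 r'P] := gz _ e20.
exists (Num.min r r'); first by rewrite lt_min r0.
move=> w; rewrite lt_min => /andP[/rP le1 /r'P le2].
have -> : f w + g w - (f z + g z) - (w - z) * (d + d') =
  (f w - f z - (w - z) * d) + (g w - g z - (w - z) * d') by ring.
apply: le_trans (cmodD _ _) _; lra.
Qed.

Lemma cderivM f g z d d' : cderiv f z d -> cderiv g z d' ->
  cderiv (fun w => f w * g w) z (d * g z + f z * d').
Proof.
move=> fz gz e e0.
set A := cmod (f z) + 1; set B := cmod (g z) + 1.
have A0 : 0 < A by have := cmod_ge0 (f z); rewrite /A; lra.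
have B0 : 0 < B by have := cmod_ge0 (g z); rewrite /B; lra.
have d0 : 0 < cmod d + 1 by have := cmod_ge0 d; lra.
have e30 : 0 < e / 3 by lra.
have [|r r0 rP] := fz (e / 3 / B); first by rewrite !divr_gt0.
have [|r' r'0 r'P] := gz (e / 3 / A); first by rewrite !divr_gt0.
have [s s0 sP] := cderiv_lip fz.
have [|t t0 tP] := cderiv_ccont gz (e := e / 3 / (cmod d + 1)).
  by rewrite !divr_gt0.
exists (Num.min r (Num.min r' (Num.min s t))); first by rewrite !lt_min r0 r'0 s0.
move=> w; rewrite !lt_min => /and4P[/rP le1 /r'P le2 /sP le3 /tP le4].
have -> : f w * g w - f z * g z - (w - z) * (d * g z + f z * d') =
  (f w - f z - (w - z) * d) * g z + f z * (g w - g z - (w - z) * d')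
   + (f w - f z) * (g w - g z) by ring.
apply: le_trans (cmodD _ _) _; rewrite [cmod (_ * (g w - g z))]cmodM.
have := cmodD ((f w - f z - (w - z) * d) * g z) (f z * (g w - g z - (w - z) * d')).
rewrite !cmodM; set N := cmod (w - z) in le1 le2 le3 *.
have N0 : 0 <= N := cmod_ge0 _.
have h1 : cmod (f w - f z - (w - z) * d) * cmod (g z) <= e / 3 * N.
  have : cmod (f w - f z - (w - z) * d) * B <= e / 3 * N.
    by apply: le_trans (ler_wpM2r (ltW B0) le1) _; rewrite mulrAC divfK// gt_eqF.
  by apply: le_trans; rewrite ler_wpM2l ?cmod_ge0// /B lerDl.
have h2 : cmod (f z) * cmod (g w - g z - (w - z) * d') <= e / 3 * N.
  have : A * cmod (g w - g z - (w - z) * d') <= e / 3 * N.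
    apply: le_trans (ler_wpM2l (ltW A0) le2) _.
    by rewrite mulrA [A * _]mulrC divfK// gt_eqF.
  by apply: le_trans; rewrite ler_wpM2r ?cmod_ge0// /A lerDl.
have h3 : cmod (f w - f z) * cmod (g w - g z) <= e / 3 * N.
  apply: le_trans (ler_pM (cmod_ge0 _) (cmod_ge0 _) le3 le4) _.
  suff -> : (cmod d + 1) * N * (e / 3 / (cmod d + 1)) = e / 3 * N by [].
  by field; rewrite gt_eqF.
lra.
Qed.

Lemma cderivV f z d : f z != 0 -> cderiv f z d ->
  cderiv (fun w => (f w)^-1) z (- d / f z ^+ 2).
Proof.
move=> fz0 fz e e0; set a := cmod (f z).
have a0 : 0 < a by rewrite cmod_gt0.
have d0 : 0 < cmod d + 1 by have := cmod_ge0 d; lra.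
have e20 : 0 < e / 2 by lra.
have [|r r0 rP] := fz (e / 2 * a ^+ 2); first by rewrite mulr_gt0 ?exprn_gt0.
have [s s0 sP] := cderiv_lip fz.
have [|t t0 tP] := cderiv_ccont fz (e := a / 2); first by lra.
have [|t' t'0 t'P] := cderiv_ccont fz (e := e / 2 * (a / 2 * a ^+ 2) / (cmod d + 1)).
  by rewrite divr_gt0// !mulr_gt0 ?exprn_gt0//; lra.
exists (Num.min r (Num.min s (Num.min t t'))); first by rewrite !lt_min r0 s0 t0.
move=> w; rewrite !lt_min => /and4P[/rP le1 /sP le2 /tP le3 /t'P le4].
have fwa : a / 2 <= cmod (f w).
  by have := cmod_le_dist (f z) (f w); rewrite -/a; lra.
have fw0 : f w != 0 by rewrite -cmod_gt0; lra.
(* The remainder of 1 / f is that of f over - f(z)^2, plus a term quadratic in [f w - f z]; each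
   gets half of the error. *)
have -> : (f w)^-1 - (f z)^-1 - (w - z) * (- d / f z ^+ 2) =
    - (f w - f z - (w - z) * d) / f z ^+ 2 + (f w - f z) * (f w - f z) / (f w * f z ^+ 2).
  by field; rewrite ?fw0 ?fz0.
apply: le_trans (cmodD _ _) _; rewrite [leRHS](_ : _ = e / 2 * cmod (w - z) + e / 2 * cmod (w - z)); last by lra.
apply: lerD.
  rewrite cmodM cmodN cmodV cmodX -/a ler_pdivrMr ?exprn_gt0//.
  by apply: le_trans le1 _; rewrite mulrAC.
rewrite !cmodM cmodV cmodM cmodX -/a ler_pdivrMr ?mulr_gt0 ?exprn_gt0 ?cmod_gt0//.
apply: le_trans (ler_pM (cmod_ge0 _) (cmod_ge0 _) le2 le4) _.
have -> : (cmod d + 1) * cmod (w - z) * (e / 2 * (a / 2 * a ^+ 2) / (cmod d + 1)) =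
  e / 2 * cmod (w - z) * (a / 2 * a ^+ 2) by field; rewrite gt_eqF.
apply: ler_wpM2l; first by rewrite mulr_ge0 ?cmod_ge0// ltW.
by apply: ler_wpM2r => //; rewrite exprn_ge0// ltW.
Qed.

End ComplexCalculus.

(** * Integrals along segments *)

Lemma real_primitive (R : realType) (f : R -> R) :
  (forall t, 0 <= t <= 1 -> forall e, 0 < e -> exists2 r, 0 < r &
    forall s, 0 <= s <= 1 -> `|s - t| < r -> `|f s - f t| <= e) ->
  exists F : R -> R, forall t, 0 <= t <= 1 -> forall e, 0 < e ->
    exists2 r, 0 < r & forall s, `|s - t| < r ->
      `|F s - F t - (s - t) * f t| <= e * `|s - t|.
Proof.
(* Composition with the 1-Lipschitz retraction onto [0, 1] extends f to a continuous function on the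
   line. *)
move=> fc; pose cl (t : R) := Num.max 0 (Num.min 1 t).
have cl01 t : 0 <= cl t <= 1.
  by rewrite /cl le_max lexx/= ge_max ler01/= ge_min lexx.
have clE t : 0 <= t <= 1 -> cl t = t.
  by move=> /andP[t0 t1]; rewrite /cl min_r// max_r.
have cl_lip s t : `|cl s - cl t| <= `|s - t|.
  wlog st : s t / s <= t.
    by move=> H; case: (leP s t) => [/H//|/ltW /H]; rewrite distrC [X in _ <= X]distrC.
  rewrite distrC [X in _ <= X]distrC [X in _ <= X]ger0_norm ?subr_ge0//.
  rewrite ger0_norm /cl; case: (leP 1 s) => hs; case: (leP 1 t) => ht;
  rewrite ?(max_r ler01); case: (leP 0 s) => ?; case: (leP 0 t) => ?; lra.
pose g t := f (cl t).
have gc : continuous g.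
  move=> t; apply/cvgrPdist_le => /= e e0.
  have [r r0 rP] := fc _ (cl01 t) e e0.
  apply/nbhs_ballP; exists r => //= s ts.
  have {}ts : `|t - s| < r by [].
  rewrite distrC; apply: rP => //.
  by apply: le_lt_trans (cl_lip _ _) _; rewrite distrC.
(* Integrating from -1, inside [-1, 2], makes 0 and 1 interior points for the fundamental theorem,
   so the derivative there is two-sided. *)
exists (fun x => \int[lebesgue_measure]_(t in [set` `[(-1), x]]) (g t))%R.
move=> t t01 e e0.
have [||||dF FE] := @continuous_FTC1_closed R g (-1) t 2 _ _.
- by lra.
- apply: continuous_compact_integrable; first exact: segment_compact.
  exact: continuous_subspaceT.
- by lra.
- exact: gc.
rewrite derive1E /g clE// in FE.
have [r r0 rP] := derivable_eps dF e0.
by exists r => // s /rP; rewrite FE.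
Qed.

Section Integral.
Context {R : realType}.
Implicit Types (f g F G : R -> R[i]) (e r s t : R).

Definition pcont f := forall t, 0 <= t <= 1 -> forall e, 0 < e ->
  exists2 r, 0 < r & forall s, 0 <= s <= 1 -> `|s - t| < r -> cmod (f s - f t) <= e.

Definition prim F f := forall t, 0 <= t <= 1 -> forall e, 0 < e ->
  exists2 r, 0 < r & forall s, 0 <= s <= 1 -> `|s - t| < r ->
    cmod (F s - F t - (s - t)%:C * f t) <= e * `|s - t|.

Lemma prim_exists f : pcont f -> exists F, prim F f.
Proof.
move=> fc.
have [|F1 F1P] := @real_primitive R (fun t => Re (f t)).
  move=> t t01 e e0; have [r r0 rP] := fc t t01 e e0; exists r => // s s01 st.
  by apply: le_trans (rP s s01 st); rewrite -raddfB; exact: cmod_Re.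
have [|F2 F2P] := @real_primitive R (fun t => Im (f t)).
  move=> t t01 e e0; have [r r0 rP] := fc t t01 e e0; exists r => // s s01 st.
  by apply: le_trans (rP s s01 st); rewrite -raddfB; exact: cmod_Im.
exists (fun t => F1 t +i* F2 t) => t t01 e e0.
have e20 : 0 < e / 2 by lra.
have [r r0 rP] := F1P t t01 _ e20; have [r' r'0 r'P] := F2P t t01 _ e20.
exists (Num.min r r'); first by rewrite lt_min r0.
move=> s _; rewrite lt_min => /andP[/rP le1 /r'P le2].
apply: le_trans (cmod_ReIm _) _.
move: le1 le2; case: (f t) => a b /=; rewrite !mul0r subr0 addr0 => le1 le2.
lra.
Qed.

(** A mean value inequality for one real component. Up to a slope e it holds on short intervals
    around each point, and it is additive in the interval, so bisection applies. The factor c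
    selects the component: the direction of [F 1 - F 0] in [prim_le], the imaginary part in
    [winding_neq0]. *)
Lemma prim_Re_le F f (c : R[i]) M : prim F f ->
  (forall t, 0 <= t <= 1 -> Re (c * f t) <= M) -> Re (c * (F 1 - F 0)) <= M.
Proof.
move=> Ff fM; apply/ler_addgt0Pl => e e0.
suff : Re (c * (F 1 - F 0)) <= (e + M) * (1 - 0) by rewrite subr0 mulr1.
apply: (@bisection R (fun s t => Re (c * (F t - F s)) <= (e + M) * (t - s))).
  move=> s m t _ h1 h2; rewrite -(subrKA (F m)) mulrDr raddfD /=; lra.
move=> p p01.
have c0 : 0 < cmod c + 1 by have := cmod_ge0 c; lra.
have [|r r0 rP] := Ff p p01 (e / (cmod c + 1)); first by rewrite divr_gt0.
exists r => // s t s0 t1 st str /andP[sp pt].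
have := rP s; rewrite [`|s - p|]distrC ger0_norm; last by lra.
move=> /(_ _ _) le1; have {}le1 := le1 ltac:(by lra) ltac:(by lra).
have := rP t; rewrite ger0_norm; last by lra.
move=> /(_ _ _) le2; have {}le2 := le2 ltac:(by lra) ltac:(by lra).
set A := F s - F p - _ in le1; set B := F t - F p - _ in le2.
have -> : F t - F s = B - A + (t - s)%:C * f p.
  by rewrite /A /B !rmorphB/=; ring.
rewrite mulrDr raddfD /= mulrCA.
have -> : Re ((t - s)%:C * (c * f p)) = (t - s) * Re (c * f p).
  by case: (c * f p) => a b /=; rewrite mul0r subr0.
have h1 : (t - s) * Re (c * f p) <= (t - s) * M by rewrite ler_wpM2l ?fM//; lra.
have h2 : Re (c * (B - A)) <= (cmod c + 1) * (e / (cmod c + 1) * (t - s)).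
  apply: le_trans (ler_norm _) _; apply: le_trans (cmod_Re _) _.
  rewrite cmodM; apply: ler_pM; rewrite ?cmod_ge0// ?lerDl//.
  by apply: le_trans (cmodB _ _) _; lra.
suff h3 : (cmod c + 1) * (e / (cmod c + 1) * (t - s)) = e * (t - s) by lra.
by field; rewrite gt_eqF.
Qed.

Lemma prim_le F f M : prim F f -> (forall t, 0 <= t <= 1 -> cmod (f t) <= M) ->
  cmod (F 1 - F 0) <= M.
Proof.
move=> Ff fM; set v := F 1 - F 0.
have [->|v0] := eqVneq v 0.
  by rewrite cmod0; apply: le_trans (fM 0 _); rewrite ?cmod_ge0// lexx ler01.
(* The unimodular factor that rotates [F 1 - F 0] onto the positive real axis. *)
have c1 : cmod ((cmod v)%:C / v) = 1.
  by rewrite cmodM cmodV cmod_real ger0_norm ?cmod_ge0// divff// cmod_eq0.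
have := @prim_Re_le F f ((cmod v)%:C / v) M Ff; rewrite divfK//=; apply.
move=> t /fM; apply: le_trans; apply: le_trans (ler_norm _) _.
by apply: le_trans (cmod_Re _) _; rewrite cmodM c1 mul1r.
Qed.

Lemma primD F G f g : prim F f -> prim G g -> prim (fun t => F t + G t) (fun t => f t + g t).
Proof.
move=> Ff Gg t t01 e e0; have e20 : 0 < e / 2 by lra.
have [r r0 rP] := Ff t t01 _ e20; have [r' r'0 r'P] := Gg t t01 _ e20.
exists (Num.min r r'); first by rewrite lt_min r0.
move=> s s01; rewrite lt_min => /andP[/(rP _ s01) le1 /(r'P _ s01) le2].
have -> : F s + G s - (F t + G t) - (s - t)%:C * (f t + g t) =
  (F s - F t - (s - t)%:C * f t) + (G s - G t - (s - t)%:C * g t) by ring.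
apply: le_trans (cmodD _ _) _; lra.
Qed.

Lemma primZ F f c : prim F f -> prim (fun t => c * F t) (fun t => c * f t).
Proof.
move=> Ff t t01 e e0.
have c0 : 0 < cmod c + 1 by have := cmod_ge0 c; lra.
have [|r r0 rP] := Ff t t01 (e / (cmod c + 1)); first by rewrite divr_gt0.
exists r => // s s01 /(rP _ s01) le1.
have -> : c * F s - c * F t - (s - t)%:C * (c * f t) =
  c * (F s - F t - (s - t)%:C * f t) by ring.
rewrite cmodM; apply: le_trans (_ : (cmod c + 1) * (e / (cmod c + 1) * `|s - t|) <= _).
  by apply: ler_pM; rewrite ?cmod_ge0// lerDl.
by rewrite mulrA [(_ + 1) * _]mulrC divfK// gt_eqF.
Qed.

Lemma prim_uniq F G f : prim F f -> prim G f -> F 1 - F 0 = G 1 - G 0.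
Proof.
move=> Ff Gf; apply/eqP; rewrite -subr_eq0 -cmod_eq0 eq_le cmod_ge0 andbT.
have -> : F 1 - F 0 - (G 1 - G 0) = (F 1 + - 1 * G 1) - (F 0 + - 1 * G 0) by ring.
apply: (prim_le (primD Ff (primZ (- 1) Gf))) => t _.
by rewrite mulN1r subrr cmod0.
Qed.

(** Meaningful only if f has a primitive on [0, 1], e.g. if f is continuous. *)
Definition cint f : R[i] :=
  let F := xget (fun=> 0) [set F | prim F f] in F 1 - F 0.

Lemma cintE F f : prim F f -> cint f = F 1 - F 0.
Proof.
move=> Ff; have h : prim (xget (fun=> 0) [set F | prim F f]) f.
  by apply: (@xgetPex _ (fun=> 0) [set F | prim F f]); exists F.
exact: prim_uniq h Ff.
Qed.

Lemma cint_ext f g : (forall t, 0 <= t <= 1 -> f t = g t) -> cint f = cint g.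
Proof.
move=> fg; rewrite /cint.
suff -> : [set F | prim F f] = [set F | prim F g] by [].
apply/seteqP; split=> F Ff t t01 e e0; have [r r0 rP] := Ff t t01 e e0;
  exists r => // s s01 /(rP _ s01); first by rewrite fg.
by rewrite -fg.
Qed.

Lemma pcont_bounded f : pcont f ->
  exists2 M, 0 < M & forall t, 0 <= t <= 1 -> cmod (f t) <= M.
Proof.
move=> fc; pose P s t := exists2 M, 0 < M & forall x, s <= x <= t -> cmod (f x) <= M.
apply: (@bisection R P).
  move=> s m t _ [M M0 MP] [N N0 NP]; exists (M + N); first exact: addr_gt0.
  move=> x /andP[sx xt]; case: (leP x m) => xm.
    by apply: le_trans (MP x _) _; rewrite ?sx// lerDl ltW.
  by apply: le_trans (NP x _) _; rewrite ?xt ?ltW// ltrDr.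
move=> p p01; have [r r0 rP] := fc p p01 1 ltr01; exists r => // s t s0 t1 st str spt.
exists (cmod (f p) + 1); first by have := cmod_ge0 (f p); lra.
move=> x sxt; have := cmod_le_dist (f x) (f p); rewrite cmod_distC.
have := rP x ltac:(by lra) _; suff -> : `|x - p| < r by move=> /(_ isT); lra.
by rewrite ltr_norml; apply/andP; split; lra.
Qed.

End Integral.

Section SegmentIntegral.
Context {R : realType}.
Implicit Types (p q z w : R[i]) (u v : R[i] -> R[i]) (e r s t : R).

Definition seg p q t : R[i] := p + t%:C * (q - p).

Lemma seg0 p q : seg p q 0 = p. Proof. by rewrite /seg mul0r addr0. Qed.

Lemma seg1 p q : seg p q 1 = q. Proof. by rewrite /seg mul1r addrC subrK. Qed.

Lemma segB p q s t : seg p q t - seg p q s = (t - s)%:C * (q - p).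
Proof. by rewrite /seg rmorphB /=; ring. Qed.

Lemma seg_sub p q a b t : seg (seg p q a) (seg p q b) t = seg p q (a + t * (b - a)).
Proof. by rewrite /seg rmorphD rmorphM rmorphB /=; ring. Qed.

(** Continuity in the plane at the points of the segment, not merely along it: the integrands are
    holomorphic near their contours. *)
Definition scont p q u := forall t, 0 <= t <= 1 -> ccont u (seg p q t).

Definition sint p q u : R[i] := cint (fun t => (q - p) * u (seg p q t)).

Lemma scont_pcont p q u : scont p q u -> pcont (fun t => (q - p) * u (seg p q t)).
Proof.
move=> uc t t01 e e0; have c0 : 0 < cmod (q - p) + 1 by have := cmod_ge0 (q - p); lra.
have [|r r0 rP] := uc t t01 (e / (cmod (q - p) + 1)); first by rewrite divr_gt0.
exists (r / (cmod (q - p) + 1)); first by rewrite divr_gt0.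
move=> s _ st; rewrite -mulrBr cmodM.
apply: le_trans (_ : (cmod (q - p) + 1) * (e / (cmod (q - p) + 1)) <= _); last first.
  by rewrite mulrC divfK// gt_eqF.
apply: ler_pM; rewrite ?cmod_ge0 ?lerDl//; apply: rP.
rewrite segB cmodM cmod_real; rewrite ltr_pdivlMr// in st.
by apply: le_lt_trans st; rewrite ler_wpM2l// lerDl.
Qed.

Lemma sint_prim p q u : scont p q u ->
  exists F, prim F (fun t => (q - p) * u (seg p q t)).
Proof. by move=> /scont_pcont/prim_exists. Qed.

Lemma scontD p q u v : scont p q u -> scont p q v -> scont p q (fun z => u z + v z).
Proof. by move=> uc vc t t01; apply: ccontD; [exact: uc|exact: vc]. Qed.

Lemma scontZ p q u c : scont p q u -> scont p q (fun z => c * u z).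
Proof. by move=> uc t t01; apply: ccontM; [exact: ccont_cst|exact: uc]. Qed.

Lemma sint_ext p q u v : (forall t, 0 <= t <= 1 -> u (seg p q t) = v (seg p q t)) ->
  sint p q u = sint p q v.
Proof. by move=> uv; apply: cint_ext => t t01; rewrite uv. Qed.

Lemma eq_prim (F f g : R -> R[i]) : (forall t, f t = g t) -> prim F f -> prim F g.
Proof. by move=> /funext ->. Qed.

Lemma sintD p q u v : scont p q u -> scont p q v ->
  sint p q (fun z => u z + v z) = sint p q u + sint p q v.
Proof.
move=> /sint_prim[F Fu] /sint_prim[G Gv].
rewrite {2}/sint (cintE Fu) /sint (cintE Gv).
have H := eq_prim (fun t => esym (mulrDr _ _ _)) (primD Fu Gv).
by rewrite (cintE H); ring.
Qed.

Lemma sintZ p q u c : scont p q u -> sint p q (fun z => c * u z) = c * sint p q u.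
Proof.
move=> /sint_prim[F Fu]; rewrite {2}/sint (cintE Fu) /sint.
have H := eq_prim (fun t => mulrCA _ _ _) (primZ c Fu).
by rewrite (cintE H); ring.
Qed.

Lemma sint_le p q u M : scont p q u ->
  (forall t, 0 <= t <= 1 -> cmod (u (seg p q t)) <= M) ->
  cmod (sint p q u) <= cmod (q - p) * M.
Proof.
move=> /sint_prim[F Fu] uM; rewrite /sint (cintE Fu); apply: prim_le Fu _ => t /uM ?.
by rewrite cmodM ler_wpM2l ?cmod_ge0.
Qed.

Lemma sint_Re_le p q u c M : scont p q u ->
  (forall t, 0 <= t <= 1 -> Re (c * ((q - p) * u (seg p q t))) <= M) ->
  Re (c * sint p q u) <= M.
Proof. by move=> /sint_prim[F Fu] uM; rewrite /sint (cintE Fu); exact: prim_Re_le Fu _. Qed.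

Lemma sint_FTC p q u F : (forall t, 0 <= t <= 1 -> cderiv F (seg p q t) (u (seg p q t))) ->
  sint p q u = F q - F p.
Proof.
move=> Fu; have FP : prim (fun t => F (seg p q t)) (fun t => (q - p) * u (seg p q t)).
  move=> t t01 e e0; have c0 : 0 < cmod (q - p) + 1 by have := cmod_ge0 (q - p); lra.
  have [|r r0 rP] := Fu t t01 (e / (cmod (q - p) + 1)); first by rewrite divr_gt0.
  exists (r / (cmod (q - p) + 1)); first by rewrite divr_gt0.
  move=> s _ st; have := rP (seg p q s); rewrite segB -mulrA => le1.
  apply: le_trans (le1 _) _.
    rewrite cmodM cmod_real.
    rewrite ltr_pdivlMr// in st; apply: le_lt_trans st.
    by rewrite ler_wpM2l// lerDl.
  have h : e / (cmod (q - p) + 1) * cmod (q - p) <= e.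
    by rewrite mulrAC ler_pdivrMr// ler_wpM2l ?lerDl// ltW.
  by rewrite cmodM cmod_real [_ * cmod _]mulrC mulrA ler_wpM2r.
by rewrite /sint (cintE FP) seg1 seg0.
Qed.

Lemma prim_affine (F f : R -> R[i]) a b : 0 <= a -> a <= b -> b <= 1 -> prim F f ->
  prim (fun t => F (a + t * (b - a))) (fun t => (b - a)%:C * f (a + t * (b - a))).
Proof.
move=> a0 ab b1 Ff t /andP[t0 t1] e e0.
have aff s : 0 <= s <= 1 -> 0 <= a + s * (b - a) <= 1.
  move=> /andP[s0 s1]; apply/andP; split.
    by rewrite addr_ge0// mulr_ge0// subr_ge0.
  apply: le_trans b1; rewrite -lerBrDl ler_piMl// subr_ge0//.
have [|r r0 rP] := Ff (a + t * (b - a)) _ e e0; first by rewrite aff// t0.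
exists r => // s s01 st; have := rP (a + s * (b - a)) (aff s s01).
rewrite (_ : a + s * (b - a) - _ = (s - t) * (b - a)); last by ring.
rewrite normrM [`|b - a|]ger0_norm ?subr_ge0// => le1.
have h : `|s - t| * (b - a) <= `|s - t| by rewrite ler_piMr//; lra.
rewrite mulrA -rmorphM; apply: le_trans (le1 _) _; first exact: le_lt_trans st.
by rewrite ler_wpM2l// ltW.
Qed.

Lemma sint_sub p q u a b F : prim F (fun t => (q - p) * u (seg p q t)) ->
  0 <= a -> a <= b -> b <= 1 -> sint (seg p q a) (seg p q b) u = F b - F a.
Proof.
move=> Fu a0 ab b1.
have H := prim_affine a0 ab b1 Fu.
have {}H : prim (fun t => F (a + t * (b - a)))
   (fun t => (seg p q b - seg p q a) * u (seg (seg p q a) (seg p q b) t)).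
  by apply: eq_prim H => t; rewrite segB seg_sub mulrA.
by rewrite /sint (cintE H) mul1r mul0r addr0 [a + _]addrC subrK.
Qed.

Lemma scont_sub p q u a b : 0 <= a -> a <= b -> b <= 1 ->
  scont p q u -> scont (seg p q a) (seg p q b) u.
Proof.
move=> a0 ab b1 uc t /andP[t0 t1]; rewrite seg_sub; apply: uc; apply/andP; split.
  by rewrite addr_ge0// mulr_ge0// subr_ge0.
apply: le_trans b1; rewrite -lerBrDl ler_piMl// subr_ge0//.
Qed.

Lemma sint_split p q u a b c : 0 <= a -> a <= b -> b <= c -> c <= 1 -> scont p q u ->
  sint (seg p q a) (seg p q c) u =
  sint (seg p q a) (seg p q b) u + sint (seg p q b) (seg p q c) u.
Proof.
move=> a0 ab bc c1 /sint_prim[F Fu].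
rewrite !(sint_sub Fu)//; [by ring|lra..].
Qed.

Lemma seg_bounded p q u : scont p q u ->
  exists2 M, 0 < M & forall t, 0 <= t <= 1 -> cmod (u (seg p q t)) <= M.
Proof.
move=> uc; have pc : pcont (fun t => u (seg p q t)).
  move=> t t01 e e0; have c0 : 0 < cmod (q - p) + 1 by have := cmod_ge0 (q - p); lra.
  have [|r r0 rP] := uc t t01 e; first by [].
  exists (r / (cmod (q - p) + 1)); first by rewrite divr_gt0.
  move=> s _ st; apply: rP; rewrite segB cmodM cmod_real.
  rewrite ltr_pdivlMr// in st; apply: le_lt_trans st.
  by rewrite ler_wpM2l// lerDl.
exact: pcont_bounded pc.
Qed.

End SegmentIntegral.

(** * Integrals along rectangles *)

Section RectangleIntegral.
Context {R : realType}.
Implicit Types (p q z w d : R[i]) (u v : R[i] -> R[i]) (e r s t x y : R).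

Lemma cderiv_eq u z d d' : cderiv u z d -> d = d' -> cderiv u z d'.
Proof. by move=> ? <-. Qed.

Lemma sintpp p u : sint p p u = 0.
Proof.
suff H : prim (fun=> 0) (fun t => (p - p) * u (seg p p t)).
  by rewrite /sint (cintE H) subrr.
move=> t _ e e0; exists 1 => // s _ _.
by rewrite !subrr mul0r mulr0 subrr cmod0 mulr_ge0// ltW.
Qed.

Lemma seg_horiz x1 x2 y t : seg (x1 +i* y) (x2 +i* y) t = (x1 + t * (x2 - x1)) +i* y.
Proof. by rewrite /seg; simpc; congr (_ +i* _); ring. Qed.

Lemma seg_vert x y1 y2 t : seg (x +i* y1) (x +i* y2) t = x +i* (y1 + t * (y2 - y1)).
Proof. by rewrite /seg; simpc; congr (_ +i* _); ring. Qed.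

Definition crect x1 x2 y1 y2 : set R[i] :=
  [set z | (x1 <= Re z <= x2) /\ (y1 <= Im z <= y2)].

Definition orect x1 x2 y1 y2 : set R[i] :=
  [set z | (x1 < Re z < x2) /\ (y1 < Im z < y2)].

Definition rbdry x1 x2 y1 y2 : set R[i] :=
  crect x1 x2 y1 y2 `\` orect x1 x2 y1 y2.

(** The integral along the boundary, counterclockwise. *)
Definition rint x1 x2 y1 y2 u : R[i] :=
  sint (x1 +i* y1) (x2 +i* y1) u + sint (x2 +i* y1) (x2 +i* y2) u
  - sint (x1 +i* y2) (x2 +i* y2) u - sint (x1 +i* y1) (x1 +i* y2) u.

Lemma itv_affine x1 x2 t : x1 <= x2 -> 0 <= t <= 1 -> x1 <= x1 + t * (x2 - x1) <= x2.
Proof.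
move=> x12 /andP[t0 t1]; apply/andP; split.
  by rewrite lerDl mulr_ge0// subr_ge0.
by rewrite -lerBrDl ler_piMl// subr_ge0.
Qed.

Section Fixed.
Variables (x1 x2 y1 y2 : R).
Hypotheses (x12 : x1 <= x2) (y12 : y1 <= y2).

Lemma rbdry_bottom t : 0 <= t <= 1 -> rbdry x1 x2 y1 y2 (seg (x1 +i* y1) (x2 +i* y1) t).
Proof.
move=> t01; rewrite seg_horiz; split; rewrite /crect /orect /=.
  by rewrite lexx y12 itv_affine.
by rewrite ltxx => -[].
Qed.

Lemma rbdry_top t : 0 <= t <= 1 -> rbdry x1 x2 y1 y2 (seg (x1 +i* y2) (x2 +i* y2) t).
Proof.
move=> t01; rewrite seg_horiz; split; rewrite /crect /orect /=.
  by rewrite lexx y12 itv_affine.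
by rewrite ltxx andbF => -[].
Qed.

Lemma rbdry_left t : 0 <= t <= 1 -> rbdry x1 x2 y1 y2 (seg (x1 +i* y1) (x1 +i* y2) t).
Proof.
move=> t01; rewrite seg_vert; split; rewrite /crect /orect /=.
  by rewrite lexx x12 itv_affine.
by rewrite ltxx => -[].
Qed.

Lemma rbdry_right t : 0 <= t <= 1 -> rbdry x1 x2 y1 y2 (seg (x2 +i* y1) (x2 +i* y2) t).
Proof.
move=> t01; rewrite seg_vert; split; rewrite /crect /orect /=.
  by rewrite lexx x12 itv_affine.
by rewrite ltxx andbF => -[].
Qed.

Definition rcont u := forall z, rbdry x1 x2 y1 y2 z -> ccont u z.

Lemma rcont_bottom u : rcont u -> scont (x1 +i* y1) (x2 +i* y1) u.
Proof. by move=> uc t /rbdry_bottom/uc. Qed.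

Lemma rcont_top u : rcont u -> scont (x1 +i* y2) (x2 +i* y2) u.
Proof. by move=> uc t /rbdry_top/uc. Qed.

Lemma rcont_left u : rcont u -> scont (x1 +i* y1) (x1 +i* y2) u.
Proof. by move=> uc t /rbdry_left/uc. Qed.

Lemma rcont_right u : rcont u -> scont (x2 +i* y1) (x2 +i* y2) u.
Proof. by move=> uc t /rbdry_right/uc. Qed.

Lemma rint_ext u v : (forall z, rbdry x1 x2 y1 y2 z -> u z = v z) ->
  rint x1 x2 y1 y2 u = rint x1 x2 y1 y2 v.
Proof.
move=> uv; rewrite /rint; congr (_ + _ - _ - _); apply: sint_ext => t t01; apply: uv.
- exact: rbdry_bottom.
- exact: rbdry_right.
- exact: rbdry_top.
- exact: rbdry_left.
Qed.

Lemma rintD u v : rcont u -> rcont v -> rint x1 x2 y1 y2 (fun z => u z + v z) =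
  rint x1 x2 y1 y2 u + rint x1 x2 y1 y2 v.
Proof.
move=> uc vc; rewrite /rint !sintD;
  try (by apply: rcont_bottom); try (by apply: rcont_top);
  try (by apply: rcont_left); try (by apply: rcont_right).
by ring.
Qed.

Lemma rintZ u c : rcont u -> rint x1 x2 y1 y2 (fun z => c * u z) =
  c * rint x1 x2 y1 y2 u.
Proof.
move=> uc; rewrite /rint !sintZ;
  try (by apply: rcont_bottom); try (by apply: rcont_top);
  try (by apply: rcont_left); try (by apply: rcont_right).
by ring.
Qed.

Lemma cmod_horiz y : cmod ((x2 +i* y) - (x1 +i* y)) = x2 - x1.
Proof.
have -> : (x2 +i* y) - (x1 +i* y) = (x2 - x1)%:C by apply/eqP; rewrite eq_complex /= subrr !eqxx.
by rewrite cmod_real ger0_norm ?subr_ge0.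
Qed.

Lemma cmod_vert x : cmod ((x +i* y2) - (x +i* y1)) = y2 - y1.
Proof.
have -> : (x +i* y2) - (x +i* y1) = 'i * (y2 - y1)%:C.
  by apply/eqP; rewrite eq_complex /=; apply/andP; split; apply/eqP; ring.
rewrite cmodM cmod_real ger0_norm ?subr_ge0//.
by rewrite /cmod /= expr0n expr1n add0r sqrtr1 mul1r.
Qed.

Lemma rint_le u M : rcont u -> (forall z, rbdry x1 x2 y1 y2 z -> cmod (u z) <= M) ->
  cmod (rint x1 x2 y1 y2 u) <= 2 * ((x2 - x1) + (y2 - y1)) * M.
Proof.
move=> uc uM.
have h1 := sint_le (rcont_bottom uc) (fun t t01 => uM _ (rbdry_bottom t01)).
have h2 := sint_le (rcont_top uc) (fun t t01 => uM _ (rbdry_top t01)).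
have h3 := sint_le (rcont_left uc) (fun t t01 => uM _ (rbdry_left t01)).
have h4 := sint_le (rcont_right uc) (fun t t01 => uM _ (rbdry_right t01)).
rewrite !cmod_horiz !cmod_vert in h1 h2 h3 h4.
rewrite /rint; apply: le_trans (cmodB _ _) _.
have h5 := cmodB (sint (x1 +i* y1) (x2 +i* y1) u + sint (x2 +i* y1) (x2 +i* y2) u)
  (sint (x1 +i* y2) (x2 +i* y2) u).
have h6 := cmodD (sint (x1 +i* y1) (x2 +i* y1) u) (sint (x2 +i* y1) (x2 +i* y2) u).
lra.
Qed.

Lemma rint_FTC u F : (forall z, rbdry x1 x2 y1 y2 z -> cderiv F z (u z)) ->
  rint x1 x2 y1 y2 u = 0.
Proof.
move=> Fu; rewrite /rint !(@sint_FTC _ _ _ _ F); first by ring.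
- by move=> t /rbdry_left/Fu.
- by move=> t /rbdry_top/Fu.
- by move=> t /rbdry_right/Fu.
- by move=> t /rbdry_bottom/Fu.
Qed.

Lemma rint_cutx u m : x1 <= m <= x2 -> rcont u ->
  rint x1 x2 y1 y2 u = rint x1 m y1 y2 u + rint m x2 y1 y2 u.
Proof.
move=> /andP[x1m mx2] uc.
have H y : scont (x1 +i* y) (x2 +i* y) u -> sint (x1 +i* y) (x2 +i* y) u =
    sint (x1 +i* y) (m +i* y) u + sint (m +i* y) (x2 +i* y) u.
  move=> ucy; move: x12; rewrite le_eqVlt => /orP[/eqP E|x12'].
    have -> : m = x1 by lra.
    by rewrite sintpp add0r.
  have x21 : 0 < x2 - x1 by lra.
  have := @sint_split R (x1 +i* y) (x2 +i* y) u 0 ((m - x1) / (x2 - x1)) 1 (lexx _) _ _ (lexx _) ucy.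
  rewrite seg0 seg1 seg_horiz divfK ?gt_eqF// [x1 + _]addrC subrK; apply.
    by apply: divr_ge0; lra.
  by rewrite ler_pdivrMr//; lra.
rewrite /rint (H _ (rcont_bottom uc)) (H _ (rcont_top uc)); ring.
Qed.

Lemma rint_cuty u m : y1 <= m <= y2 -> rcont u ->
  rint x1 x2 y1 y2 u = rint x1 x2 y1 m u + rint x1 x2 m y2 u.
Proof.
move=> /andP[x1m mx2] uc.
have H x : scont (x +i* y1) (x +i* y2) u -> sint (x +i* y1) (x +i* y2) u =
    sint (x +i* y1) (x +i* m) u + sint (x +i* m) (x +i* y2) u.
  move=> ucy; move: y12; rewrite le_eqVlt => /orP[/eqP E|y12'].
    have -> : m = y1 by lra.
    by rewrite sintpp add0r.
  have y21 : 0 < y2 - y1 by lra.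
  have := @sint_split R (x +i* y1) (x +i* y2) u 0 ((m - y1) / (y2 - y1)) 1 (lexx _) _ _ (lexx _) ucy.
  rewrite seg0 seg1 seg_vert divfK ?gt_eqF// [y1 + _]addrC subrK; apply.
    by apply: divr_ge0; lra.
  by rewrite ler_pdivrMr//; lra.
rewrite /rint (H _ (rcont_left uc)) (H _ (rcont_right uc)); ring.
Qed.

End Fixed.

(** The affine approximation of u at [z0] has a quadratic primitive and contributes nothing to the
    integral; what is left is at most [e * l] on a boundary of length at most [2 * l]. *)
Lemma rint_local u z0 d e : cderiv u z0 d -> 0 < e -> exists2 r, 0 < r &
  forall x1 x2 y1 y2 l, x1 <= x2 -> y1 <= y2 -> (x2 - x1) + (y2 - y1) <= l -> l < r ->
  crect x1 x2 y1 y2 z0 -> rcont x1 x2 y1 y2 u ->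
  cmod (rint x1 x2 y1 y2 u) <= 2 * l * (e * l).
Proof.
move=> ud e0; have [r r0 rP] := ud e e0; exists r => // x1 x2 y1 y2 l x12 y12 ll lr [z0x z0y] uc.
pose A z := u z0 + (z - z0) * d.
have Ad z : cderiv A z d.
  apply: cderiv_eq (cderivD (cderiv_cst (u z0) z)
    (cderivM (cderivD (cderiv_id z) (cderiv_cst (- z0) z)) (cderiv_cst d z))) _.
  by ring.
have A0 : rint x1 x2 y1 y2 A = 0.
  apply: (@rint_FTC _ _ _ _ x12 y12 A (fun z => u z0 * z + d / 2 * ((z - z0) * (z - z0)))) => z _.
  apply: cderiv_eq (cderivD (cderivM (cderiv_cst (u z0) z) (cderiv_id z))
    (cderivM (cderiv_cst (d / 2) z) (cderivM (cderivD (cderiv_id z) (cderiv_cst (- z0) z))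
    (cderivD (cderiv_id z) (cderiv_cst (- z0) z))))) _.
  by rewrite /A; field.
have Ac : rcont x1 x2 y1 y2 (fun z => - 1 * A z).
  by move=> z _; apply: ccontM; [exact: ccont_cst|exact: cderiv_ccont (Ad z)].
have -> : rint x1 x2 y1 y2 u = rint x1 x2 y1 y2 (fun z => u z + - 1 * A z).
  rewrite rintD// rintZ// ?A0 ?mulr0 ?addr0// => z _.
  exact: cderiv_ccont (Ad z).
apply: le_trans (_ : _ <= 2 * ((x2 - x1) + (y2 - y1)) * (e * l)) _.
  apply: rint_le => // [z zb|z [[zx zy] _]].
    by apply: ccontD; [exact: uc|exact: Ac].
  have zz0 : cmod (z - z0) <= l.
    apply: le_trans (cmod_ReIm _) _; rewrite !raddfB /=.
    by apply: le_trans ll; apply: lerD; rewrite ler_norml; apply/andP; split; lra.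
  have := rP z (le_lt_trans zz0 lr); rewrite /A.
  have -> : u z + - 1 * (u z0 + (z - z0) * d) = u z - u z0 - (z - z0) * d by ring.
  by move=> le1; apply: le_trans le1 _; rewrite ler_wpM2l// ltW.
have l0 : 0 <= l by lra.
by apply: ler_wpM2r; [rewrite mulr_ge0// ltW|lra].
Qed.

Lemma rint_quarter x1 xm x2 y1 ym y2 u : x1 <= xm <= x2 -> y1 <= ym <= y2 ->
  (forall z, crect x1 x2 y1 y2 z -> ccont u z) ->
  rint x1 x2 y1 y2 u = rint x1 xm y1 ym u + rint x1 xm ym y2 u +
    (rint xm x2 y1 ym u + rint xm x2 ym y2 u).
Proof.
move=> /andP[x1m mx2] /andP[y1m my2] uc.
have x12 := le_trans x1m mx2; have y12 := le_trans y1m my2.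
rewrite (@rint_cutx _ _ _ _ x12 y12 u xm) ?x1m//; last first.
  by move=> z [zR _]; exact: uc.
rewrite (@rint_cuty x1 xm _ _ x1m y12 u ym) ?y1m//; last first.
  move=> z [[/andP[zx1 zx2] zy] _]; apply: uc; split => //.
  by rewrite zx1 (le_trans zx2).
rewrite (@rint_cuty xm x2 _ _ mx2 y12 u ym) ?y1m//.
move=> z [[/andP[zx1 zx2] zy] _]; apply: uc; split => //.
by rewrite zx2 (le_trans _ zx1).
Qed.

Theorem goursat x1 x2 y1 y2 u : x1 <= x2 -> y1 <= y2 ->
  (forall z, crect x1 x2 y1 y2 z -> exists d, cderiv u z d) ->
  rint x1 x2 y1 y2 u = 0.
Proof.
move=> x12 y12.
have [w [wE w0]] : exists w : R, x2 = x1 + w /\ 0 <= w by exists (x2 - x1); split; lra.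
have [h [hE h0]] : exists h, y2 = y1 + h /\ 0 <= h by exists (y2 - y1); split; lra.
rewrite {}wE {}hE {x12 y12 x2 y2} => ud.
suff H e : 0 < e -> cmod (rint x1 (x1 + w) y1 (y1 + h) u) <= e.
  apply/eqP; rewrite -cmod_eq0 eq_le cmod_ge0 andbT.
  by apply/ler_addgt0Pl => e /H; rewrite addr0.
move=> e0.
(* A bound proportional to the area is preserved by quartering: four quarters contribute
   [e * (s / 2) ^+ 2] each. *)
pose P x y s := x1 <= x -> x + s * w <= x1 + w -> y1 <= y -> y + s * h <= y1 + h ->
  cmod (rint x (x + s * w) y (y + s * h) u) <= e * s ^+ 2.
suff : P x1 y1 1 by rewrite /P !mul1r expr1n mulr1; exact.
apply: (@quartering R w h x1 y1 P) => //.
  move=> x y s s0; rewrite /P.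
  have [xm xmE] : {xm | xm = x + s / 2 * w} by exists (x + s / 2 * w).
  have [ym ymE] : {ym | ym = y + s / 2 * h} by exists (y + s / 2 * h).
  have -> : x + s / 2 * w + s / 2 * w = x + s * w by lra.
  have -> : y + s / 2 * h + s / 2 * h = y + s * h by lra.
  have : 0 <= s / 2 * w by rewrite mulr_ge0// divr_ge0// ltW.
  have : 0 <= s / 2 * h by rewrite mulr_ge0// divr_ge0// ltW.
  have [xe xeE] : {xe | xe = x + s * w} by exists (x + s * w).
  have [ye yeE] : {ye | ye = y + s * h} by exists (y + s * h).
  have : xe - xm = s / 2 * w by lra.
  have : ye - ym = s / 2 * h by lra.
  have : xm - x = s / 2 * w by lra.
  have : ym - y = s / 2 * h by lra.
  rewrite -xmE -ymE -xeE -yeE {xmE ymE xeE yeE}.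
  move: (s / 2 * w) (s / 2 * h) => sw sh E1 E2 E3 E4 sh0 sw0 P1 P2 P3 P4 xa xb ya yb.
  have xxm : x <= xm by rewrite -subr_ge0 E2.
  have yym : y <= ym by rewrite -subr_ge0 E1.
  have xme : xm <= xe by rewrite -subr_ge0 E4.
  have yme : ym <= ye by rewrite -subr_ge0 E3.
  have {}P1 := P1 xa (le_trans xme xb) ya (le_trans yme yb).
  have {}P2 := P2 (le_trans xa xxm) xb ya (le_trans yme yb).
  have {}P3 := P3 xa (le_trans xme xb) (le_trans ya yym) yb.
  have {}P4 := P4 (le_trans xa xxm) xb (le_trans ya yym) yb.
  rewrite (@rint_quarter _ xm _ _ ym) ?xxm ?yym//; last first.
    move=> z [/andP[zx zx'] /andP[zy zy']].
    have [|d] := ud z; last exact: cderiv_ccont.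
    by split; apply/andP; split; [exact: le_trans zx|exact: le_trans xb
      |exact: le_trans zy|exact: le_trans yb].
  apply: le_trans (cmodD _ _) _.
  have h1 := cmodD (rint x xm y ym u) (rint x xm ym ye u).
  have h2 := cmodD (rint xm xe y ym u) (rint xm xe ym ye u).
  apply: le_trans (lerD h1 h2) _; apply: le_trans (lerD (lerD P1 P3) (lerD P2 P4)) _.
  by rewrite exprMn; lra.
move=> a b ax yb; have [d zd] := ud (a +i* b) (conj ax yb).
(* [s * C] bounds half the perimeter, and C stays positive for a degenerate rectangle. The tolerance
   [e / (2 * C * C)] turns the bound of [rint_local] into [e * s ^+ 2]. *)
have [C [CE C0]] : exists C, w + h <= C /\ 0 < C by exists (w + h + 1); split; lra.
have [|r r0 rP] := rint_local zd (e := e / (2 * C * C)).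
  by rewrite divr_gt0// !mulr_gt0.
exists (r / C); first by rewrite divr_gt0.
move=> x y s /andP[s0 sr] xa xb ya yb' xp yp _ _ _ _.
have -> : e * s ^+ 2 = 2 * (s * C) * (e / (2 * C * C) * (s * C)).
  by field; rewrite gt_eqF.
have sw : 0 <= s * w by rewrite mulr_ge0// ltW.
have sh : 0 <= s * h by rewrite mulr_ge0// ltW.
apply: rP; rewrite ?lerDl//; last 2 first.
- by rewrite -ltr_pdivlMr.
- move=> z [[/andP[zx zx'] /andP[zy zy']] _].
  have [|d'] := ud z; last exact: cderiv_ccont.
  by split; apply/andP; split; [exact: le_trans zx|exact: le_trans xb
      |exact: le_trans zy|exact: le_trans yb'].
by rewrite ![_ + _ * _ - _]addrAC !subrr !add0r -mulrDr ler_wpM2l// ltW.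
Qed.

(** Cuts along the sides of the inner rectangle leave it and four rectangles avoiding its interior;
    on these Goursat's theorem gives 0. *)
Lemma rint_shrink x1 x2 y1 y2 a1 a2 b1 b2 u :
  x1 <= a1 -> a1 <= a2 -> a2 <= x2 -> y1 <= b1 -> b1 <= b2 -> b2 <= y2 ->
  (forall z, crect x1 x2 y1 y2 z -> ~ orect a1 a2 b1 b2 z -> exists d, cderiv u z d) ->
  rint x1 x2 y1 y2 u = rint a1 a2 b1 b2 u.
Proof.
move=> xa a12 ax yb b12 bz ud.
have uc c1 c2 (d1 d2 : R) : (forall z, rbdry c1 c2 d1 d2 z -> crect x1 x2 y1 y2 z /\
    ~ orect a1 a2 b1 b2 z) -> rcont c1 c2 d1 d2 u.
  by move=> cd z /cd[zR zO]; have [d] := ud z zR zO; exact: cderiv_ccont.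
have u0 c1 c2 (d1 d2 : R) : c1 <= c2 -> d1 <= d2 -> (forall z, crect c1 c2 d1 d2 z ->
    crect x1 x2 y1 y2 z /\ ~ orect a1 a2 b1 b2 z) -> rint c1 c2 d1 d2 u = 0.
  by move=> c12 d12 cd; apply: goursat => // z /cd[zR zO]; exact: ud.
have T1 : rcont x1 x2 y1 y2 u.
  apply: uc => z [[zx zy] zO]; split => // -[zx' zy']; apply: zO.
  by split; apply/andP; split; lra.
have T2 : rcont a1 x2 y1 y2 u.
  apply: uc => z [[zx zy] zO]; split; first by split; lra.
  by move=> [zx' zy']; apply: zO; split; lra.
have T3 : rcont a1 a2 y1 y2 u.
  apply: uc => z [[zx zy] zO]; split; first by split; lra.
  by move=> [zx' zy']; apply: zO; split; lra.
have T4 : rcont a1 a2 b1 y2 u.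
  apply: uc => z [[zx zy] zO]; split; first by split; lra.
  by move=> [zx' zy']; apply: zO; split; lra.
rewrite (@rint_cutx _ _ _ _ _ _ u a1) //; [|lra..].
rewrite (@rint_cutx a1 _ _ _ _ _ u a2) //; [|lra..].
rewrite (@rint_cuty a1 a2 _ _ _ _ u b1) //; [|lra..].
rewrite (@rint_cuty a1 a2 b1 _ _ _ u b2) //; [|lra..].
rewrite (u0 x1 a1) //; [|lra..|]; last first.
  by move=> z [zx zy]; split; [split; lra|move=> [zx' zy']; lra].
rewrite (u0 a2 x2) //; [|lra..|]; last first.
  by move=> z [zx zy]; split; [split; lra|move=> [zx' zy']; lra].
rewrite (u0 a1 a2 y1 b1) //; last first.
  by move=> z [zx zy]; split; [split; lra|move=> [zx' zy']; lra].
rewrite (u0 a1 a2 b2 y2) //; last first.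
  by move=> z [zx zy]; split; [split; lra|move=> [zx' zy']; lra].
ring.
Qed.

End RectangleIntegral.

(** * Cauchy's formula on rectangles *)

Section CauchyFormula.
Context {R : realType}.
Implicit Types (p q z w d : R[i]) (f g u v : R[i] -> R[i]) (e r s t : R).

Lemma cderiv_near f g z d r : 0 < r -> (forall w, cmod (w - z) < r -> f w = g w) ->
  cderiv g z d -> cderiv f z d.
Proof.
move=> r0 fg gd e e0; have [r' r'0 r'P] := gd e e0.
exists (Num.min r r'); first by rewrite lt_min r0.
move=> w; rewrite lt_min => /andP[wr wr']; rewrite !fg//; first exact: r'P.
by rewrite subrr cmod0.
Qed.

Lemma cderiv_subr z w : cderiv (fun w => w - z) w 1.
Proof.
apply: cderiv_eq (cderivD (cderiv_id w) (cderiv_cst (- z) w)) _.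
by rewrite addr0.
Qed.

Lemma cderiv_inv_subr z w : w != z -> cderiv (fun w => (w - z)^-1) w (- 1 / (w - z) ^+ 2).
Proof.
move=> wz; apply: (@cderivV _ (fun w => w - z)); first by rewrite subr_eq0.
exact: cderiv_subr.
Qed.

Lemma ccont_subr z w : ccont (fun w => w - z) w.
Proof. exact: cderiv_ccont (cderiv_subr z w). Qed.

Lemma ccont_div_subr g z w : w != z -> ccont g w -> ccont (fun w => g w / (w - z)) w.
Proof.
move=> wz gc; apply: ccontM => //; apply: ccontV; first by rewrite subr_eq0.
exact: ccont_subr.
Qed.

Definition seg_far p q z r := forall t, 0 <= t <= 1 -> r <= cmod (seg p q t - z).

Lemma seg_far_neq p q z r t : 0 < r -> seg_far p q z r -> 0 <= t <= 1 -> seg p q t != z.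
Proof. by move=> r0 far t01; rewrite -subr_eq0 -cmod_gt0; apply: lt_le_trans (far t t01). Qed.

Lemma scont_cauchy p q g z r : 0 < r -> seg_far p q z r -> scont p q g ->
  scont p q (fun w => g w / (w - z)).
Proof.
move=> r0 far gc t t01; apply: ccont_div_subr; last exact: gc.
exact: seg_far_neq r0 far t01.
Qed.

(** Differentiation under the integral sign, from the exact identity 1/(x-w) - 1/(x-z) -
    (w-z)/(x-z)^2 = (w-z)^2 / ((x-w)(x-z)^2). *)
Lemma cauchy_seg_deriv p q g z r : 0 < r -> seg_far p q z r -> scont p q g ->
  cderiv (fun w => sint p q (fun x => g x / (x - w))) z
    (sint p q (fun x => g x / (x - z) / (x - z))).
Proof.
move=> r0 far gc e e0; have [M M0 gM] := seg_bounded gc.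
(* For w within [r / 2] of z, the points of the segment are at distance at least [r / 2] from w and
   r from z, so the kernel of the remainder is at most [2 / r ^+ 3]. *)
set C := cmod (q - p) * (M * (2 / r ^+ 3)).
have C0 : 0 <= C by rewrite !mulr_ge0 ?cmod_ge0 ?invr_ge0 ?exprn_ge0// ltW.
have C1 : 0 < C + 1 by lra.
exists (Num.min (r / 2) (e / (C + 1))); first by rewrite lt_min !divr_gt0.
move=> w; rewrite lt_min => /andP[wr we].
have farw : seg_far p q w (r / 2).
  move=> t /far le1; have := cmod_le_dist (seg p q t - z) (seg p q t - w).
  rewrite (_ : seg p q t - w - (seg p q t - z) = - (w - z)); last by ring.
  by rewrite cmodN; lra.
have r20 : 0 < r / 2 by lra.
have sz := scont_cauchy r0 far gc.
have szz := scont_cauchy r0 far sz.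
have sw := scont_cauchy r20 farw gc.
rewrite (_ : _ - _ = sint p q (fun x => (g x / (x - w) + - 1 * (g x / (x - z)))
    + - (w - z) * (g x / (x - z) / (x - z)))); last first.
  rewrite sintD; [|exact: scontD sw (scontZ _ sz)|exact: scontZ].
  rewrite sintD; [|exact: sw|exact: scontZ].
  rewrite !sintZ//; ring.
rewrite (@sint_ext _ _ _ _ (fun x => (w - z) * (w - z) * (g x / (x - w) / (x - z) / (x - z)))); last first.
  move=> t t01; have h1 := seg_far_neq r0 far t01; have h2 := seg_far_neq r20 farw t01.
  by field; rewrite !subr_eq0 h1 h2.
have sc : scont p q (fun x => g x / (x - w) / (x - z) / (x - z)).
  by do 2 apply: (scont_cauchy r0 far).
rewrite sintZ// !cmodM.
have h : cmod (sint p q (fun x => g x / (x - w) / (x - z) / (x - z))) <= C.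
  apply: sint_le => // t t01; rewrite !cmodM !cmodV.
  have h1 := far t t01; have h2 := farw t t01.
  rewrite -!mulrA; apply: ler_pM; rewrite ?cmod_ge0 ?mulr_ge0 ?invr_ge0 ?cmod_ge0//.
    exact: gM.
  have -> : 2 / r ^+ 3 = (r / 2)^-1 * (r^-1 * r^-1) by field; rewrite gt_eqF.
  have c0 a : 0 <= (cmod a)^-1 by rewrite invr_ge0 cmod_ge0.
  have cle a (x : R) : 0 < x -> x <= cmod a -> (cmod a)^-1 <= x^-1.
    by move=> x0 xa; rewrite lef_pV2// posrE; exact: lt_le_trans xa.
  apply: ler_pM; [exact: c0|by rewrite mulr_ge0 ?c0|by apply: cle|].
  by apply: ler_pM; [exact: c0|exact: c0|by apply: cle|by apply: cle].
apply: le_trans (_ : (e / (C + 1)) * cmod (w - z) * C <= _).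
  apply: ler_pM => //; rewrite ?mulr_ge0 ?cmod_ge0//.
  by apply: ler_wpM2r; rewrite ?cmod_ge0// ltW.
rewrite mulrAC ler_wpM2r ?cmod_ge0// mulrAC ler_pdivrMr//.
by apply: ler_wpM2l; [exact: ltW|rewrite lerDl].
Qed.

Lemma constant_on_seg f p q : (forall t, 0 <= t <= 1 -> cderiv f (seg p q t) 0) -> f p = f q.
Proof.
move=> fd; have := @sint_FTC R p q (fun=> 0) f fd.
have c0 : scont p q (fun=> 0) by move=> t _; exact: ccont_cst.
have := @sint_le R p q (fun=> 0) 0 c0; rewrite mulr0 => le0 E.
have {}le0 := le0 (fun t _ => (eq_ind_r (fun x => x <= 0) (lexx 0) (@cmod0 R))).
apply/eqP; rewrite eq_sym -subr_eq0 -E -cmod_eq0 eq_le cmod_ge0 andbT//.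
Qed.

Lemma itv_center (a b : R) : a < b ->
  exists c h : R, [/\ 0 < h, b - a = 2 * h, a = c - h & b = c + h].
Proof. by move=> ab; exists ((a + b) / 2), ((b - a) / 2); split; lra. Qed.

Section Rect.
Variables (x1 x2 y1 y2 : R).

Lemma orect_crect : orect x1 x2 y1 y2 `<=` crect x1 x2 y1 y2.
Proof. by move=> z [/andP[? ?] /andP[? ?]]; split; rewrite !ltW. Qed.

Lemma orect_far_left z t : Re z - x1 <= cmod (seg (x1 +i* y1) (x1 +i* y2) t - z).
Proof.
rewrite seg_vert; apply: le_trans (cmod_Re _); case: z => a b /=.
by apply: le_trans (ler_norm _) _; rewrite distrC.
Qed.

Lemma orect_far_right z t : x2 - Re z <= cmod (seg (x2 +i* y1) (x2 +i* y2) t - z).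
Proof.
rewrite seg_vert; apply: le_trans (cmod_Re _); case: z => a b /=.
exact: ler_norm.
Qed.

Lemma orect_far_bottom z t : Im z - y1 <= cmod (seg (x1 +i* y1) (x2 +i* y1) t - z).
Proof.
rewrite seg_horiz; apply: le_trans (cmod_Im _); case: z => a b /=.
by apply: le_trans (ler_norm _) _; rewrite distrC.
Qed.

Lemma orect_far_top z t : y2 - Im z <= cmod (seg (x1 +i* y2) (x2 +i* y2) t - z).
Proof.
rewrite seg_horiz; apply: le_trans (cmod_Im _); case: z => a b /=.
exact: ler_norm.
Qed.

(** The usual factor 1 / (2 pi i) is omitted; division by [winding] takes its place. *)
Definition cauchy_int g z := rint x1 x2 y1 y2 (fun w => g w / (w - z)).

(** This is 2 pi i inside the rectangle, but only its constancy and the fact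
    that it is nonzero are needed. *)
Definition winding z := cauchy_int (fun=> 1) z.

Hypotheses (x12 : x1 < x2) (y12 : y1 < y2).
Let x12' := ltW x12.
Let y12' := ltW y12.

Lemma rbdry_neq z w : orect x1 x2 y1 y2 z -> rbdry x1 x2 y1 y2 w -> w != z.
Proof. by move=> zR [_ wR]; apply/eqP => E; apply: wR; rewrite E. Qed.

Lemma rcont_cauchy g z : orect x1 x2 y1 y2 z -> rcont x1 x2 y1 y2 g ->
  rcont x1 x2 y1 y2 (fun w => g w / (w - z)).
Proof.
by move=> zR gc w wb; apply: ccont_div_subr; [exact: rbdry_neq wb|exact: gc].
Qed.

Lemma cauchy_deriv g z : orect x1 x2 y1 y2 z -> rcont x1 x2 y1 y2 g ->
  cderiv (cauchy_int g) z (cauchy_int (fun w => g w / (w - z)) z).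
Proof.
move=> [/andP[zx1 zx2] /andP[zy1 zy2]] gc.
have d1 : 0 < Re z - x1 by lra.
have d2 : 0 < x2 - Re z by lra.
have d3 : 0 < Im z - y1 by lra.
have d4 : 0 < y2 - Im z by lra.
have c1 := cauchy_seg_deriv d1 (fun t _ => orect_far_left z t) (rcont_left x12' y12' gc).
have c2 := cauchy_seg_deriv d2 (fun t _ => orect_far_right z t) (rcont_right x12' y12' gc).
have c3 := cauchy_seg_deriv d3 (fun t _ => orect_far_bottom z t) (rcont_bottom x12' y12' gc).
have c4 := cauchy_seg_deriv d4 (fun t _ => orect_far_top z t) (rcont_top x12' y12' gc).
have N1 := cderiv_cst (- 1) z.
have cE w : cauchy_int g w = sint (x1 +i* y1) (x2 +i* y1) (fun x => g x / (x - w)) +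
  sint (x2 +i* y1) (x2 +i* y2) (fun x => g x / (x - w)) +
  - 1 * sint (x1 +i* y2) (x2 +i* y2) (fun x => g x / (x - w)) +
  - 1 * sint (x1 +i* y1) (x1 +i* y2) (fun x => g x / (x - w)).
  by rewrite /cauchy_int /rint !mulN1r.
apply: (@cderiv_near _ _ _ _ 1 _ (fun w _ => cE w)) => //.
apply: cderiv_eq (cderivD (cderivD (cderivD c3 c2) (cderivM N1 c4)) (cderivM N1 c1)) _.
by rewrite /cauchy_int /rint !mul0r !add0r !mulN1r.
Qed.

(** The derivative in z is the integral of (x - z)^-2, which has the primitive - (x - z)^-1 along
    the boundary; the rectangle is convex, so the segment from z to w stays inside. *)
Lemma winding_const z w : orect x1 x2 y1 y2 z -> orect x1 x2 y1 y2 w -> winding z = winding w.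
Proof.
move=> [zx zy] [wx wy]; apply: constant_on_seg => t t01.
have tR : orect x1 x2 y1 y2 (seg z w t).
  move: t01 => /andP[t0 t1].
  have -> : seg z w t = ((1 - t) * Re z + t * Re w) +i* ((1 - t) * Im z + t * Im w).
    case: z w {zx zy wx wy} => a b [c d']; rewrite /seg; apply/eqP.
    by rewrite eq_complex /=; apply/andP; split; apply/eqP; ring.
  have H a b c c' : a < c < b -> a < c' < b -> a < (1 - t) * c + t * c' < b.
    move=> /andP[? ?] /andP[? ?]; case: (leP c c') => cc.
      have : 0 <= t * (c' - c) by rewrite mulr_ge0 ?subr_ge0.
      have : 0 <= (1 - t) * (c' - c) by rewrite mulr_ge0 ?subr_ge0.
      by move=> ? ?; apply/andP; split; lra.
    have : 0 <= t * (c - c') by rewrite mulr_ge0 ?subr_ge0// ltW.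
    have : 0 <= (1 - t) * (c - c') by rewrite mulr_ge0 ?subr_ge0// ltW.
    by move=> ? ?; apply/andP; split; lra.
  by split; exact: H.
have onec : rcont x1 x2 y1 y2 (fun=> 1) by move=> *; exact: ccont_cst.
apply: cderiv_eq (cauchy_deriv tR onec) _.
rewrite /cauchy_int; apply: (rint_FTC x12' y12' (F := fun x => - 1 * (x - seg z w t)^-1)).
move=> x xb; have xn := rbdry_neq tR xb.
apply: cderiv_eq (cderivM (cderiv_cst (- 1) x) (cderiv_inv_subr xn)) _.
by field; rewrite subr_eq0.
Qed.

(** It suffices to look at the centre, where all four sides turn in the same sense. With half sides
    a and b, each contributes at least [2 * a * b / (a ^+ 2 + b ^+ 2)] to the imaginary part, the
    denominator being the squared distance of the corners. The top and the left side enter [rint]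
    with a minus sign, hence the factor [- 'i] for them. *)
Lemma winding_neq0 z : orect x1 x2 y1 y2 z -> winding z != 0.
Proof.
have [xc [a [a0 aE xc1 xc2]]] := itv_center x12.
have [yc [b [b0 bE yc1 yc2]]] := itv_center y12.
pose c := xc +i* yc.
have cR : orect x1 x2 y1 y2 c by rewrite /c; split; apply/andP; split=> /=; lra.
move=> zR; rewrite (winding_const zR cR).
have onec : rcont x1 x2 y1 y2 (fun=> 1) by move=> *; exact: ccont_cst.
have wc := rcont_cauchy cR onec.
have hor (k X Y : R) : Re ('i * (k%:C * (1 / (X +i* Y)))) = k * Y / (X ^+ 2 + Y ^+ 2).
  by rewrite /=; ring.
have ver (k X Y : R) : Re ('i * ((0 +i* k) * (1 / (X +i* Y)))) = - (k * X / (X ^+ 2 + Y ^+ 2)).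
  by rewrite /=; ring.
have NRe w : Re (- 'i * w) = - Re ('i * w) by rewrite mulNr raddfN.
have dx y : (x2 +i* y) - (x1 +i* y) = (2 * a)%:C.
  by apply/eqP; rewrite eq_complex /= subrr aE !eqxx.
have dy x : (x +i* y2) - (x +i* y1) = 0 +i* (2 * b).
  by apply/eqP; rewrite eq_complex /= subrr bE !eqxx.
have frac (k l X Y : R) : 0 < k -> 0 < l -> X ^+ 2 <= Y ^+ 2 ->
    k * l / (Y ^+ 2 + l ^+ 2) <= k * l / (X ^+ 2 + l ^+ 2).
  move=> k0 l0 XY; have := sqr_ge0 X; have : 0 < l ^+ 2 by rewrite exprn_gt0.
  by move=> ? ?; rewrite ler_pM2l ?mulr_gt0// lef_pV2 ?posrE//; lra.
have bnd t (l : R) : 0 < l -> 0 <= t <= 1 -> (- l + t * (2 * l)) ^+ 2 <= l ^+ 2.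
  move=> l0 /andP[t0 t1]; have -> : - l + t * (2 * l) = l * (2 * t - 1) by ring.
  rewrite exprMn ler_piMr ?sqr_ge0//.
  by rewrite expr2; nra.
have h1 : Re ('i * sint (x1 +i* y1) (x2 +i* y1) (fun w => 1 / (w - c))) <= - (2 * a * b / (a ^+ 2 + b ^+ 2)).
  apply: sint_Re_le; first exact: rcont_bottom wc.
  move=> t t01; rewrite seg_horiz dx.
  have -> : (x1 + t * (x2 - x1)) +i* y1 - c = (- a + t * (2 * a)) +i* - b.
    by apply/eqP; rewrite eq_complex /= -aE; apply/andP; split; apply/eqP; lra.
  rewrite hor mulrN mulNr sqrrN lerN2; apply: frac => //; first by lra.
  exact: bnd.
have h2 : Re ('i * sint (x2 +i* y1) (x2 +i* y2) (fun w => 1 / (w - c))) <= - (2 * b * a / (b ^+ 2 + a ^+ 2)).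
  apply: sint_Re_le; first exact: rcont_right wc.
  move=> t t01; rewrite seg_vert dy.
  have -> : x2 +i* (y1 + t * (y2 - y1)) - c = a +i* (- b + t * (2 * b)).
    by apply/eqP; rewrite eq_complex /= -bE; apply/andP; split; apply/eqP; lra.
  rewrite ver [a ^+ 2 + (_ + _) ^+ 2]addrC lerN2; apply: frac => //; first by lra.
  exact: bnd.
have h3 : Re (- 'i * sint (x1 +i* y2) (x2 +i* y2) (fun w => 1 / (w - c))) <= - (2 * a * b / (a ^+ 2 + b ^+ 2)).
  apply: sint_Re_le; first exact: rcont_top wc.
  move=> t t01; rewrite seg_horiz dx.
  have -> : (x1 + t * (x2 - x1)) +i* y2 - c = (- a + t * (2 * a)) +i* b.
    by apply/eqP; rewrite eq_complex /= -aE; apply/andP; split; apply/eqP; lra.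
  rewrite NRe hor lerN2; apply: frac => //; first by lra.
  exact: bnd.
have h4 : Re (- 'i * sint (x1 +i* y1) (x1 +i* y2) (fun w => 1 / (w - c))) <= - (2 * b * a / (b ^+ 2 + a ^+ 2)).
  apply: sint_Re_le; first exact: rcont_left wc.
  move=> t t01; rewrite seg_vert dy.
  have -> : x1 +i* (y1 + t * (y2 - y1)) - c = (- a) +i* (- b + t * (2 * b)).
    by apply/eqP; rewrite eq_complex /= -bE; apply/andP; split; apply/eqP; lra.
  rewrite NRe ver mulrN mulNr opprK sqrrN [a ^+ 2 + (_ + _) ^+ 2]addrC lerN2.
  by apply: frac => //; [lra|exact: bnd].
have m1 : 0 < 2 * a * b / (a ^+ 2 + b ^+ 2) by rewrite divr_gt0 ?addr_gt0 ?mulr_gt0 ?exprn_gt0.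
have m2 : 0 < 2 * b * a / (b ^+ 2 + a ^+ 2) by rewrite divr_gt0 ?addr_gt0 ?mulr_gt0 ?exprn_gt0.
apply/eqP => W0; have : Re ('i * winding c) = 0 by rewrite W0 mulr0.
have sum4 (s1 s2 s3 s4 : R[i]) : Re ('i * (s1 + s2 - s3 - s4)) =
    Re ('i * s1) + Re ('i * s2) + Re (- 'i * s3) + Re (- 'i * s4).
  by case: s1 s2 s3 s4 => [? ?] [? ?] [? ?] [? ?]; rewrite /=; ring.
rewrite /winding /cauchy_int /rint sum4 => E.
have := lerD (lerD (lerD h1 h2) h3) h4; rewrite E; lra.
Qed.

(** The difference quotient phi of f at z is derivable away from z, so its integral can be moved to
    small squares around z; there phi is bounded and the perimeter tends to 0. *)
Theorem cauchy_formula f z : orect x1 x2 y1 y2 z ->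
  (forall w, crect x1 x2 y1 y2 w -> exists d, cderiv f w d) ->
  cauchy_int f z = f z * winding z.
Proof.
move=> zR fd.
have fc : rcont x1 x2 y1 y2 f by move=> w [/fd[d]] /cderiv_ccont.
have onec : rcont x1 x2 y1 y2 (fun=> 1) by move=> *; exact: ccont_cst.
pose phi w := f w / (w - z) + - f z * (1 / (w - z)).
have phiE w : phi w = (f w - f z) / (w - z) by rewrite /phi; ring.
suff phi0 : rint x1 x2 y1 y2 phi = 0.
  have c1 := rcont_cauchy zR fc; have c2 := rcont_cauchy zR onec.
  have c3 : rcont x1 x2 y1 y2 (fun w => - f z * (1 / (w - z))).
    by move=> w wb; apply: ccontM; [exact: ccont_cst|exact: c2].
  move: phi0; rewrite (rintD x12' y12' c1 c3) (rintZ x12' y12' _ c2) mulNr.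
  by move/eqP; rewrite subr_eq0 => /eqP.
have [d /cderiv_lip[r r0 rP]] := fd z (orect_crect zR).
set L := cmod d + 1 in rP.
have L0 : 0 < L by have := cmod_ge0 d; rewrite /L; lra.
case: (zR) => /andP[zx1 zx2] /andP[zy1 zy2].
have [r' [r'0 r'P]] : exists r' : R, 0 < r' /\ forall s, 0 < s -> s <= r' ->
    [/\ x1 <= Re z - s, Re z + s <= x2, y1 <= Im z - s & Im z + s <= y2].
  exists (Num.min (Num.min (Re z - x1) (x2 - Re z)) (Num.min (Im z - y1) (y2 - Im z))).
  split; first by rewrite !lt_min !subr_gt0 zx1 zx2 zy1.
  by move=> s s0; rewrite !le_min => /andP[/andP[? ?] /andP[? ?]]; split; lra.
(* [8 * s] is the perimeter of the square of half side s, and L bounds phi on it by the Lipschitz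
   estimate at z, valid since its points are within [2 * s < r]. *)
suff H s : 0 < s -> s <= r' -> 2 * s < r -> cmod (rint x1 x2 y1 y2 phi) <= 8 * s * L.
  apply/eqP; rewrite -cmod_eq0 eq_le cmod_ge0 andbT; apply/ler_addgt0Pl => e e0.
  rewrite addr0; pose s := Num.min r' (Num.min (r / 4) (e / (8 * L))).
  have s0 : 0 < s by rewrite !lt_min r'0 !divr_gt0// mulr_gt0.
  have [s1 [s2 s3]] : s <= r' /\ s <= r / 4 /\ s <= e / (8 * L).
    by rewrite !ge_min !lexx !orbT.
  apply: le_trans (H s s0 s1 _) _; first by lra.
  by rewrite mulrAC mulrC -ler_pdivlMr// mulr_gt0.
move=> s0 sr' sr; have [s1 s2 s3 s4] := r'P s s0 sr'.
have sq w : rbdry (Re z - s) (Re z + s) (Im z - s) (Im z + s) w -> w != z.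
  by move=> [_ wn]; apply/eqP => E; apply: wn; rewrite E; split; apply/andP; split; lra.
rewrite (@rint_shrink _ _ _ _ _ (Re z - s) (Re z + s) (Im z - s) (Im z + s)) //; try lra; last first.
  move=> w wR wn; have wz : w != z.
    by apply/eqP => E; apply: wn; rewrite E; split; apply/andP; split; lra.
  have [d' wd] := fd w wR.
  have iv := cderiv_inv_subr wz.
  exists ((d' * (w - z)^-1 + f w * (- 1 / (w - z) ^+ 2)) + (0 * (w - z)^-1 + - f z * (- 1 / (w - z) ^+ 2))).
  apply: (@cderiv_near _ (fun w => f w * (w - z)^-1 + - f z * (w - z)^-1) w _ 1) => //.
    by move=> x _; rewrite /phi mul1r.
  by apply: cderivD; apply: cderivM => //; exact: cderiv_cst.
apply: le_trans (rint_le (M := L) _ _ _ _) _; try lra.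
- move=> w wb; have wz := sq w wb; rewrite /phi.
  have [d' wd] : exists d, cderiv f w d.
    by case: wb => [[wx wy] _]; apply: fd; split; lra.
  apply: ccontD; first by apply: ccont_div_subr => //; exact: cderiv_ccont wd.
  apply: ccontM; first exact: ccont_cst.
  by apply: ccont_div_subr => //; exact: ccont_cst.
- move=> w wb; have wz := sq w wb; rewrite phiE cmodM cmodV.
  rewrite ler_pdivrMr ?cmod_gt0 ?subr_eq0//; apply: rP.
  apply: le_lt_trans (cmod_ReIm _) _; rewrite !raddfB /=.
  case: wb => [[wx wy] _]; have h1 : `|Re w - Re z| <= s by rewrite ler_norml; lra.
  have h2 : `|Im w - Im z| <= s by rewrite ler_norml; lra.
  by lra.
Qed.

End Rect.
End CauchyFormula.

(** * Holomorphic functions *)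

Section Holomorphic.
Context {R : realType}.
Implicit Types (p q z w d : R[i]) (f g u v : R[i] -> R[i]) (e r s t : R)
  (U V : set R[i]).

Definition chol U f := forall z, U z -> exists d, cderiv f z d.

Lemma chol_ccont U f z : chol U f -> U z -> ccont f z.
Proof. by move=> fU /fU[d]; exact: cderiv_ccont. Qed.

Lemma chol_subset U V f : U `<=` V -> chol V f -> chol U f.
Proof. by move=> UV fV z /UV /fV. Qed.

Lemma chol_ext U f g : copen U -> (forall z, U z -> f z = g z) -> chol U g -> chol U f.
Proof.
move=> oU fg gU z Uz; have [d gd] := gU z Uz; have [r r0 rU] := oU z Uz.
by exists d; apply: cderiv_near r0 _ gd => w /rU /fg.
Qed.

Lemma chol_cst U c : chol U (fun=> c).
Proof. by move=> z _; exists 0; exact: cderiv_cst. Qed.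

Lemma chol_id U : chol U id.
Proof. by move=> z _; exists 1; exact: cderiv_id. Qed.

Lemma cholD U f g : chol U f -> chol U g -> chol U (fun z => f z + g z).
Proof.
move=> fU gU z Uz; have [d fd] := fU z Uz; have [d' gd] := gU z Uz.
by exists (d + d'); exact: cderivD.
Qed.

Lemma cholM U f g : chol U f -> chol U g -> chol U (fun z => f z * g z).
Proof.
move=> fU gU z Uz; have [d fd] := fU z Uz; have [d' gd] := gU z Uz.
by exists (d * g z + f z * d'); exact: cderivM.
Qed.

Lemma cholN U f : chol U f -> chol U (fun z => - f z).
Proof.
move=> fU; have -> : (fun z => - f z) = (fun z => - 1 * f z).
  by apply/funext => z; rewrite mulN1r.
by apply: cholM => //; exact: chol_cst.
Qed.

Lemma cholB U f g : chol U f -> chol U g -> chol U (fun z => f z - g z).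
Proof. by move=> fU gU; apply: cholD => //; exact: cholN. Qed.

Lemma cholV U f : (forall z, U z -> f z != 0) -> chol U f -> chol U (fun z => (f z)^-1).
Proof.
move=> f0 fU z Uz; have [d fd] := fU z Uz.
by exists (- d / f z ^+ 2); apply: cderivV => //; exact: f0.
Qed.

Lemma chol_sum (I : Type) (s : seq I) (P : pred I) U (F : I -> R[i] -> R[i]) :
  (forall i, P i -> chol U (F i)) -> chol U (fun z => \sum_(i <- s | P i) F i z).
Proof.
move=> FU; elim: s => [|i s IH].
  by under [X in chol _ X]eq_fun do rewrite big_nil; exact: chol_cst.
have [Pi|nPi] := boolP (P i); last first.
  by under [X in chol _ X]eq_fun do rewrite big_cons (negbTE nPi).
under [X in chol _ X]eq_fun do rewrite big_cons Pi.
by apply: cholD => //; exact: FU.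
Qed.

Lemma chol_prod (I : Type) (s : seq I) (P : pred I) U (F : I -> R[i] -> R[i]) :
  (forall i, P i -> chol U (F i)) -> chol U (fun z => \prod_(i <- s | P i) F i z).
Proof.
move=> FU; elim: s => [|i s IH].
  by under [X in chol _ X]eq_fun do rewrite big_nil; exact: chol_cst.
have [Pi|nPi] := boolP (P i); last first.
  by under [X in chol _ X]eq_fun do rewrite big_cons (negbTE nPi).
under [X in chol _ X]eq_fun do rewrite big_cons Pi.
by apply: cholM => //; exact: FU.
Qed.

Lemma chol_horner U (p : {poly R[i]}) : chol U (fun z => p.[z]).
Proof.
elim/poly_ind: p => [|p c IH].
  have -> : (fun z => (0 : {poly R[i]}).[z]) = fun=> 0 by apply/funext => z; rewrite horner0.
  exact: chol_cst.
have -> : (fun z => (p * 'X + c%:P).[z]) = fun z => p.[z] * z + c.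
  by apply/funext => z; rewrite hornerMXaddC.
apply: cholD; last exact: chol_cst.
by apply: cholM => //; exact: chol_id.
Qed.

Lemma copen_orect (x1 x2 y1 y2 : R) : copen (orect x1 x2 y1 y2).
Proof.
move=> z [/andP[zx1 zx2] /andP[zy1 zy2]].
exists (Num.min (Num.min (Re z - x1) (x2 - Re z)) (Num.min (Im z - y1) (y2 - Im z))).
  by rewrite !lt_min !subr_gt0 zx1 zx2 zy1.
move=> w; rewrite !lt_min => /andP[/andP[h1 h2] /andP[h3 h4]].
have := cmod_Re (w - z); have := cmod_Im (w - z); rewrite !raddfB /= !ler_norml.
by move=> /andP[? ?] /andP[? ?]; split; apply/andP; split; lra.
Qed.

Lemma copenI U V : copen U -> copen V -> copen (U `&` V).
Proof.
move=> oU oV z [/oU[r r0 rU] /oV[s s0 sV]]; exists (Num.min r s).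
  by rewrite lt_min r0.
by move=> w; rewrite lt_min => /andP[/rU ? /sV].
Qed.

Lemma copen_square U z : copen U -> U z ->
  exists2 s, 0 < s & crect (Re z - s) (Re z + s) (Im z - s) (Im z + s) `<=` U.
Proof.
move=> oU /oU[r r0 rU]; exists (r / 3); first by lra.
move=> w [/andP[? ?] /andP[? ?]]; apply: rU; apply: le_lt_trans (cmod_ReIm _) _.
rewrite !raddfB /=.
have : `|Re w - Re z| <= r / 3 by rewrite ler_norml; lra.
have : `|Im w - Im z| <= r / 3 by rewrite ler_norml; lra.
lra.
Qed.

Lemma square_center z s : 0 < s -> orect (Re z - s) (Re z + s) (Im z - s) (Im z + s) z.
Proof. by move=> s0; split; apply/andP; split; lra. Qed.

Lemma square_lt (a s : R) : 0 < s -> a - s < a + s.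
Proof. by move=> s0; lra. Qed.

Lemma chol_cauchy (x1 x2 y1 y2 : R) g : x1 < x2 -> y1 < y2 -> rcont x1 x2 y1 y2 g ->
  chol (orect x1 x2 y1 y2) (cauchy_int x1 x2 y1 y2 g).
Proof. by move=> x12 y12 gc z zR; eexists; exact: cauchy_deriv. Qed.

(** Cauchy integrals of merely continuous functions are holomorphic. With g = f this shows that a
    continuous function satisfying Cauchy's formula is holomorphic, as uniform limits do. *)
Lemma cauchy_rep_chol (x1 x2 y1 y2 : R) f g : x1 < x2 -> y1 < y2 -> rcont x1 x2 y1 y2 g ->
  (forall z, orect x1 x2 y1 y2 z -> f z * winding x1 x2 y1 y2 z = cauchy_int x1 x2 y1 y2 g z) ->
  chol (orect x1 x2 y1 y2) f.
Proof.
move=> x12 y12 gc fE.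
apply: (@chol_ext _ _ (fun z => cauchy_int x1 x2 y1 y2 g z * (winding x1 x2 y1 y2 z)^-1)).
- exact: copen_orect.
- by move=> z zR; rewrite -fE// mulfK// winding_neq0.
apply: cholM; first exact: chol_cauchy.
apply: cholV; first by move=> z; exact: winding_neq0.
by apply: chol_cauchy => // z _; exact: ccont_cst.
Qed.

(** The quotient (f(z) - f(p)) / (z - p) has a removable singularity: near p it is the Cauchy
    integral [h0] of f(w) / (w - p), because 1/(w-z) - 1/(w-p) = (z-p) / ((w-p)(w-z)). The value of
    h at p is taken from [h0]. *)
Lemma divided_difference U f p : copen U -> chol U f -> U p ->
  exists2 h, chol U h & forall z, U z -> f z = f p + (z - p) * h z.
Proof.
move=> oU fU Up; have [s s0 sU] := copen_square oU Up.
set a1 := Re p - s in sU; set a2 := Re p + s in sU.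
set b1 := Im p - s in sU; set b2 := Im p + s in sU.
have a12 : a1 < a2 := square_lt _ s0; have b12 : b1 < b2 := square_lt _ s0.
have pR : orect a1 a2 b1 b2 p := square_center p s0.
have fc : rcont a1 a2 b1 b2 f by move=> z [/sU Uz _]; exact: chol_ccont Uz.
have fR w : crect a1 a2 b1 b2 w -> exists d, cderiv f w d by move=> /sU/fU.
have gc := rcont_cauchy pR fc.
pose W := winding a1 a2 b1 b2 p.
have W0 : W != 0 by exact: winding_neq0.
pose h0 z := cauchy_int a1 a2 b1 b2 (fun w => f w / (w - p)) z / W.
have h0c : chol (orect a1 a2 b1 b2) h0.
  by apply: cholM; [exact: chol_cauchy|exact: chol_cst].
pose h z := if z == p then h0 z else (f z - f p) / (z - p).
have hE z : orect a1 a2 b1 b2 z -> h z = h0 z.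
  move=> zR; rewrite /h; case: eqVneq => // zp.
  have fz := cauchy_formula a12 b12 zR fR; have fp := cauchy_formula a12 b12 pR fR.
  rewrite (winding_const a12 b12 zR pR) -/W in fz.
  have zp0 : z - p != 0 by rewrite subr_eq0.
  apply: (mulIf zp0); rewrite divfK// /h0.
  apply: (mulIf W0); rewrite [RHS]mulrAC divfK// mulrBl -fz -fp /cauchy_int.
  have zc := rcont_cauchy zR fc.
  have pc : rcont a1 a2 b1 b2 (fun w => - 1 * (f w / (w - p))).
    by move=> w wb; apply: ccontM; [exact: ccont_cst|exact: gc].
  have -> : rint a1 a2 b1 b2 (fun w => f w / (w - z)) - rint a1 a2 b1 b2 (fun w => f w / (w - p))
      = rint a1 a2 b1 b2 (fun w => f w / (w - z) + - 1 * (f w / (w - p))).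
    by rewrite (rintD _ _ zc pc) ?(rintZ _ _ _ gc) ?ltW// mulN1r.
  rewrite mulrC -(rintZ _ _ _ (rcont_cauchy zR gc)) ?ltW//.
  apply: rint_ext; rewrite ?ltW// => w wb.
  have wz := rbdry_neq zR wb; have wp := rbdry_neq pR wb.
  by field; rewrite !subr_eq0 wz wp.
exists h; last first.
  move=> z _; rewrite /h; case: eqVneq => [->|zp]; first by rewrite subrr mul0r addr0.
  by rewrite mulrC divfK ?subr_eq0// addrC subrK.
move=> z Uz; have [zp|zp] := eqVneq z p.
  by rewrite zp; exact: (chol_ext (@copen_orect _ _ _ _) hE h0c).
have [d zd] := fU z Uz.
have H : chol [set w | U w /\ w != p] (fun z => (f z - f p) / (z - p)).
  apply: cholM; first by apply: cholB; [by apply: chol_subset fU => w []|exact: chol_cst].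
  apply: cholV; first by move=> w [_]; rewrite subr_eq0.
  by apply: cholB; [exact: chol_id|exact: chol_cst].
have [d' hd] := H z (conj Uz zp); exists d'.
apply: (@cderiv_near _ _ _ _ _ (cmod (z - p)) _ _ hd).
  by rewrite cmod_gt0 subr_eq0.
move=> w wz; rewrite /h; case: eqVneq => // wp.
by rewrite wp cmod_distC ltxx in wz.
Qed.

Lemma uniform_limit_ccont U (F : nat -> R[i] -> R[i]) f z : copen U -> U z ->
  (forall n, chol U (F n)) ->
  (forall e, 0 < e -> exists n, forall w, U w -> cmod (F n w - f w) <= e) -> ccont f z.
Proof.
move=> oU Uz FU Ff e e0; have e30 : 0 < e / 3 by lra.
have [n nP] := Ff _ e30; have [r r0 rU] := oU z Uz.
have [r' r'0 r'P] := chol_ccont (FU n) Uz e30.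
exists (Num.min r r'); first by rewrite lt_min r0.
move=> w; rewrite lt_min => /andP[/rU Uw /r'P le1].
have -> : f w - f z = - (F n w - f w) + (F n w - F n z) + (F n z - f z) by ring.
apply: le_trans (cmodD _ _) _; apply: le_trans (lerD (cmodD _ _) (lexx _)) _.
by have := nP w Uw; have := nP z Uz; rewrite cmodN; lra.
Qed.

(** The limit is continuous, and Cauchy's formula for [F n] passes to it under uniform convergence
    on the boundary of a small square. *)
Theorem uniform_limit_chol U (F : nat -> R[i] -> R[i]) f : copen U ->
  (forall n, chol U (F n)) ->
  (forall e, 0 < e -> exists n, forall w, U w -> cmod (F n w - f w) <= e) -> chol U f.
Proof.
move=> oU FU Ff z Uz.
have fc w : U w -> ccont f w by move=> Uw; exact: uniform_limit_ccont Uw FU Ff.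
have [s s0 sU] := copen_square oU Uz.
set a1 := Re z - s in sU; set a2 := Re z + s in sU.
set b1 := Im z - s in sU; set b2 := Im z + s in sU.
have a12 : a1 < a2 := square_lt _ s0; have b12 : b1 < b2 := square_lt _ s0.
have zR : orect a1 a2 b1 b2 z := square_center z s0.
have bU w : rbdry a1 a2 b1 b2 w -> U w by move=> [/sU].
have fcb : rcont a1 a2 b1 b2 f by move=> w /bU/fc.
suff H : chol (orect a1 a2 b1 b2) f by exact: H.
apply: (cauchy_rep_chol a12 b12 fcb) => w wR.
have wU : U w by apply: sU; exact: orect_crect.
have ic : rcont a1 a2 b1 b2 (fun x => (x - w)^-1).
  move=> x xb; apply: ccontV; first by rewrite subr_eq0; exact: rbdry_neq xb.
  exact: ccont_subr.
have [M M0 MP] : exists2 M : R, 0 < M & forall x, rbdry a1 a2 b1 b2 x -> cmod (x - w)^-1 <= M.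
  case: (wR) => /andP[w1 w2] /andP[w3 w4].
  set m := Num.min (Num.min (Re w - a1) (a2 - Re w)) (Num.min (Im w - b1) (b2 - Im w)).
  have m0 : 0 < m by rewrite !lt_min !subr_gt0 w1 w2 w3.
  exists m^-1; first by rewrite invr_gt0.
  move=> x [xR xn]; rewrite cmodV lef_pV2 ?posrE// ?cmod_gt0; last first.
    by rewrite subr_eq0; apply/eqP => xw; apply: xn; rewrite xw.
  rewrite leNgt; apply/negP; rewrite !lt_min => /andP[/andP[h1 h2] /andP[h3 h4]].
  apply: xn; have := cmod_Re (x - w); have := cmod_Im (x - w); rewrite !raddfB /= !ler_norml.
  by move=> /andP[? ?] /andP[? ?]; split; apply/andP; split; lra.
pose W := winding a1 a2 b1 b2 w.
(* K collects what multiplies the uniform error: [cmod W] at the point w, and perimeter times kernel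
   bound in the integral. *)
pose K := cmod W + 2 * ((a2 - a1) + (b2 - b1)) * M.
have K0 : 0 <= K.
  rewrite addr_ge0 ?cmod_ge0// mulr_ge0 ?(ltW M0)// mulr_ge0// addr_ge0//.
    by rewrite subr_ge0 ltW.
  by rewrite subr_ge0 ltW.
have K1 : 0 < K + 1 by lra.
apply/eqP; rewrite -subr_eq0 -cmod_eq0 eq_le cmod_ge0 andbT; apply/ler_addgt0Pl => e e0.
rewrite addr0; have [|n nP] := Ff (e / (K + 1)); first by rewrite divr_gt0.
have FR x : crect a1 a2 b1 b2 x -> exists d, cderiv (F n) x d by move=> /sU/FU.
have Fw := cauchy_formula a12 b12 wR FR; rewrite -/W in Fw *.
have Fc : rcont a1 a2 b1 b2 (F n) by move=> x /bU Ux; exact: chol_ccont Ux.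
have c1 := rcont_cauchy wR Fc; have c2 := rcont_cauchy wR fcb.
have c3 : rcont a1 a2 b1 b2 (fun x => - 1 * (f x / (x - w))).
  by move=> x xb; apply: ccontM; [exact: ccont_cst|exact: c2].
have -> : f w * W - cauchy_int a1 a2 b1 b2 f w = - (F n w - f w) * W +
    rint a1 a2 b1 b2 (fun x => F n x / (x - w) + - 1 * (f x / (x - w))).
  rewrite (rintD _ _ c1 c3) ?(rintZ _ _ _ c2) ?ltW//.
  by rewrite -/(cauchy_int _ _ _ _ (F n) w) Fw -/(cauchy_int _ _ _ _ f w); ring.
apply: le_trans (cmodD _ _) _; rewrite cmodM cmodN.
have h1 : cmod (F n w - f w) * cmod W <= e / (K + 1) * cmod W.
  by rewrite ler_wpM2r ?cmod_ge0// nP.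
have h2 : cmod (rint a1 a2 b1 b2 (fun x => F n x / (x - w) + - 1 * (f x / (x - w)))) <=
    2 * ((a2 - a1) + (b2 - b1)) * (e / (K + 1) * M).
  apply: rint_le; rewrite ?ltW//.
    by move=> x xb; apply: ccontD; [exact: c1|exact: c3].
  move=> x xb; have -> : F n x / (x - w) + - 1 * (f x / (x - w)) = (F n x - f x) / (x - w).
    by ring.
  rewrite cmodM; apply: ler_pM; rewrite ?cmod_ge0//; first by apply: nP; exact: bU.
  exact: MP.
apply: le_trans (lerD h1 h2) _.
have -> : e / (K + 1) * cmod W + 2 * (a2 - a1 + (b2 - b1)) * (e / (K + 1) * M) = e / (K + 1) * K.
  by rewrite /K; ring.
rewrite mulrAC ler_pdivrMr//; apply: ler_wpM2l; first exact: ltW.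
by rewrite lerDl.
Qed.

(** Cauchy's formula on a square of half side s around z: the perimeter is [8 * s], the kernel at
    most [1 / s], and f at most [e / 8] once s is large. *)
Theorem liouville_decay f : chol setT f ->
  (forall e, 0 < e -> exists N : R, forall z, N <= cmod z -> cmod (f z) <= e) ->
  forall z, f z = 0.
Proof.
move=> fT f0 z.
have sq s : 0 < s -> orect (Re z - s) (Re z + s) (Im z - s) (Im z + s) z := @square_center z s.
pose W s := winding (Re z - s) (Re z + s) (Im z - s) (Im z + s) z.
(* The formula must be divided by a number independent of s. *)
have WE s : 1 <= s -> W s = W 1.
  move=> s1; rewrite /W /winding /cauchy_int; apply: rint_shrink; try lra.
  move=> w _ wn; have wz : w != z.
    by apply/eqP => E; apply: wn; rewrite E; exact: sq.
  exists (0 * (w - z)^-1 + 1 * (- 1 / (w - z) ^+ 2)).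
  by apply: cderivM; [exact: cderiv_cst|exact: cderiv_inv_subr].
have W0 : W 1 != 0 by apply: winding_neq0; rewrite ?square_lt//; exact: sq.
apply/eqP; rewrite -(inj_eq (mulIf W0)) mul0r -cmod_eq0 eq_le cmod_ge0 andbT.
apply/ler_addgt0Pl => e e0; rewrite addr0.
have [|N NP] := f0 (e / 8); first by lra.
pose s := Num.max 1 (N + cmod z).
have s1 : 1 <= s by rewrite le_max lexx.
have s0 : 0 < s by lra.
have sN : N <= s - cmod z by rewrite lerBrDr le_max lexx orbT.
rewrite -(WE s s1) -cauchy_formula ?square_lt//; last by move=> w _; exact: fT.
  have fc : rcont (Re z - s) (Re z + s) (Im z - s) (Im z + s) f.
    by move=> w _; exact: chol_ccont fT _.
  apply: le_trans (rint_le (M := e / 8 / s) (ltW (square_lt _ s0)) (ltW (square_lt _ s0)) _ _) _.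
  - exact: rcont_cauchy (sq s s0) fc.
  - move=> w [_ wn].
    have sw : s <= cmod (w - z).
      rewrite leNgt; apply/negP => lts; apply: wn.
      have := cmod_Re (w - z); have := cmod_Im (w - z); rewrite !raddfB /= !ler_norml.
      by move=> /andP[? ?] /andP[? ?]; split; apply/andP; split; lra.
    rewrite cmodM cmodV; apply: ler_pM; rewrite ?cmod_ge0 ?invr_ge0 ?cmod_ge0//.
      by apply: NP; have := cmodB w z; lra.
    by rewrite lef_pV2 ?posrE//; lra.
  - have -> : 2 * (Re z + s - (Re z - s) + (Im z + s - (Im z - s))) * (e / 8 / s) = e.
      by field; rewrite gt_eqF.
    exact: lexx.
exact: sq.
Qed.

End Holomorphic.

(** * Holomorphic matrices *)

Section MatrixNorm.
Context {R : realType}.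
Implicit Types (m n p : nat) (U V : set R[i]).

(** This norm is submultiplicative, but the identity has norm n; this explains the factors n in
    later constants. *)
Definition mnorm m n (M : 'M[R[i]]_(m, n)) : R := \sum_i \sum_j cmod (M i j).

Lemma mnorm_ge0 m n (M : 'M[R[i]]_(m, n)) : 0 <= mnorm M.
Proof. by apply: sumr_ge0 => i _; apply: sumr_ge0 => j _; exact: cmod_ge0. Qed.

Lemma mnorm_entry m n (M : 'M[R[i]]_(m, n)) i j : cmod (M i j) <= mnorm M.
Proof.
rewrite /mnorm (bigD1 i)//= (bigD1 j)//= -addrA lerDl addr_ge0//.
  by apply: sumr_ge0 => k _; exact: cmod_ge0.
by apply: sumr_ge0 => k _; apply: sumr_ge0 => l _; exact: cmod_ge0.
Qed.

Lemma mnorm_le m n (M : 'M[R[i]]_(m, n)) c : (forall i j, cmod (M i j) <= c) ->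
  mnorm M <= (m * n)%:R * c.
Proof.
move=> Mc; apply: le_trans (_ : \sum_(i < m) \sum_(j < n) c <= _).
  by apply: ler_sum => i _; apply: ler_sum => j _; exact: Mc.
by rewrite !sumr_const !card_ord -mulrnA mulr_natl mulnC.
Qed.

Lemma mnormD m n (M N : 'M[R[i]]_(m, n)) : mnorm (M + N) <= mnorm M + mnorm N.
Proof.
rewrite /mnorm -big_split; apply: ler_sum => i _; rewrite -big_split.
by apply: ler_sum => j _; rewrite mxE cmodD.
Qed.

Lemma mnormN m n (M : 'M[R[i]]_(m, n)) : mnorm (- M) = mnorm M.
Proof. by apply: eq_bigr => i _; apply: eq_bigr => j _; rewrite mxE cmodN. Qed.

Lemma mnormB m n (M N : 'M[R[i]]_(m, n)) : mnorm (M - N) <= mnorm M + mnorm N.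
Proof. by rewrite -(mnormN N); exact: mnormD. Qed.

Lemma mnorm_eq0 m n (M : 'M[R[i]]_(m, n)) : mnorm M <= 0 -> M = 0.
Proof.
move=> M0; apply/matrixP => i j; rewrite mxE; apply/eqP; rewrite -cmod_eq0.
by rewrite eq_le cmod_ge0 andbT (le_trans (mnorm_entry _ _ _) M0).
Qed.

Lemma cmod_sum (I : finType) (F : I -> R[i]) : cmod (\sum_i F i) <= \sum_i cmod (F i).
Proof.
apply: (big_ind2 (fun (x : R[i]) (y : R) => cmod x <= y)); rewrite ?cmod0//.
by move=> x y x' y' xy x'y'; apply: le_trans (cmodD _ _) _; exact: lerD.
Qed.

Lemma mnormM m n p (M : 'M[R[i]]_(m, n)) (N : 'M[R[i]]_(n, p)) :
  mnorm (M *m N) <= mnorm M * mnorm N.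
Proof.
rewrite /mnorm mulr_suml; apply: ler_sum => i _.
apply: le_trans (_ : \sum_j \sum_k cmod (M i k) * cmod (N k j) <= _).
  apply: ler_sum => j _; rewrite mxE; apply: le_trans (cmod_sum _) _.
  by apply: ler_sum => k _; rewrite cmodM.
rewrite exchange_big mulr_suml; apply: ler_sum => k _.
rewrite -mulr_sumr ler_wpM2l ?cmod_ge0//.
rewrite (bigD1 k)//= lerDl.
by apply: sumr_ge0 => l _; apply: sumr_ge0 => j _; exact: cmod_ge0.
Qed.

Lemma mnorm1 n : mnorm (1%:M : 'M[R[i]]_n) = n%:R.
Proof.
rewrite /mnorm -[in RHS](card_ord n) -sum1_card natr_sum; apply: eq_bigr => i _.
rewrite (bigD1 i)//= mxE eqxx cmod1 big1 ?addr0// => j ji.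
by rewrite mxE eq_sym (negbTE ji) cmod0.
Qed.

(** A vector v killed by X equals - v (X - 1), so its norm is at most half of itself. *)
Lemma unitmx_near1 n (X : 'M[R[i]]_n) : mnorm (X - 1%:M) <= 2^-1 -> X \in unitmx.
Proof.
move=> X1; rewrite -row_free_unit; apply: inj_row_free => v vX.
have vE : v = - (v *m (X - 1%:M)) by rewrite mulmxBr vX mulmx1 sub0r opprK.
apply: mnorm_eq0; have : mnorm v <= mnorm v * 2^-1.
  rewrite {1}vE mnormN; apply: le_trans (mnormM _ _) _.
  by rewrite ler_wpM2l ?mnorm_ge0.
lra.
Qed.

Lemma mnorm_inv_near1 n (X : 'M[R[i]]_n) : mnorm (X - 1%:M) <= 2^-1 ->
  mnorm (invmx X) <= 2 * n%:R.
Proof.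
move=> X1; have Xu := unitmx_near1 X1.
have E : invmx X = 1%:M - invmx X *m (X - 1%:M).
  by rewrite mulmxBr mulVmx// mulmx1 opprB addrC subrK.
have := mnormB 1%:M (invmx X *m (X - 1%:M)); rewrite -E mnorm1.
have := mnormM (invmx X) (X - 1%:M).
have : mnorm (invmx X) * mnorm (X - 1%:M) <= mnorm (invmx X) * 2^-1.
  by rewrite ler_wpM2l ?mnorm_ge0.
lra.
Qed.

Definition cholmx m n U (M : R[i] -> 'M[R[i]]_(m, n)) :=
  forall i j, chol U (fun z => M z i j).

(** Invertibility is asked pointwise; the inverse is then holomorphic by Cramer's formula, see
    [cholmx_inv]. [GL_holoP] identifies this with [GL_holo]. *)
Definition cholGL n U (M : R[i] -> 'M[R[i]]_n) :=
  cholmx U M /\ forall z, U z -> M z \in unitmx.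

Lemma cholmx_subset m n U V (M : R[i] -> 'M[R[i]]_(m, n)) :
  U `<=` V -> cholmx V M -> cholmx U M.
Proof. by move=> UV MV i j; apply: chol_subset (MV i j). Qed.

Lemma cholGL_subset n U V (M : R[i] -> 'M[R[i]]_n) :
  U `<=` V -> cholGL V M -> cholGL U M.
Proof. by move=> UV [MV Mu]; split; [exact: cholmx_subset MV|move=> z /UV/Mu]. Qed.

Lemma cholmx_ext m n U (M N : R[i] -> 'M[R[i]]_(m, n)) : copen U ->
  (forall z, U z -> M z = N z) -> cholmx U N -> cholmx U M.
Proof. by move=> oU MN NU i j; apply: chol_ext (NU i j) => // z /MN ->. Qed.

Lemma cholmx_cst m n U (M : 'M[R[i]]_(m, n)) : cholmx U (fun=> M).
Proof. by move=> i j; exact: chol_cst. Qed.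

Lemma cholmxD m n U (M N : R[i] -> 'M[R[i]]_(m, n)) :
  cholmx U M -> cholmx U N -> cholmx U (fun z => M z + N z).
Proof.
move=> MU NU i j; under [X in chol _ X]eq_fun do rewrite mxE.
by apply: cholD; [exact: MU|exact: NU].
Qed.

Lemma cholmxZ m n U (f : R[i] -> R[i]) (M : R[i] -> 'M[R[i]]_(m, n)) :
  chol U f -> cholmx U M -> cholmx U (fun z => f z *: M z).
Proof.
by move=> fU MU i j; under [X in chol _ X]eq_fun do rewrite mxE; apply: cholM => //; exact: MU.
Qed.

Lemma cholmxM m n p U (M : R[i] -> 'M[R[i]]_(m, n)) (N : R[i] -> 'M[R[i]]_(n, p)) :
  cholmx U M -> cholmx U N -> cholmx U (fun z => M z *m N z).
Proof.
move=> MU NU i j; under [X in chol _ X]eq_fun do rewrite mxE.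
by apply: chol_sum => k _; apply: cholM; [exact: MU|exact: NU].
Qed.

Lemma chol_det n U (M : R[i] -> 'M[R[i]]_n) : cholmx U M -> chol U (fun z => \det (M z)).
Proof.
move=> MU; rewrite /determinant; apply: chol_sum => s _.
by apply: cholM; [exact: chol_cst|apply: chol_prod => i _; exact: MU].
Qed.

Lemma cholmx_inv n U (M : R[i] -> 'M[R[i]]_n) : cholGL U M -> cholmx U (fun z => invmx (M z)).
Proof.
move=> [MU Mu] i j.
have Vd : chol U (fun z => (\det (M z))^-1).
  apply: cholV; last exact: chol_det.
  by move=> z /Mu; rewrite unitmxE unitfE.
have H : chol U (fun z => (\det (M z))^-1 * ((-1) ^+ (j + i) * \det (row' j (col' i (M z))))).
  apply: cholM => //; apply: cholM; first exact: chol_cst.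
  apply: chol_det => k l; under [X in chol _ X]eq_fun do rewrite !mxE.
  exact: MU.
move=> z Uz; have [d Hd] := H z Uz.
(* [invmx] is given by the adjugate only at units, and derivability at z concerns a full
   neighbourhood, which U need not contain. *)
have [r [r0 ur]] : exists r : R, 0 < r /\ forall w, cmod (w - z) < r -> M w \in unitmx.
  have dc := chol_ccont (chol_det MU) Uz.
  have d0 : 0 < cmod (\det (M z)).
    by rewrite cmod_gt0; have := Mu z Uz; rewrite unitmxE unitfE.
  have [|r r0 rP] := dc (cmod (\det (M z)) / 2); first by rewrite divr_gt0.
  exists r; split => // w /rP le1; rewrite unitmxE unitfE -cmod_gt0.
  by have := cmod_le_dist (\det (M z)) (\det (M w)); lra.
exists d; apply: cderiv_near r0 _ Hd => w /ur wu.
by rewrite /invmx wu !mxE.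
Qed.

Lemma cholGLM n U (M N : R[i] -> 'M[R[i]]_n) :
  cholGL U M -> cholGL U N -> cholGL U (fun z => M z *m N z).
Proof.
move=> [MU Mu] [NU Nu]; split; first exact: cholmxM.
by move=> z Uz; rewrite unitmx_mul Mu// Nu.
Qed.

Lemma cholGL_inv n U (M : R[i] -> 'M[R[i]]_n) : cholGL U M -> cholGL U (fun z => invmx (M z)).
Proof.
by move=> MU; split; [exact: cholmx_inv|move=> z /MU.2; rewrite unitmx_inv].
Qed.

Lemma cholGLZ n U (f : R[i] -> R[i]) (M : R[i] -> 'M[R[i]]_n) :
  chol U f -> (forall z, U z -> f z != 0) -> cholGL U M -> cholGL U (fun z => f z *: M z).
Proof.
move=> fU f0 [MU Mu]; split; first exact: cholmxZ.
by move=> z Uz; rewrite unitmxZ ?Mu// unitfE f0.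
Qed.

Lemma cholGL_cst n U (M : 'M[R[i]]_n) : M \in unitmx -> cholGL U (fun=> M).
Proof. by move=> Mu; split; [exact: cholmx_cst|]. Qed.

End MatrixNorm.

(** The intervals of centre [u k] and radius [2 * c * 2^-1 ^+ k] are nested, since the radius drops
    at each step by the bound on the increment. *)
Lemma geometric_cvg_real (R : realType) (u : nat -> R) (c : R) :
  (forall k, `|u k.+1 - u k| <= c * 2^-1 ^+ k) ->
  exists l, forall k, `|u k - l| <= 2 * c * 2^-1 ^+ k.
Proof.
move=> uc; have c0 : 0 <= c by have := uc 0; rewrite expr0 mulr1; apply: le_trans.
pose a k := u k - 2 * c * 2^-1 ^+ k; pose b k := u k + 2 * c * 2^-1 ^+ k.
have aS k : a k <= a k.+1.
  by have := uc k; rewrite ler_norml => /andP[? ?]; rewrite /a exprS; lra.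
have bS k : b k.+1 <= b k.
  by have := uc k; rewrite ler_norml => /andP[? ?]; rewrite /b exprS; lra.
have aD i j : (i <= j)%N -> a i <= a j.
  by move=> /subnK <-; elim: (j - i)%N => // n /le_trans -> //; rewrite addSn.
have bD i j : (i <= j)%N -> b j <= b i.
  by move=> /subnK <-; elim: (j - i)%N => // n; apply: le_trans; rewrite addSn.
have ab i j : a i <= b j.
  apply: le_trans (aD _ _ (leq_maxl i j)) _.
  apply: le_trans _ (bD _ _ (leq_maxr i j)).
  rewrite /a /b; have : 0 <= 2 * c * 2^-1 ^+ maxn i j.
    by rewrite !mulr_ge0// exprn_ge0.
  lra.
exists (sup (range a)) => k.
have h1 : a k <= sup (range a).
  apply: ub_le_sup; last by exists k.
  by exists (b k) => _ [i _ <-].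
have h2 : sup (range a) <= b k by apply: ge_sup; [exists (a 0), 0|move=> _ [i _ <-]].
by rewrite ler_norml; move: h1 h2; rewrite /a /b => ? ?; apply/andP; split; lra.
Qed.

Lemma geometric_cvg (R : realType) (u : nat -> R[i]) (c : R) :
  (forall k, cmod (u k.+1 - u k) <= c * 2^-1 ^+ k) ->
  exists l, forall k, cmod (u k - l) <= 4 * c * 2^-1 ^+ k.
Proof.
move=> uc.
have [|l1 l1P] := @geometric_cvg_real R (fun k => Re (u k)) c.
  by move=> k; apply: le_trans (uc k); rewrite -raddfB; exact: cmod_Re.
have [|l2 l2P] := @geometric_cvg_real R (fun k => Im (u k)) c.
  by move=> k; apply: le_trans (uc k); rewrite -raddfB; exact: cmod_Im.
exists (l1 +i* l2) => k; apply: le_trans (cmod_ReIm _) _; rewrite !raddfB /=.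
by have := l1P k; have := l2P k; lra.
Qed.

Lemma le_half_pow (R : realType) (r c : R) : (forall k, r <= c * 2^-1 ^+ k) -> r <= 0.
Proof.
move=> rc; apply/ler_addgt0Pl => e e0; rewrite addr0.
have c0 : 0 < `|c| + 1 by rewrite ltr_wpDl.
have [|k kr] := @exists_half_pow_lt R (e / (`|c| + 1)); first by rewrite divr_gt0.
apply: le_trans (rc k) _; apply: le_trans (_ : (`|c| + 1) * (2^-1) ^+ k <= _).
  by rewrite ler_wpM2r ?exprn_ge0//; have := ler_norm c; lra.
by rewrite mulrC -ler_pdivlMr// ltW.
Qed.

(** * Cartan's factorization *)

Section Newton.
Context {R : realType}.
Implicit Types (n : nat) (s t : R) (A B : R -> set R[i]).

(** Pairs of open sets A s, B s, shrinking as s grows, for which Cartan's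
    factorization holds after an arbitrarily small shrinking. *)
Record split_family (s0 : R) A B : Prop := SplitFamily {
  sf_openA : forall s, copen (A s);
  sf_openB : forall s, copen (B s);
  sf_monoA : forall s t, s <= t -> A t `<=` A s;
  sf_monoB : forall s t, s <= t -> B t `<=` B s;
  sf_add : exists2 K : R, 0 < K & forall s t, 0 <= s -> s < t -> t <= s0 ->
    forall g M, 0 <= M -> chol (A s `&` B s) g ->
    (forall z, (A s `&` B s) z -> cmod (g z) <= M) ->
    exists h1 h2, [/\ chol (A t) h1, chol (B t) h2,
      (forall z, A t z -> cmod (h1 z) <= K * M / (t - s)),
      (forall z, B t z -> cmod (h2 z) <= K * M / (t - s)) &
      forall z, (A t `&` B t) z -> g z = h1 z + h2 z];
  sf_bounded : forall s t g, 0 <= s -> s < t -> t <= s0 -> chol (A s `&` B s) g ->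
    exists M : R, forall z, (A t `&` B t) z -> cmod (g z) <= M;
  sf_approx : forall s t g (e : R), 0 <= s -> s < t -> t <= s0 -> chol (A s `&` B s) g ->
    0 < e -> exists p q : {poly R[i]}, [/\ q != 0,
      (forall z, root q z -> ~ (A t `&` B t) z) &
      forall z, (A t `&` B t) z -> cmod (g z - p.[z] / q.[z]) <= e]
}.

(** Factors of a matrix do not commute; exchanging the two sides provides the factorization in the
    other order, which [cartan] needs for its correction term. *)
Lemma split_family_sym s0 A B : split_family s0 A B -> split_family s0 B A.
Proof.
case=> oA oB mA mB [K K0 KP] bnd app; split=> //.
- exists K => // s t s_ge0 st ts0 g M M0; rewrite setIC => gc gM.
  have [h1 [h2 [h1c h2c h1M h2M gE]]] := KP s t s_ge0 st ts0 g M M0 gc gM.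
  by exists h2, h1; split=> // z; rewrite setIC => /gE ->; rewrite addrC.
- by move=> s t g s_ge0 st ts0; rewrite setIC [B t `&` _]setIC; exact: bnd.
- by move=> s t g e s_ge0 st ts0; rewrite setIC [B t `&` _]setIC; exact: app.
Qed.

Lemma split_mx s0 A B n : split_family s0 A B -> exists2 K : R, 0 < K &
  forall s t, 0 <= s -> s < t -> t <= s0 ->
    forall (g : R[i] -> 'M[R[i]]_n) M, 0 <= M -> cholmx (A s `&` B s) g ->
    (forall z, (A s `&` B s) z -> mnorm (g z) <= M) ->
    exists h1 h2 : R[i] -> 'M[R[i]]_n, [/\ cholmx (A t) h1, cholmx (B t) h2,
      (forall z, A t z -> mnorm (h1 z) <= K * M / (t - s)),
      (forall z, B t z -> mnorm (h2 z) <= K * M / (t - s)) &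
      forall z, (A t `&` B t) z -> g z = h1 z + h2 z].
Proof.
case=> _ _ _ _ [K K0 KP] _ _.
(* The added 1 keeps the constant positive when n = 0. *)
have nn0 : 0 < (n * n)%:R + 1 :> R by rewrite ltr_wpDl.
exists (((n * n)%:R + 1) * K); first by rewrite mulr_gt0.
move=> s t s_ge0 st ts0 g M M0 gc gM.
have H (ij : 'I_n * 'I_n) : exists h : (R[i] -> R[i]) * (R[i] -> R[i]),
    [/\ chol (A t) h.1, chol (B t) h.2,
      (forall z, A t z -> cmod (h.1 z) <= K * M / (t - s)),
      (forall z, B t z -> cmod (h.2 z) <= K * M / (t - s)) &
      forall z, (A t `&` B t) z -> g z ij.1 ij.2 = h.1 z + h.2 z].
  have [|h1 [h2 ?]] := KP s t s_ge0 st ts0 (fun z => g z ij.1 ij.2) M M0 (gc ij.1 ij.2).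
    by move=> z /gM; apply: le_trans; exact: mnorm_entry.
  by exists (h1, h2).
have [h hP] := choice H.
have bnd : (n * n)%:R * (K * M / (t - s)) <= ((n * n)%:R + 1) * K * M / (t - s).
  rewrite -!mulrA ler_wpM2r ?lerDl// !mulr_ge0 ?invr_ge0 ?subr_ge0// ltW//.
exists (fun z => \matrix_(i, j) (h (i, j)).1 z), (fun z => \matrix_(i, j) (h (i, j)).2 z).
split.
- by move=> i j; under [X in chol _ X]eq_fun do rewrite mxE; have [] := hP (i, j).
- by move=> i j; under [X in chol _ X]eq_fun do rewrite mxE; have [] := hP (i, j).
- move=> z zA; apply: le_trans bnd; apply: mnorm_le => i j; rewrite mxE.
  by have [_ _ hA _ _] := hP (i, j); exact: hA.
- move=> z zB; apply: le_trans bnd; apply: mnorm_le => i j; rewrite mxE.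
  by have [_ _ _ hB _] := hP (i, j); exact: hB.
- move=> z zAB; apply/matrixP => i j; rewrite !mxE.
  by have [_ _ _ _ hE] := hP (i, j); exact: hE.
Qed.

Lemma mx_limit n (U : set R[i]) (F : nat -> R[i] -> 'M[R[i]]_n) (c : R) : copen U ->
  (forall k, cholmx U (F k)) ->
  (forall k z, U z -> mnorm (F k.+1 z - F k z) <= c * 2^-1 ^+ k) ->
  exists G, cholmx U G /\ forall k z, U z ->
    mnorm (F k z - G z) <= (n * n)%:R * (4 * c) * 2^-1 ^+ k.
Proof.
move=> oU FU Fc.
have H (zij : (R[i] * ('I_n * 'I_n))%type) : exists l, U zij.1 ->
    forall k, cmod (F k zij.1 zij.2.1 zij.2.2 - l) <= 4 * c * 2^-1 ^+ k.
  case: zij => z [i j] /=; have [Uz|nUz] := pselect (U z); last by exists 0.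
  have [|l lP] := @geometric_cvg R (fun k => F k z i j) c; last by exists l.
  move=> k; apply: le_trans (Fc k z Uz); have := mnorm_entry (F k.+1 z - F k z) i j.
  by rewrite !mxE.
have [l lP] := choice H.
exists (fun z => \matrix_(i, j) l (z, (i, j))); split.
  move=> i j; under [X in chol _ X]eq_fun do rewrite mxE.
  apply: (@uniform_limit_chol _ U (fun k z => F k z i j)) => //; first by move=> k; exact: FU.
  move=> e e0; have c0 : 0 < 4 * `|c| + 1 by rewrite ltr_wpDl ?mulr_ge0.
  have [|k kr] := @exists_half_pow_lt R (e / (4 * `|c| + 1)); first by rewrite divr_gt0.
  exists k => z Uz; apply: le_trans (lP (z, (i, j)) Uz k) _.
  apply: le_trans (_ : (4 * `|c| + 1) * (2^-1) ^+ k <= _).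
    by rewrite ler_wpM2r ?exprn_ge0//; have := ler_norm c; lra.
  by rewrite mulrC -ler_pdivlMr// ltW.
move=> k z Uz; rewrite -mulrA; apply: mnorm_le => i j; rewrite !mxE.
exact: (lP (z, (i, j)) Uz k).
Qed.

Local Notation mfun3 n :=
  ((R[i] -> 'M[R[i]]_n) * (R[i] -> 'M[R[i]]_n) * (R[i] -> 'M[R[i]]_n))%type.

(** Newton's iteration: if X = 1 + h1 + h2 with h1 on A and h2 on B, then
    (1 + h1)^-1 X (1 + h2)^-1 - 1 is quadratic in (h1, h2), which outweighs the
    loss incurred by shrinking the domains. *)
Theorem cartan_small s0 A B n s t : split_family s0 A B -> 0 <= s -> s < t -> t <= s0 ->
  exists2 eta : R, 0 < eta & forall X : R[i] -> 'M[R[i]]_n,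
    cholmx (A s `&` B s) X ->
    (forall z, (A s `&` B s) z -> mnorm (X z - 1%:M) <= eta) ->
    exists a b : R[i] -> 'M[R[i]]_n, [/\ cholGL (A t) a, cholGL (B t) b &
      forall z, (A t `&` B t) z -> X z = a z *m b z].
Proof.
move=> sf s_ge0 st ts0; have [K K0 KP] := split_mx n sf.
(* N bounds the norm of every matrix within 1/2 of the identity, and 2 N the norm of its inverse. *)
have [N [N1 nN]] : exists N : R, 1 <= N /\ n%:R + 2^-1 <= N.
  by exists (n%:R + 1); have : 0 <= n%:R :> R by []; split; lra.
have [d [d0 dE]] : exists d : R, 0 < d /\ d = t - s by exists (t - s); split; lra.
(* At stage k the corrections h1, h2 have size [c * x k ^+ 2]. The first condition keeps 1 + h1 and
   1 + h2 invertible and the drift of the factors small; the second makes the new error an eighth of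
   the old bound. *)
have [c [c0 cN cd]] : exists c : R, [/\ 0 < c, 8 * N * c <= 1 & 64 * N ^+ 2 * K * c <= d].
  have N0 : 0 < 8 * N by lra.
  have NK : 0 < 64 * N ^+ 2 * K by rewrite !mulr_gt0 ?exprn_gt0//; lra.
  exists (Num.min (1 / (8 * N)) (d / (64 * N ^+ 2 * K))); split.
  - by rewrite lt_min !divr_gt0.
  - by rewrite mulrC -ler_pdivlMr// ge_min lexx.
  - by rewrite mulrC -ler_pdivlMr// ge_min lexx orbT.
(* Chosen so that splitting an error [eta * x k ^+ 3] over the gap [d * x k / 2] costs exactly
   [c * x k ^+ 2]. *)
pose eta := c * d / (2 * K).
have eta0 : 0 < eta by rewrite divr_gt0 ?mulr_gt0.
have etaE : c = 2 * K * eta / d by rewrite /eta; field; rewrite !gt_eqF.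
have eta32 : 32 * N ^+ 2 * c ^+ 2 <= eta.
  rewrite /eta ler_pdivlMr ?mulr_gt0//.
  have -> : 32 * N ^+ 2 * c ^+ 2 * (2 * K) = c * (64 * N ^+ 2 * K * c) by ring.
  by rewrite ler_wpM2l// ltW.
exists eta => // X XAB X1.
pose x k : R := 2^-1 ^+ k.
have x0 k : 0 < x k by rewrite exprn_gt0 ?invr_gt0.
have xle1 k : x k <= 1 by rewrite exprn_ile1 ?invr_ge0// invf_le1 ?ler1n.
have xS k : x k.+1 = x k / 2 by rewrite /x exprSr.
(* The domains shrink from parameter s at k = 0 towards t, by half the remaining distance at each
   stage. *)
pose sg k := t - d * x k.
have sgt k : sg k <= t by rewrite /sg gerBl mulr_ge0// ltW.
have sgs k : s <= sg k.
  have : d * x k <= d by rewrite ler_piMr// ltW.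
  by rewrite /sg; lra.
have sgS k : sg k.+1 - sg k = d * x k / 2 by rewrite /sg xS; lra.
have sglt k : sg k < sg k.+1 by rewrite -subr_gt0 sgS divr_gt0 ?mulr_gt0.
(* The triple holds the current quotient and the left and right factors built so far. Division by
   the gap turns an error of order [x k ^+ 3] into corrections of order [x k ^+ 2], whose product,
   of order [x k ^+ 4], fits the next bound. The factors move by [x k / 4], which is the increment
   of [(1 - x k) / 2], so they never leave the ball of radius 1/2 about 1. *)
pose Inv k (Y : mfun3 n) :=
  [/\ cholmx (A (sg k) `&` B (sg k)) Y.1.1 /\
      forall z, (A (sg k) `&` B (sg k)) z -> mnorm (Y.1.1 z - 1%:M) <= eta * x k ^+ 3,
    cholmx (A (sg k)) Y.1.2 /\
      forall z, A (sg k) z -> mnorm (Y.1.2 z - 1%:M) <= (1 - x k) / 2,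
    cholmx (B (sg k)) Y.2 /\
      forall z, B (sg k) z -> mnorm (Y.2 z - 1%:M) <= (1 - x k) / 2 &
    forall z, (A (sg k) `&` B (sg k)) z -> X z = Y.1.2 z *m Y.1.1 z *m Y.2 z].
pose Close k (Y Y' : mfun3 n) :=
  (forall z, A (sg k.+1) z -> mnorm (Y'.1.2 z - Y.1.2 z) <= x k / 4) /\
  (forall z, B (sg k.+1) z -> mnorm (Y'.2 z - Y.2 z) <= x k / 4).
have nearN (M : 'M[R[i]]_n) (r : R) : 0 <= r -> mnorm (M - 1%:M) <= (1 - r) / 2 -> mnorm M <= N.
  move=> r0 M1; have := mnormD (M - 1%:M) 1%:M; rewrite subrK mnorm1; lra.
have step k Y : exists Y', Inv k Y -> Inv k.+1 Y' /\ Close k Y Y'.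
  have [[[Xc XM] [ac aM] [bc bM] XE]|nI] := pselect (Inv k Y); last by exists Y.
  case: Y Xc XM ac aM bc bM XE => [[Y a] b] /= Yc YM ac aM bc bM YE.
  have Y1c : cholmx (A (sg k) `&` B (sg k)) (fun z => Y z - 1%:M).
    by apply: cholmxD => //; exact: cholmx_cst.
  have etak : 0 <= eta * x k ^+ 3 by rewrite mulr_ge0 ?exprn_ge0// ltW.
  have [h1 [h2 []]] := KP (sg k) (sg k.+1) (le_trans s_ge0 (sgs k)) (sglt k)
    (le_trans (sgt _) ts0) _ _ etak Y1c YM.
  have -> : K * (eta * x k ^+ 3) / (sg k.+1 - sg k) = c * x k ^+ 2.
    by rewrite sgS etaE; field; rewrite !gt_eqF.
  move=> h1c h2c h1M h2M YhE.
  have subA : A (sg k.+1) `<=` A (sg k) by apply: sf_monoA sf _ _ _; exact: ltW.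
  have subB : B (sg k.+1) `<=` B (sg k) by apply: sf_monoB sf _ _ _; exact: ltW.
  have subAB : A (sg k.+1) `&` B (sg k.+1) `<=` A (sg k) `&` B (sg k).
    by move=> z [/subA ? /subB ?].
  have ck : c * x k ^+ 2 <= x k / (8 * N).
    rewrite ler_pdivlMr; last by lra.
    have -> : c * x k ^+ 2 * (8 * N) = (8 * N * c) * x k * x k by ring.
    apply: ler_piMl; first exact: ltW.
    by apply: mulr_ile1 => //; [rewrite !mulr_ge0// ?ltW//; lra|exact: ltW].
  have ck8 : c * x k ^+ 2 <= 8^-1.
    apply: le_trans ck _; rewrite ler_pdivrMr; last by lra.
    by have := xle1 k; lra.
  have near1 (h : 'M[R[i]]_n) : mnorm h <= c * x k ^+ 2 -> mnorm (1%:M + h - 1%:M) <= 2^-1.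
    by rewrite addrC addKr => ?; lra.
  have Nck : N * (c * x k ^+ 2) <= x k / 8.
    apply: le_trans (ler_wpM2l _ ck) _; first by lra.
    by rewrite le_eqVlt; apply/orP; left; apply/eqP; field; lra.
  have h1A : cholmx (A (sg k.+1)) (fun z => 1%:M + h1 z) by apply: cholmxD => //; exact: cholmx_cst.
  have h2B : cholmx (B (sg k.+1)) (fun z => 1%:M + h2 z) by apply: cholmxD => //; exact: cholmx_cst.
  have G1 : cholGL (A (sg k.+1)) (fun z => 1%:M + h1 z).
    by split=> // z /h1M/near1/unitmx_near1.
  have G2 : cholGL (B (sg k.+1)) (fun z => 1%:M + h2 z).
    by split=> // z /h2M/near1/unitmx_near1.
  have cA : forall z, A (sg k.+1) z -> mnorm (a z *m (1%:M + h1 z) - a z) <= x k / 4.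
    move=> z zA; rewrite mulmxDr mulmx1 addrAC subrr add0r; apply: le_trans (mnormM _ _) _.
    have aN := nearN _ _ (ltW (x0 k)) (aM z (subA z zA)).
    apply: le_trans (ler_pM (mnorm_ge0 _) (mnorm_ge0 _) aN (h1M z zA)) _.
    by have := x0 k; lra.
  have cB : forall z, B (sg k.+1) z -> mnorm ((1%:M + h2 z) *m b z - b z) <= x k / 4.
    move=> z zB; rewrite mulmxDl mul1mx addrAC subrr add0r; apply: le_trans (mnormM _ _) _.
    have bN := nearN _ _ (ltW (x0 k)) (bM z (subB z zB)).
    apply: le_trans (ler_pM (mnorm_ge0 _) (mnorm_ge0 _) (h2M z zB) bN) _.
    by rewrite mulrC; have := x0 k; lra.
  exists (fun z => invmx (1%:M + h1 z) *m Y z *m invmx (1%:M + h2 z),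
    fun z => a z *m (1%:M + h1 z), fun z => (1%:M + h2 z) *m b z) => _.
  split; last by [].
  have AB1 : A (sg k.+1) `&` B (sg k.+1) `<=` A (sg k.+1) by move=> z [].
  have AB2 : A (sg k.+1) `&` B (sg k.+1) `<=` B (sg k.+1) by move=> z [].
  split=> /=.
  - split.
      apply: cholmxM; first apply: cholmxM.
      + exact: cholmx_subset AB1 (cholmx_inv G1).
      + exact: cholmx_subset subAB Yc.
      + exact: cholmx_subset AB2 (cholmx_inv G2).
    move=> z zAB; have [zA zB] := zAB.
    (* Hence the new quotient differs from 1 by (1 + h1)^-1 h1 h2 (1 + h2)^-1 only. *)
    have E : Y z = (1%:M + h1 z) *m (1%:M + h2 z) - h1 z *m h2 z.
      have -> : Y z = 1%:M + (Y z - 1%:M) by rewrite addrC subrK.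
      rewrite (YhE z zAB) mulmxDl mul1mx mulmxDr mulmx1 !addrA addrK.
      by rewrite -!addrA [h1 z + h2 z]addrC.
    rewrite E mulmxBr mulmxBl !mulmxA mulVmx ?(G1.2 z zA)// mul1mx mulmxV ?(G2.2 z zB)//.
    rewrite addrC addKr mnormN.
    have i1 := mnorm_inv_near1 (near1 _ (h1M z zA)).
    have i2 := mnorm_inv_near1 (near1 _ (h2M z zB)).
    have {}i1 : mnorm (invmx (1%:M + h1 z)) <= 2 * N by lra.
    have {}i2 : mnorm (invmx (1%:M + h2 z)) <= 2 * N by lra.
    have B1 := le_trans (mnormM _ _) (ler_pM (mnorm_ge0 _) (mnorm_ge0 _) i1 (h1M z zA)).
    have B2 := le_trans (mnormM _ _) (ler_pM (mnorm_ge0 _) (mnorm_ge0 _) B1 (h2M z zB)).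
    apply: le_trans (mnormM _ _) _.
    apply: le_trans (ler_pM (mnorm_ge0 _) (mnorm_ge0 _) B2 i2) _.
    have -> : 2 * N * (c * x k ^+ 2) * (c * x k ^+ 2) * (2 * N) =
      32 * N ^+ 2 * c ^+ 2 * (x k ^+ 4 / 8) by field.
    have -> : eta * x k.+1 ^+ 3 = eta * (x k ^+ 3 / 8) by rewrite xS; field.
    apply: ler_pM => //.
    + by rewrite !mulr_ge0 ?exprn_ge0 ?ltW//; lra.
    + by rewrite divr_ge0 ?exprn_ge0 ?ltW.
    + by rewrite ler_pM2r ?invr_gt0// exprS ler_piMl ?exprn_ge0 ?xle1// ltW.
  - split; first by apply: cholmxM => //; exact: cholmx_subset subA ac.
    move=> z zA; have := mnormD (a z *m (1%:M + h1 z) - a z) (a z - 1%:M).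
    by rewrite addrA subrK xS; have := cA z zA; have := aM z (subA z zA); lra.
  - split; first by apply: cholmxM => //; exact: cholmx_subset subB bc.
    move=> z zB; have := mnormD ((1%:M + h2 z) *m b z - b z) (b z - 1%:M).
    by rewrite addrA subrK xS; have := cB z zB; have := bM z (subB z zB); lra.
  - move=> z zAB; have [zA zB] := zAB.
    rewrite !mulmxA -[a z *m _ *m invmx _]mulmxA mulmxV ?(G1.2 z zA)// mulmx1.
    rewrite -[_ *m invmx _ *m _]mulmxA mulVmx ?(G2.2 z zB)// mulmx1.
    exact: YE z (subAB z zAB).
have [nxt nxtP] := choice (fun kY : (nat * mfun3 n)%type => step kY.1 kY.2).
pose Y := fix Y (k : nat) : mfun3 n :=
  if k is k'.+1 then nxt (k', Y k') else (X, fun=> 1%:M, fun=> 1%:M).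
have sg0 : sg 0 = s by rewrite /sg /x expr0; lra.
have YI k : Inv k (Y k).
  elim: k => [|k IH]; last by have [] := nxtP (k, Y k) IH.
  rewrite /Inv sg0 /x !expr0; split=> /=.
  - by split => // z zAB; rewrite expr1n mulr1; exact: X1.
  - split; first exact: cholmx_cst.
    by move=> z _; rewrite !subrr mul0r /mnorm big1// => i _; rewrite big1// => j _; rewrite mxE cmod0.
  - split; first exact: cholmx_cst.
    by move=> z _; rewrite !subrr mul0r /mnorm big1// => i _; rewrite big1// => j _; rewrite mxE cmod0.
  - by move=> z _; rewrite mul1mx mulmx1.
have YC k : Close k (Y k) (Y k.+1) by have [] := nxtP (k, Y k) (YI k).
have subAt k : A t `<=` A (sg k) by exact: sf_monoA sf _ _ (sgt k).
have subBt k : B t `<=` B (sg k) by exact: sf_monoB sf _ _ (sgt k).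
have [||a [ac aL]] := @mx_limit _ (A t) (fun k => (Y k).1.2) 4^-1 (@sf_openA _ _ _ sf t).
- by move=> k; have [_ [ac _] _ _] := YI k; exact: cholmx_subset (subAt k) ac.
- by move=> k z zA; rewrite mulrC; apply: (YC k).1; exact: subAt.
have [||b [bc bL]] := @mx_limit _ (B t) (fun k => (Y k).2) 4^-1 (@sf_openB _ _ _ sf t).
- by move=> k; have [_ _ [bc _] _] := YI k; exact: cholmx_subset (subBt k) bc.
- by move=> k z zB; rewrite mulrC; apply: (YC k).2; exact: subBt.
have [C CE] : exists C : R, C = (n * n)%:R * (4 * 4^-1) by exists ((n * n)%:R * (4 * 4^-1)).
rewrite -CE in aL bL.
(* The uniform control of the drift passes to the limit factors and makes them invertible. *)
have lim1 (M : 'M[R[i]]_n) (F : nat -> 'M[R[i]]_n) : (forall k, mnorm (F k - M) <= C * x k) ->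
    (forall k, mnorm (F k - 1%:M) <= (1 - x k) / 2) -> mnorm (M - 1%:M) <= 2^-1.
  move=> FM F1; rewrite -subr_le0; apply: (@le_half_pow _ _ C) => k.
  have := mnormB (F k - 1%:M) (F k - M).
  have -> : F k - 1%:M - (F k - M) = M - 1%:M by rewrite opprB addrC addrA subrK.
  by have := FM k; have := F1 k; have := x0 k; rewrite -/(x k); lra.
have a1 z : A t z -> mnorm (a z - 1%:M) <= 2^-1.
  move=> zA; apply: (lim1 _ (fun k => (Y k).1.2 z)) => k; first exact: aL.
  by have [_ [_ aM] _ _] := YI k; apply: aM; exact: subAt.
have b1 z : B t z -> mnorm (b z - 1%:M) <= 2^-1.
  move=> zB; apply: (lim1 _ (fun k => (Y k).2 z)) => k; first exact: bL.
  by have [_ _ [_ bM] _] := YI k; apply: bM; exact: subBt.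
exists a, b; split.
- by split => // z /a1/unitmx_near1.
- by split => // z /b1/unitmx_near1.
move=> z [zA zB]; apply/eqP; rewrite -subr_eq0; apply/eqP; apply: mnorm_eq0.
have N0 : 0 <= N by lra.
apply: (@le_half_pow _ _ (N * eta * N + C * N + N * C)) => k; rewrite -/(x k).
have zk : (A (sg k) `&` B (sg k)) z by split; [exact: subAt|exact: subBt].
have [[_ YM] [_ aM] [_ bM] XE] := YI k.
rewrite (XE z zk).
move: (YM z zk) (aM z zk.1) (bM z zk.2) (aL k z zA) (bL k z zB).
move: ((Y k).1.1 z) ((Y k).1.2 z) ((Y k).2 z) => Yz az bz YM' aM' bM' aL' bL'.
have aN := nearN _ _ (ltW (x0 k)) aM'; have bN := nearN _ _ (ltW (x0 k)) bM'.
have aN' : mnorm (a z) <= N.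
  by apply: (nearN _ 0) => //; have := a1 z zA; lra.
(* Each of the three terms is bounded by a constant times [x k]: the quotient tends to 1, the
   factors to their limits. *)
have -> : az *m Yz *m bz - a z *m b z =
    az *m (Yz - 1%:M) *m bz + (az - a z) *m bz + a z *m (bz - b z).
  by rewrite !(mulmxBr, mulmxBl) mulmx1 !addrA !subrK.
have x3 : x k ^+ 3 <= x k.
  rewrite exprS; apply: ler_piMr; first exact: ltW.
  by apply: exprn_ile1 (xle1 k); exact: ltW.
have {}YM' : mnorm (Yz - 1%:M) <= eta * x k.
  by apply: le_trans YM' _; rewrite ler_wpM2l// ltW.
have B1 := le_trans (mnormM _ _) (ler_pM (mnorm_ge0 _) (mnorm_ge0 _) aN YM').
have B2 := le_trans (mnormM _ _) (ler_pM (mnorm_ge0 _) (mnorm_ge0 _) B1 bN).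
have B3 := le_trans (mnormM _ _) (ler_pM (mnorm_ge0 _) (mnorm_ge0 _) aL' bN).
have B4 := le_trans (mnormM _ _) (ler_pM (mnorm_ge0 _) (mnorm_ge0 _) aN' bL').
apply: le_trans (mnormD _ _) _; apply: le_trans (lerD (mnormD _ _) (lexx _)) _.
apply: le_trans (lerD (lerD B2 B3) B4) _.
rewrite -/(x k) le_eqVlt; apply/orP; left; apply/eqP; ring.
Qed.

End Newton.

(** * Zeros of determinants and the factorization of general matrices *)

Section ColumnReplacement.
Context {F : comUnitRingType} {n : nat}.

Definition subst_col (A : 'M[F]_n) (j : 'I_n) (w : 'cV[F]_n) : 'M[F]_n :=
  \matrix_(i, k) if k == j then w i 0 else A i k.

(** The cofactors along column j do not see that column, so they are those of the identity, read off
    its adjugate. *)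
Lemma det_subst_col1 j w : \det (subst_col 1%:M j w) = w j 0.
Proof.
rewrite (expand_det_col _ j).
have cE i : cofactor (subst_col 1%:M j w) i j = (i == j)%:R.
  have -> : cofactor (subst_col 1%:M j w) i j = cofactor 1%:M i j.
    rewrite /cofactor; congr (_ * \det _); apply/matrixP => k l; rewrite !mxE.
    by rewrite eq_sym (negbTE (neq_lift _ _)).
  have : \adj (1%:M : 'M[F]_n) = 1%:M.
    by rewrite -[LHS]mul1mx mul_mx_adj det1.
  by move=> /matrixP/(_ j i); rewrite !mxE eq_sym.
rewrite (bigD1 j)//= cE eqxx mulr1 mxE eqxx big1 ?addr0// => i ij.
by rewrite cE (negbTE ij) mulr0.
Qed.

Lemma mulmx_subst_col (A : 'M[F]_n) j (w : 'cV[F]_n) :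
  A *m subst_col 1%:M j w = subst_col A j (A *m w).
Proof.
apply/matrixP => i k; rewrite !mxE; case: eqVneq => [->|kj].
  by apply: eq_bigr => l _; rewrite mxE eqxx.
rewrite (bigD1 k)//= !mxE (negbTE kj) eqxx mulr1 big1 ?addr0// => l lk.
by rewrite !mxE (negbTE kj) (negbTE lk) mulr0.
Qed.

End ColumnReplacement.

Section Cartan.
Context {R : realType}.
Implicit Types (n : nat) (s t : R) (U V : set R[i]).

Lemma chol_eq_punctured U (f g : R[i] -> R[i]) p : copen U -> U p -> chol U f -> chol U g ->
  (forall z, U z -> z != p -> f z = g z) -> f p = g p.
Proof.
move=> oU Up fU gU fg; apply/eqP; rewrite -subr_eq0 -cmod_eq0 eq_le cmod_ge0 andbT.
apply/ler_addgt0Pl => e e0; rewrite addr0.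
have [r r0 rU] := oU p Up.
have [r' r'0 r'P] := chol_ccont (cholB fU gU) Up e0.
pose d := Num.min (r / 2) (r' / 2).
have d0 : 0 < d by rewrite lt_min !divr_gt0.
have [dr dr'] : d <= r / 2 /\ d <= r' / 2 by rewrite !ge_min !lexx orbT.
have dE : cmod (p + d%:C - p) = d by rewrite addrC addKr cmod_real gtr0_norm.
have := r'P (p + d%:C); rewrite dE fg ?subrr ?sub0r ?cmodN; last 2 first.
- by apply: rU; rewrite dE; lra.
- by rewrite -subr_eq0 -cmod_eq0 dE gt_eqF.
by apply; lra.
Qed.

(** If M p has a kernel vector w with w_j = 1, replacing column j of M by
    M w / (z - p) removes the zero p of the determinant, at the price of a right
    factor that is invertible away from p. *)
Lemma factor_zeros n U V (M : R[i] -> 'M[R[i]]_n) (u : R[i] -> R[i]) (s : seq R[i]) :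
  copen U -> cholmx U M -> chol U u -> (forall z, U z -> u z != 0) ->
  (forall p, p \in s -> ~ (U `&` V) p) ->
  (forall z, U z -> \det (M z) = \prod_(p <- s) (z - p) * u z) ->
  exists M1 Q : R[i] -> 'M[R[i]]_n, [/\ cholGL U M1, cholGL V Q &
    forall z, U z -> M z = M1 z *m Q z].
Proof.
move=> oU; elim: s M u => [|p s IH] M u MU uU u0 sUV dM.
  exists M, (fun=> 1%:M); split; first 2 last.
  - by move=> z _; rewrite mulmx1.
  - by split => // z Uz; rewrite unitmxE unitfE dM// big_nil mul1r u0.
  - exact: cholGL_cst (unitmx1 _ _).
have sUV' q : q \in s -> ~ (U `&` V) q by move=> qs; apply: sUV; rewrite inE qs orbT.
have pUV : ~ (U `&` V) p by apply: sUV; rewrite inE eqxx.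
(* If p lies outside U, the factor z - p has no zero in U and is absorbed into the nonvanishing
   function u. *)
have [Up|nUp] := pselect (U p); last first.
  apply: (IH M (fun z => (z - p) * u z)) => //.
  - by apply: cholM => //; apply: cholB; [exact: chol_id|exact: chol_cst].
  - move=> z Uz; rewrite mulf_neq0 ?u0// subr_eq0; apply/eqP => zp.
    by apply: nUp; rewrite -zp.
  - by move=> z Uz; rewrite dM// big_cons [_ * \prod_(_ <- _) _]mulrC mulrA.
have nVp : ~ V p by move=> Vp; exact: pUV.
(* [det0P] yields row vectors in the left kernel; the transpose turns them into the column vector
   w. *)
have : \det (M p)^T == 0 by rewrite det_tr dM// big_cons subrr !mul0r.
move=> /det0P[v v0 vM].
have [j vj] : exists j, v 0 j != 0.
  apply/existsP; apply: contraNT v0 => /existsPn v0; apply/eqP/rowP => j.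
  by rewrite mxE; have := v0 j; rewrite negbK => /eqP.
pose w := (v 0 j)^-1 *: v^T.
have wj : w j 0 = 1 by rewrite !mxE mulVf.
have Mw : M p *m w = 0.
  by rewrite -scalemxAr -[M p]trmxK -trmx_mul vM trmx0 scaler0.
have MwU i : chol U (fun z => (M z *m w) i 0).
  exact: (cholmxM MU (@cholmx_cst R n 1 U w) i 0).
have H i : exists h, chol U h /\ forall z, U z -> (M z *m w) i 0 = (z - p) * h z.
  have [h hU hE] := divided_difference oU (MwU i) Up.
  by exists h; split => // z Uz; rewrite hE// Mw mxE add0r.
have [h hP] := choice H.
pose M' z := subst_col (M z) j (\col_i h i z).
(* As M w = (z - p) h and w_j = 1, column j of M is (z - p) h minus the other columns weighted by w:
   these are the entries of column j of Q. *)
pose e z : 'cV[R[i]]_n := \col_i if i == j then z - p else - w i 0.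
pose Q z := subst_col 1%:M j (e z).
have detQ z : \det (Q z) = z - p by rewrite det_subst_col1 mxE eqxx.
have ME z : U z -> M z = M' z *m Q z.
  move=> Uz; rewrite mulmx_subst_col; apply/matrixP => i k; rewrite mxE.
  case: eqVneq => [->|kj]; last by rewrite mxE (negbTE kj).
  have := (hP i).2 z Uz; rewrite !mxE (bigD1 j)//= wj mulr1 => E.
  rewrite (bigD1 j)//= !mxE eqxx mulrC -E -addrA [X in _ + X](_ : _ = 0) ?addr0//.
  rewrite -big_split big1//= => k' kj; rewrite !mxE (negbTE kj) mulrN.
  by rewrite subrr.
have M'U : cholmx U M'.
  move=> i k; have [->|kj] := eqVneq k j.
    apply: (chol_ext oU (g := h i)); last exact: (hP i).1.
    by move=> z _; rewrite !mxE eqxx.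
  by apply: (chol_ext oU _ (MU i k)) => z _; rewrite mxE (negbTE kj).
(* Cancelling det Q = z - p gives the formula off p; both sides are continuous at p. *)
have dM' z : U z -> \det (M' z) = \prod_(q <- s) (z - q) * u z.
  have fU : chol U (fun z => \prod_(q <- s) (z - q) * u z).
    apply: cholM => //; apply: chol_prod => q _.
    by apply: cholB; [exact: chol_id|exact: chol_cst].
  have H1 x : U x -> x != p -> \det (M' x) = \prod_(q <- s) (x - q) * u x.
    move=> Ux xp; have xp0 : x - p != 0 by rewrite subr_eq0.
    apply: (mulIf xp0); rewrite -detQ -det_mulmx -ME// dM// big_cons detQ.
    by rewrite -mulrA mulrC.
  move=> Uz; have [->|] := eqVneq z p; last exact: H1.
  exact: chol_eq_punctured oU Up (chol_det M'U) fU H1.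
have [M1 [Q1 [M1U Q1V M'E]]] := IH M' u M'U uU u0 sUV' dM'.
exists M1, (fun z => Q1 z *m Q z); split => //.
  apply: cholGLM => //; split.
    move=> i k; have -> : (fun z => Q z i k) = fun z =>
        if k == j then (if i == j then z - p else - w i 0) else (1%:M : 'M[R[i]]_n) i k.
      by apply/funext => z; rewrite mxE; case: ifP => // _; rewrite mxE.
    case: (k == j); [case: (i == j)|]; try exact: chol_cst.
    by apply: cholB; [exact: chol_id|exact: chol_cst].
  move=> z Vz; rewrite unitmxE unitfE detQ subr_eq0; apply/eqP => zp.
  by apply: nVp; rewrite -zp.
by move=> z Uz; rewrite ME// M'E// mulmxA.
Qed.

(** Roots outside U go into [qU]; every other root lies in U, hence outside V, and goes into
    [qV]. *)
Lemma poly_split_roots U V (q : {poly R[i]}) : q != 0 ->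
  (forall z, root q z -> ~ (U `&` V) z) ->
  exists qU qV : {poly R[i]}, [/\ q = qU * qV,
    forall z, U z -> qU.[z] != 0 & forall z, V z -> qV.[z] != 0].
Proof.
move=> q0 qUV; have [r rE] := closed_field_poly_normal q.
exists (lead_coef q *: \prod_(z <- r | `[< ~ U z >]) ('X - z%:P)),
  (\prod_(z <- r | ~~ `[< ~ U z >]) ('X - z%:P)); split.
- by rewrite {1}rE -scalerAl; congr (_ *: _); rewrite (bigID (fun z => `[< ~ U z >])).
- move=> z Uz; rewrite hornerZ mulf_neq0 ?lead_coef_eq0// horner_prod.
  rewrite prodf_seq_neq0; apply/allP => x xr; apply/implyP => /asboolP nUx.
  by rewrite hornerXsubC subr_eq0; apply/eqP => zx; apply: nUx; rewrite -zx.
- move=> z Vz; rewrite horner_prod prodf_seq_neq0; apply/allP => x xr.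
  apply/implyP => /asboolPn /contrapT Ux; rewrite hornerXsubC subr_eq0.
  apply/eqP => zx; apply: (qUV x); last by split => //; rewrite -zx.
  by rewrite rE rootZ ?lead_coef_eq0// root_prod_XsubC.
Qed.

(** Let G be a rational approximation of T and q a common denominator, so that R = q G is
    polynomial. Then T^-1 G is near 1 and factors as b' a' with b' on B and a' on A, whence T = q^-1
    R a'^-1 b'^-1. On A, [factor_zeros] writes R a'^-1 = M1 Q with M1 invertible on A and Q on B;
    splitting q as qA qB gives T = (qA^-1 M1)(qB^-1 Q b'^-1). *)
Theorem cartan n s0 (A B : R -> set R[i]) s t (T : R[i] -> 'M[R[i]]_n) :
  split_family s0 A B -> 0 <= s -> s < t -> t <= s0 -> cholGL (A s `&` B s) T ->
  exists a b, [/\ cholGL (A t) a, cholGL (B t) b &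
    forall z, (A t `&` B t) z -> T z = a z *m b z].
Proof.
move=> sf s_ge0 st ts0 TG.
(* A point of the overlap is used below to see that [\det RP] is not the zero polynomial; for an
   empty overlap constant factors do. *)
have [[z0 z0t]|C0] := pselect (exists z, (A t `&` B t) z); last first.
  exists (fun=> 1%:M), (fun=> 1%:M); split; try exact: cholGL_cst (unitmx1 _ _).
  by move=> z zt; exfalso; apply: C0; exists z.
(* Two shrinkings: from s to s1 for the boundedness of T^-1 and the rational approximation, from s1
   to t for Newton's iteration. *)
have [s1 [ss1 s1t]] : exists s1, s < s1 /\ s1 < t by exists ((s + t) / 2); split; lra.
have s1_ge0 : 0 <= s1 by lra.
have s1s0 : s1 <= s0 by lra.
have sub1 : A t `&` B t `<=` A s1 `&` B s1.
  by move=> z [zA zB]; split; [apply: sf_monoA sf _ _ _ _ zA|apply: sf_monoB sf _ _ _ _ zB]; exact: ltW.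
have sub0 : A s1 `&` B s1 `<=` A s `&` B s.
  by move=> z [zA zB]; split; [apply: sf_monoA sf _ _ _ _ zA|apply: sf_monoB sf _ _ _ _ zB]; exact: ltW.
have [MT [MT0 MTP]] : exists MT : R, 0 < MT /\ forall z, (A s1 `&` B s1) z ->
    mnorm (invmx (T z)) <= MT.
  have H (ij : ('I_n * 'I_n)%type) := sf_bounded sf s_ge0 ss1 s1s0 (cholmx_inv TG ij.1 ij.2).
  have [m mP] := choice H.
  exists (1 + \sum_ij `|m ij|); split; first by rewrite ltr_wpDr// sumr_ge0.
  move=> z zC; apply: le_trans (_ : \sum_ij cmod (invmx (T z) ij.1 ij.2) <= _).
    by rewrite /mnorm pair_bigA.
  apply: le_trans (_ : \sum_ij `|m ij| <= _); last by rewrite lerDr.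
  by apply: ler_sum => ij _; apply: le_trans (mP ij z zC) (ler_norm _).
have [eta eta0 etaP] := cartan_small n (split_family_sym sf) s1_ge0 s1t ts0.
have nn0 : 0 < (n * n)%:R + 1 :> R by rewrite ltr_wpDl.
(* The entrywise error for which T^-1 (G - T) has norm at most eta. *)
pose e := eta / (MT * ((n * n)%:R + 1)).
have e0 : 0 < e by rewrite divr_gt0// mulr_gt0.
have H (ij : ('I_n * 'I_n)%type) : exists pq : {poly R[i]} * {poly R[i]}, [/\ pq.2 != 0,
      (forall z, root pq.2 z -> ~ (A s1 `&` B s1) z) &
      forall z, (A s1 `&` B s1) z -> cmod (T z ij.1 ij.2 - pq.1.[z] / pq.2.[z]) <= e].
  have [p [q ?]] := sf_approx sf s_ge0 ss1 s1s0 (TG.1 ij.1 ij.2) e0.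
  by exists (p, q).
have [pq pqP] := choice H.
pose G z : 'M[R[i]]_n := \matrix_(i, j) ((pq (i, j)).1.[z] / (pq (i, j)).2.[z]).
pose q := \prod_ij (pq ij).2.
have q0 : q != 0 by apply/prodf_neq0 => ij _; have [] := pqP ij.
have qC z : (A s1 `&` B s1) z -> q.[z] != 0.
  move=> zC; rewrite horner_prod; apply/prodf_neq0 => ij _; have [_ qr _] := pqP ij.
  by apply/negP => /qr; exact.
(* The matrix q G with its denominators cleared, now defined on the whole plane. *)
pose RP : 'M[{poly R[i]}]_n := \matrix_(i, j)
  ((pq (i, j)).1 * \prod_(kl | kl != (i, j)) (pq kl).2).
pose Rz z := map_mx (horner_eval z) RP.
have RG z : (A s1 `&` B s1) z -> Rz z = q.[z] *: G z.
  move=> zC; apply/matrixP => i j; rewrite !mxE /horner_eval hornerM /q.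
  have [_ qr _] := pqP (i, j).
  have qij : (pq (i, j)).2.[z] != 0 by apply/negP => /qr; exact.
  rewrite [in RHS](bigD1 (i, j))//= hornerM; field.
  exact: qij.
have GT z : (A s1 `&` B s1) z -> mnorm (invmx (T z) *m G z - 1%:M) <= eta.
  move=> zC; rewrite -(mulVmx (TG.2 z (sub0 z zC))) -mulmxBr.
  have h1 : mnorm (G z - T z) <= (n * n)%:R * e.
    apply: mnorm_le => i j; rewrite !mxE cmod_distC.
    by have [_ _] := pqP (i, j); exact.
  have B1 := le_trans (mnormM _ _) (ler_pM (mnorm_ge0 _) (mnorm_ge0 _) (MTP z zC) h1).
  apply: le_trans B1 _; have -> : eta = MT * (((n * n)%:R + 1) * e).
    by rewrite /e; field; rewrite !gt_eqF.
  by rewrite ler_wpM2l ?(ltW MT0)// ler_wpM2r ?(ltW e0)// lerDl.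
have TC : cholGL (A s1 `&` B s1) T := cholGL_subset sub0 TG.
have oC : copen (A s1 `&` B s1).
  by apply: copenI; [exact: (@sf_openA _ _ _ _ sf _)|exact: (@sf_openB _ _ _ _ sf _)].
have RC : cholmx setT Rz.
  by move=> i j; under [X in chol _ X]eq_fun do rewrite mxE; exact: chol_horner.
have qinv : chol (A s1 `&` B s1) (fun z => q.[z]^-1).
  by apply: cholV => //; exact: chol_horner.
have GC : cholmx (A s1 `&` B s1) G.
  apply: (cholmx_ext (N := fun z => q.[z]^-1 *: Rz z)) => //.
    by move=> z zC; rewrite RG// scalerA mulVf ?qC// scale1r.
  by apply: cholmxZ => //; exact: cholmx_subset RC.
have [||b' [a' [bB aA XE]]] := etaP (fun z => invmx (T z) *m G z).
- by rewrite setIC; apply: cholmxM => //; exact: cholmx_inv.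
- by move=> z; rewrite setIC; exact: GT.
have GE z : (A t `&` B t) z -> G z = T z *m (b' z *m a' z).
  move=> zC; rewrite -XE; last by rewrite setIC.
  by rewrite mulmxA mulmxV ?mul1mx// (TC.2 z (sub1 z zC)).
have Ru z : (A t `&` B t) z -> Rz z \in unitmx.
  move=> zC; rewrite RG ?GE; [|exact: zC|exact: sub1].
  rewrite unitmxZ ?unitfE ?qC//; last exact: sub1.
  rewrite !unitmx_mul (TC.2 z (sub1 z zC)) (bB.2 z zC.2) (aA.2 z zC.1) //.
have detR z : \det (Rz z) = (\det RP).[z] by rewrite det_map_mx.
have dR0 : \det RP != 0.
  apply/eqP => d0; have := Ru z0 z0t; rewrite unitmxE detR d0 horner0.
  by rewrite unitr0.
have [r rE] := closed_field_poly_normal (\det RP).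
(* The determinant vanishes in [A t] only at roots of [\det RP], and none of these is in the
   overlap, where R is invertible. *)
have [||||||M1 [Q [M1A QB ME]]] := @factor_zeros n (A t) (B t) (fun z => Rz z *m invmx (a' z))
    (fun z => lead_coef (\det RP) * \det (invmx (a' z))) r.
- exact: (@sf_openA _ _ _ _ sf _).
- by apply: cholmxM; [exact: cholmx_subset RC|exact: cholmx_inv].
- by apply: cholM; [exact: chol_cst|apply: chol_det; exact: cholmx_inv].
- move=> z zA; rewrite mulf_neq0 ?lead_coef_eq0//.
  by have := aA.2 z zA; rewrite -unitmx_inv unitmxE unitfE.
- move=> p pr pC; have := Ru p pC; rewrite unitmxE detR unitfE => /negP; apply.
  by rewrite -/(root _ p) rE rootZ ?lead_coef_eq0// root_prod_XsubC.
- move=> z zA; rewrite det_mulmx detR {1}rE hornerZ horner_prod mulrA; congr (_ * _).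
  rewrite mulrC; congr (_ * _); apply: eq_bigr => p _; exact: hornerXsubC.
have [|qA [qB [qE qA0 qB0]]] := @poly_split_roots (A t) (B t) q q0.
  by move=> z zr /sub1/qC; rewrite -/(root q z) zr.
exists (fun z => qA.[z]^-1 *: M1 z), (fun z => qB.[z]^-1 *: (Q z *m invmx (b' z))); split.
- apply: cholGLZ => //; first by apply: cholV => //; exact: chol_horner.
  by move=> z zA; rewrite invr_eq0 qA0.
- apply: cholGLZ => //; first by apply: cholV => //; exact: chol_horner.
    by move=> z zB; rewrite invr_eq0 qB0.
  by apply: cholGLM => //; exact: cholGL_inv.
move=> z zC; have [zA zB] := zC.
have au := aA.2 z zA; have bu := bB.2 z zB.
rewrite -scalemxAl -scalemxAr scalerA -invfM -hornerM -qE mulmxA -ME// RG; last exact: sub1.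
rewrite -!scalemxAl scalerA (mulVf (qC z (sub1 z zC))) scale1r.
by rewrite GE// !mulmxA -[_ *m a' z *m _]mulmxA mulmxV// mulmx1 -mulmxA mulmxV// mulmx1.
Qed.

End Cartan.

(** * Contour integrals and their Riemann sums *)

Section Contours.
Context {R : realType}.
Implicit Types (p q z w : R[i]) (g : R[i] -> R[i]) (s t e r : R).

Lemma sint_cst p q c : sint p q (fun=> c) = (q - p) * c.
Proof.
rewrite (@sint_FTC R p q (fun=> c) (fun x => x * c)); first by ring.
move=> t _; apply: cderiv_eq (cderivM (cderiv_id _) (cderiv_cst c _)) _.
by rewrite mulr0 addr0 mul1r.
Qed.

(** A single sum must serve all z at distance at least r. The error allowed on a piece is
    proportional to its length [t - s], so the sums of adjacent pieces concatenate and bisection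
    applies. *)
Lemma seg_riemann p q g r e : 0 < r -> 0 < e -> scont p q g ->
  exists l : seq (R[i] * R[i]), (forall x, x \in l -> exists2 t, 0 <= t <= 1 & x.2 = seg p q t) /\
  forall z, seg_far p q z r ->
    cmod (sint p q (fun x => g x / (x - z)) - \sum_(x <- l) x.1 / (x.2 - z)) <= e.
Proof.
move=> r0 e0 gc.
pose P s t := 0 <= s -> t <= 1 -> exists l : seq (R[i] * R[i]),
  (forall x, x \in l -> exists2 t, 0 <= t <= 1 & x.2 = seg p q t) /\
  forall z, seg_far p q z r -> cmod (sint (seg p q s) (seg p q t) (fun x => g x / (x - z)) -
    \sum_(x <- l) x.1 / (x.2 - z)) <= e * (t - s).
have ic z : seg_far p q z r -> scont p q (fun x => g x / (x - z)).
  by move=> zf; exact: scont_cauchy r0 zf gc.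
suff P01 : P 0 1.
  have [l [l1 l2]] := P01 (lexx _) (lexx _).
  by exists l; split => // z /l2; rewrite seg0 seg1 subr0 mulr1.
apply: (@bisection R P).
  move=> s m t /andP[sm mt] P1 P2 s0 t1.
  have [|l1 [l1P l1e]] := P1 s0; first by lra.
  have [|//|l2 [l2P l2e]] := P2; first by lra.
  exists (l1 ++ l2); split.
    by move=> x; rewrite mem_cat => /orP[/l1P|/l2P].
  move=> z zf; rewrite big_cat /= (sint_split s0 (ltW sm) (ltW mt) t1 (ic z zf)).
  rewrite opprD addrACA; apply: le_trans (cmodD _ _) _.
  by have := l1e z zf; have := l2e z zf; lra.
move=> p0 p01.
pose z0 := seg p q p0.
set D := cmod (q - p) + 1.
have D1 : 1 <= D by have := cmod_ge0 (q - p); rewrite /D; lra.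
have D0 : 0 < D by lra.
set G := cmod (g z0) + 1.
have G0 : 0 < G by have := cmod_ge0 (g z0); rewrite /G; lra.
have [|r1 r10 r1P] := gc p0 p01 (e * r / (2 * D)); first by rewrite divr_gt0 ?mulr_gt0.
(* The first bound controls the variation of g on a piece, the second that of the kernel 1 / (x -
   z); each contributes [e / (2 * D)]. *)
have [r' [r'0 r'1 r'2]] : exists r' : R, [/\ 0 < r', r' * D <= r1 & r' * (2 * D ^+ 2 * G) <= e * r ^+ 2].
  exists (Num.min (r1 / D) (e * r ^+ 2 / (2 * D ^+ 2 * G))).
  have h : 0 < 2 * D ^+ 2 * G by rewrite !mulr_gt0 ?exprn_gt0.
  split; first by rewrite lt_min !divr_gt0 ?mulr_gt0 ?exprn_gt0.
  - by rewrite -ler_pdivlMr// ge_min lexx.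
  - by rewrite -ler_pdivlMr// ge_min lexx orbT.
exists r' => // s t s0 t1 st str /andP[sp0 p0t] _ _.
exists [:: ((seg p q t - seg p q s) * g z0, z0)]; split.
  by move=> x; rewrite inE => /eqP -> /=; exists p0.
move=> z zf; rewrite big_seq1 /=.
have z0z : z0 != z := seg_far_neq r0 zf p01.
have stc : scont (seg p q s) (seg p q t) (fun x => g x / (x - z)).
  by apply: scont_sub => //; [exact: ltW|exact: ic].
have cc : scont (seg p q s) (seg p q t) (fun=> - (g z0 / (z0 - z))) by move=> *; exact: ccont_cst.
have -> : sint (seg p q s) (seg p q t) (fun x => g x / (x - z)) -
    (seg p q t - seg p q s) * g z0 / (z0 - z) =
  sint (seg p q s) (seg p q t) (fun x => g x / (x - z) + - (g z0 / (z0 - z))).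
  by rewrite sintD// sint_cst; ring.
have tsD : cmod (seg p q t - seg p q s) <= (t - s) * D.
  rewrite segB cmodM cmod_real ger0_norm; last by lra.
  by apply: ler_wpM2l; [lra|rewrite lerDl].
have bnd x : 0 <= x <= 1 -> cmod (g (seg (seg p q s) (seg p q t) x) / (seg (seg p q s) (seg p q t) x - z)
    + - (g z0 / (z0 - z))) <= e / D.
  move=> /andP[x0 x1]; rewrite seg_sub; set y := s + x * (t - s).
  have xts : 0 <= x * (t - s) <= t - s.
    by rewrite mulr_ge0 ?ler_piMl//; lra.
  have y01 : 0 <= y <= 1 by rewrite /y; lra.
  have yz : seg p q y != z := seg_far_neq r0 zf y01.
  have yp : cmod (seg p q y - z0) <= (t - s) * D.
    rewrite segB cmodM cmod_real; apply: ler_pM => //; rewrite ?cmod_ge0// ?lerDl//.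
    by rewrite ler_norml /y; lra.
  have yr1 : cmod (seg p q y - z0) < r1.
    by apply: le_lt_trans yp _; apply: lt_le_trans r'1; rewrite ltr_pM2r.
  have -> : g (seg p q y) / (seg p q y - z) + - (g z0 / (z0 - z)) =
      (g (seg p q y) - g z0) / (seg p q y - z) - g z0 * ((seg p q y - z0) / ((seg p q y - z) * (z0 - z))).
    by field; rewrite !subr_eq0 yz z0z.
  have fy := zf y y01; have fz0 := zf p0 p01.
  have vle x' : r <= cmod x' -> (cmod x')^-1 <= r^-1.
    by move=> rx; rewrite lef_pV2 ?posrE//; lra.
  apply: le_trans (cmodB _ _) _; rewrite (_ : e / D = e / (2 * D) + e / (2 * D)); last first.
    by field; rewrite gt_eqF.
  apply: lerD.
    rewrite cmodM cmodV; apply: le_trans (ler_pM _ _ (r1P _ yr1) (vle _ fy)) _.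
    + exact: cmod_ge0.
    + by rewrite invr_ge0 cmod_ge0.
    + by rewrite le_eqVlt; apply/orP; left; apply/eqP; field; rewrite !gt_eqF.
  rewrite !cmodM !cmodV !cmodM invfM.
  have h1 : (cmod (seg p q y - z))^-1 * (cmod (z0 - z))^-1 <= r^-1 * r^-1.
    by apply: ler_pM; rewrite ?invr_ge0 ?cmod_ge0// vle.
  have h2 : cmod (seg p q y - z0) <= r' * D.
    by apply: le_trans yp _; rewrite ler_wpM2r// ltW.
  have h3 := ler_pM (cmod_ge0 (seg p q y - z0))
     (mulr_ge0 (_ : 0 <= (cmod (seg p q y - z))^-1) (_ : 0 <= (cmod (z0 - z))^-1)) h2 h1.
  have {}h3 := h3 ltac:(by rewrite invr_ge0 cmod_ge0) ltac:(by rewrite invr_ge0 cmod_ge0).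
  have GG : cmod (g z0) <= G by rewrite lerDl.
  apply: le_trans (ler_pM (cmod_ge0 _) _ GG h3) _.
    by rewrite !mulr_ge0 ?invr_ge0 ?cmod_ge0.
  rewrite -(ler_pM2r (_ : 0 < 2 * D * r ^+ 2)); last by rewrite !mulr_gt0 ?exprn_gt0.
  have -> : e / (2 * D) * (2 * D * r ^+ 2) = e * r ^+ 2 by field; rewrite gt_eqF.
  have -> : G * (r' * D * (r^-1 * r^-1)) * (2 * D * r ^+ 2) = r' * (2 * D ^+ 2 * G).
    by field; rewrite gt_eqF.
  exact: r'2.
apply: le_trans (sint_le (scontD stc cc) bnd) _.
apply: le_trans (ler_wpM2r _ tsD) _; first by rewrite divr_ge0// ltW.
by rewrite le_eqVlt; apply/orP; left; apply/eqP; field; rewrite gt_eqF.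
Qed.

Lemma partial_fractions (l : seq (R[i] * R[i])) : exists p q : {poly R[i]},
  [/\ q != 0, forall z, root q z -> exists2 x, x \in l & x.2 = z &
  forall z, (forall x, x \in l -> x.2 != z) ->
    \sum_(x <- l) x.1 / (x.2 - z) = p.[z] / q.[z]].
Proof.
elim: l => [|x l [p [q [q0 qr qE]]]].
  exists 0, 1; split; first by rewrite oner_eq0.
  - by move=> z; rewrite /root hornerC oner_eq0.
  - by move=> z _; rewrite big_nil horner0 mul0r.
exists (x.1 *: q + p * (x.2%:P - 'X)), ((x.2%:P - 'X) * q); split.
- by rewrite mulf_neq0// -oppr_eq0 opprB polyXsubC_eq0.
- move=> z; rewrite rootM => /orP[|/qr[y yl yz]]; last by exists y; rewrite ?inE ?yl ?orbT.
  rewrite /root !hornerE subr_eq0 => /eqP xz; exists x; rewrite ?inE ?eqxx//.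
move=> z zl; have xz : x.2 != z by apply: zl; rewrite inE eqxx.
have lz y : y \in l -> y.2 != z by move=> yl; apply: zl; rewrite inE yl orbT.
have qz : q.[z] != 0.
  by apply/negP => /qr[y yl yz]; have := lz y yl; rewrite yz eqxx.
rewrite big_cons qE// !hornerE; field.
by rewrite qz subr_eq0 xz.
Qed.

(** The element (c, (p, q)) stands for c times the segment from p to q. *)
Definition contour := seq (R[i] * (R[i] * R[i])).
Implicit Types G : contour.

Definition on_contour G : set R[i] :=
  [set z | exists2 c, c \in G & exists2 t, 0 <= t <= 1 & z = seg c.2.1 c.2.2 t].

Definition contour_far G z r := forall c, c \in G -> seg_far c.2.1 c.2.2 z r.

Definition contour_int G g z : R[i] :=
  \sum_(c <- G) c.1 * sint c.2.1 c.2.2 (fun x => g x / (x - z)).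

Definition contour_len G : R := \sum_(c <- G) cmod c.1 * cmod (c.2.2 - c.2.1).

Lemma on_contour_scont G g c : (forall z, on_contour G z -> ccont g z) -> c \in G ->
  scont c.2.1 c.2.2 g.
Proof. by move=> gc cG t t01; apply: gc; exists c => //; exists t. Qed.

Lemma chol_contour_int G g U r : 0 < r -> (forall z, U z -> contour_far G z r) ->
  (forall z, on_contour G z -> ccont g z) -> chol U (contour_int G g).
Proof.
move=> r0 Ur gc; have {}gc c : c \in G -> scont c.2.1 c.2.2 g by exact: on_contour_scont.
rewrite /contour_int; elim: G Ur gc => [|c G IH] Ur gc.
  by under [X in chol _ X]eq_fun do rewrite big_nil; exact: chol_cst.
under [X in chol _ X]eq_fun do rewrite big_cons.
apply: cholD; last first.
  apply: IH => [z Uz d dG|d dG]; last by apply: gc; rewrite inE dG orbT.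
  by apply: Ur => //; rewrite inE dG orbT.
apply: cholM; first exact: chol_cst.
move=> z Uz; eexists; apply: cauchy_seg_deriv r0 _ _.
  by apply: Ur => //; rewrite inE eqxx.
by apply: gc; rewrite inE eqxx.
Qed.

Lemma contour_int_le G g z r M : 0 < r -> contour_far G z r ->
  (forall z, on_contour G z -> ccont g z) -> (forall z, on_contour G z -> cmod (g z) <= M) ->
  cmod (contour_int G g z) <= contour_len G * (M / r).
Proof.
move=> r0 far gc gM; rewrite /contour_int /contour_len mulr_suml.
have H c : c \in G -> cmod (c.1 * sint c.2.1 c.2.2 (fun x => g x / (x - z))) <=
    cmod c.1 * cmod (c.2.2 - c.2.1) * (M / r).
  move=> cG; rewrite cmodM -mulrA ler_wpM2l ?cmod_ge0//; apply: sint_le.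
    by apply: scont_cauchy r0 (far c cG) _; exact: on_contour_scont gc cG.
  move=> t t01; rewrite cmodM cmodV; apply: ler_pM; rewrite ?invr_ge0 ?cmod_ge0//.
    by apply: gM; exists c => //; exists t.
  have := far c cG t t01 => rle; rewrite lef_pV2 ?posrE//; exact: lt_le_trans rle.
elim: G H {far gc gM} => [|c G IH] H; first by rewrite !big_nil cmod0.
rewrite !big_cons; apply: le_trans (cmodD _ _) _; apply: lerD.
  by apply: H; rewrite inE eqxx.
by apply: IH => d dG; apply: H; rewrite inE dG orbT.
Qed.

Lemma contour_int_approx G g r e : 0 < r -> 0 < e ->
  (forall z, on_contour G z -> ccont g z) ->
  exists l : seq (R[i] * R[i]), (forall x, x \in l -> on_contour G x.2) /\
  forall z, contour_far G z r ->
    cmod (contour_int G g z - \sum_(x <- l) x.1 / (x.2 - z)) <= e.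
Proof.
move=> r0; elim: G e => [|c G IH] e e0 gc.
  exists [::]; split => // z _; rewrite /contour_int !big_nil subrr cmod0; exact: ltW.
have e20 : 0 < e / 2 by lra.
have [|l1 [l1P l1e]] := IH _ e20.
  by move=> z [d dG zd]; apply: gc; exists d; rewrite ?inE ?dG ?orbT.
have c0 : 0 < cmod c.1 + 1 by have := cmod_ge0 c.1; lra.
have sc : scont c.2.1 c.2.2 g by apply: on_contour_scont gc _; rewrite inE eqxx.
have [|l2 [l2P l2e]] := @seg_riemann c.2.1 c.2.2 g r (e / 2 / (cmod c.1 + 1)) r0 _ sc.
  by rewrite divr_gt0.
exists ([seq (c.1 * x.1, x.2) | x <- l2] ++ l1); split.
  move=> x; rewrite mem_cat => /orP[/mapP[y /l2P[t t01 yt] ->]|/l1P[d dG xd]].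
    by exists c; rewrite ?inE ?eqxx//; exists t.
  by exists d; rewrite ?inE ?dG ?orbT.
move=> z far; rewrite /contour_int big_cons big_cat big_map /=.
have -> : \sum_(j <- l2) c.1 * j.1 / (j.2 - z) = c.1 * \sum_(j <- l2) j.1 / (j.2 - z).
  by rewrite mulr_sumr; apply: eq_bigr => j _; rewrite mulrA.
rewrite opprD addrACA -mulrBr; apply: le_trans (cmodD _ _) _.
rewrite [leRHS](_ : e = e / 2 + e / 2); last by lra.
apply: lerD; last first.
  by apply: l1e => d dG; apply: far; rewrite inE dG orbT.
have h := l2e z (far c ltac:(by rewrite inE eqxx)).
rewrite cmodM; apply: le_trans (ler_wpM2l (cmod_ge0 _) h) _.
rewrite mulrA ler_pdivrMr// mulrC ler_wpM2l ?lerDl//; lra.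
Qed.

Lemma contour_bounded G g : (forall z, on_contour G z -> ccont g z) ->
  exists2 M, 0 < M & forall z, on_contour G z -> cmod (g z) <= M.
Proof.
elim: G => [|c G IH] gc; first by exists 1 => // z [].
have [|M M0 MP] := IH.
  by move=> z [d dG zd]; apply: gc; exists d; rewrite ?inE ?dG ?orbT.
have [|N N0 NP] := @seg_bounded _ c.2.1 c.2.2 g.
  by apply: on_contour_scont gc _; rewrite inE eqxx.
exists (M + N); first by rewrite addr_gt0.
move=> z [d]; rewrite inE => /orP[/eqP -> [t t01 ->]|dG zd].
  by have := NP t t01; lra.
by have := MP z (ex_intro2 _ _ d dG zd); lra.
Qed.

End Contours.

(** * Overlaps of rectangles and square annuli *)

Section SplitFamilies.
Context {R : realType}.
Implicit Types (z w : R[i]) (g : R[i] -> R[i]) (s t m : R) (A B : R -> set R[i]).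

(** Cauchy's formula along the contours G1 m and G2 m provides the additive
    splitting, and its Riemann sums the rational approximations. *)
Lemma contour_split_family (s0 L : R) A B (G1 G2 : R -> contour) (W : R[i]) : 0 < L -> W != 0 ->
  (forall s, copen (A s)) -> (forall s, copen (B s)) ->
  (forall s t, s <= t -> A t `<=` A s) -> (forall s t, s <= t -> B t `<=` B s) ->
  (forall m, 0 <= m -> m < s0 -> contour_len (G1 m) <= L) ->
  (forall m, 0 <= m -> m < s0 -> contour_len (G2 m) <= L) ->
  (forall m t, 0 <= m -> m < t -> t <= s0 -> forall z, A t z -> contour_far (G1 m) z (t - m)) ->
  (forall m t, 0 <= m -> m < t -> t <= s0 -> forall z, B t z -> contour_far (G2 m) z (t - m)) ->
  (forall s m, 0 <= s -> s < m -> m < s0 -> on_contour (G1 m) `<=` A s `&` B s) ->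
  (forall s m, 0 <= s -> s < m -> m < s0 -> on_contour (G2 m) `<=` A s `&` B s) ->
  (forall s m t g, 0 <= s -> s < m -> m < t -> t <= s0 -> chol (A s `&` B s) g ->
    forall z, (A t `&` B t) z -> W * g z = contour_int (G1 m) g z + contour_int (G2 m) g z) ->
  split_family s0 A B.
Proof.
move=> L0 W0 oA oB mA mB len1 len2 far1 far2 on1 on2 cau.
have cW : 0 < cmod W by rewrite cmod_gt0.
have mid s t : s < t -> exists m : R, [/\ s < m, m < t & t - m = (t - s) / 2].
  by move=> st; exists ((s + t) / 2); split; lra.
have gcont s m g : 0 <= s -> s < m -> m < s0 -> chol (A s `&` B s) g ->
    (forall z, on_contour (G1 m) z -> ccont g z) /\ (forall z, on_contour (G2 m) z -> ccont g z).
  move=> s_ge0 sm ms0 gc; split=> z zG; apply: chol_ccont gc _.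
    exact: on1 zG. exact: on2 zG.
split => //.
(* The contours are taken at the midpoint m of s and t, at distance [(t - s) / 2] from the target
   domains: hence the factor 2. *)
- exists (2 * L / cmod W); first by rewrite !divr_gt0 ?mulr_gt0.
  move=> s t s_ge0 st ts0 g M M0 gc gM.
  have [m [sm mt tm]] := mid s t st.
  have m_ge0 : 0 <= m by lra.
  have ms0 : m < s0 by lra.
  have [gc1 gc2] := gcont s m g s_ge0 sm ms0 gc.
  have tm0 : 0 < t - m by lra.
  have ts : 0 < t - s by lra.
  have bnd (G : @contour R) z : contour_len G <= L -> contour_far G z (t - m) ->
      (forall z, on_contour G z -> ccont g z) -> on_contour G `<=` A s `&` B s ->
      cmod (W^-1 * contour_int G g z) <= 2 * L / cmod W * M / (t - s).
    move=> lenG farG gcG onG; rewrite cmodM cmodV.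
    have h := contour_int_le tm0 farG gcG (fun z zG => gM z (onG z zG)).
    have h2 : contour_len G * (M / (t - m)) <= L * (M / (t - m)).
      by rewrite ler_wpM2r// divr_ge0// ltW.
    have -> : 2 * L / cmod W * M / (t - s) = (cmod W)^-1 * (L * (M / (t - m))).
      by rewrite tm; field; rewrite !gt_eqF.
    by apply: ler_wpM2l; [rewrite invr_ge0 ltW|exact: le_trans h2].
  exists (fun z => W^-1 * contour_int (G1 m) g z), (fun z => W^-1 * contour_int (G2 m) g z).
  split.
  + apply: cholM; first exact: chol_cst.
    by apply: chol_contour_int tm0 _ gc1; exact: far1.
  + apply: cholM; first exact: chol_cst.
    by apply: chol_contour_int tm0 _ gc2; exact: far2.
  + by move=> z zA; apply: bnd => //; [exact: len1|exact: far1|exact: on1].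
  + by move=> z zB; apply: bnd => //; [exact: len2|exact: far2|exact: on2].
  + by move=> z zAB; rewrite -mulrDr -(cau s m t g) // mulrA mulVf// mul1r.
- move=> s t g s_ge0 st ts0 gc.
  have [m [sm mt tm]] := mid s t st.
  have m_ge0 : 0 <= m by lra.
  have ms0 : m < s0 by lra.
  have [gc1 gc2] := gcont s m g s_ge0 sm ms0 gc.
  have tm0 : 0 < t - m by lra.
  have [M1 M10 M1P] := contour_bounded gc1; have [M2 M20 M2P] := contour_bounded gc2.
  exists ((cmod W)^-1 * (contour_len (G1 m) * (M1 / (t - m)) + contour_len (G2 m) * (M2 / (t - m)))).
  move=> z zAB; have [zA zB] := zAB.
  have -> : g z = W^-1 * (contour_int (G1 m) g z + contour_int (G2 m) g z).
    by rewrite -(cau s m t g) // mulrA mulVf// mul1r.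
  rewrite cmodM cmodV; apply: ler_wpM2l; first by rewrite invr_ge0 ltW.
  apply: le_trans (cmodD _ _) _; apply: lerD.
    exact: contour_int_le tm0 (far1 m t m_ge0 mt ts0 z zA) gc1 M1P.
  exact: contour_int_le tm0 (far2 m t m_ge0 mt ts0 z zB) gc2 M2P.
- move=> s t g e s_ge0 st ts0 gc e0.
  have [m [sm mt tm]] := mid s t st.
  have m_ge0 : 0 <= m by lra.
  have ms0 : m < s0 by lra.
  have [gc1 gc2] := gcont s m g s_ge0 sm ms0 gc.
  have tm0 : 0 < t - m by lra.
  pose e' := e * cmod W / 2.
  have e'0 : 0 < e' by rewrite divr_gt0 ?mulr_gt0.
  have [l1 [l1P l1e]] := contour_int_approx tm0 e'0 gc1.
  have [l2 [l2P l2e]] := contour_int_approx tm0 e'0 gc2.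
  have far_neq (G : @contour R) z x : contour_far G z (t - m) -> on_contour G x -> x != z.
    move=> farG [c cG [u u01 ->]]; exact: seg_far_neq tm0 (farG c cG) u01.
  have [p [q [q0 qr qE]]] := partial_fractions (l1 ++ l2).
  have lz z : (A t `&` B t) z -> forall x, x \in l1 ++ l2 -> x.2 != z.
    move=> [zA zB] x; rewrite mem_cat => /orP[/l1P|/l2P]; apply: far_neq.
      exact: far1 zA. exact: far2 zB.
  exists (W^-1 *: p), q; split => //.
    by move=> z /qr[x xl <-] /lz/(_ x xl); rewrite eqxx.
  move=> z zAB; have [zA zB] := zAB.
  rewrite hornerZ -mulrA -qE; last exact: lz.
  have -> : g z = W^-1 * (contour_int (G1 m) g z + contour_int (G2 m) g z).
    by rewrite -(cau s m t g) // mulrA mulVf// mul1r.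
  rewrite -mulrBr cmodM cmodV big_cat /= mulrC ler_pdivrMr// opprD addrACA.
  apply: le_trans (cmodD _ _) _.
  have -> : e * cmod W = e' + e' by rewrite /e'; lra.
  by apply: lerD; [apply: l1e; exact: far1|apply: l2e; exact: far2].
Qed.

(** All sides but the left one: their Cauchy integral is holomorphic on the half strip unbounded to
    the left, that of the left side on the half strip unbounded to the right. *)
Definition rect_contour3 (x1 x2 y1 y2 : R) : contour :=
  [:: (1, (x1 +i* y1, x2 +i* y1)); (1, (x2 +i* y1, x2 +i* y2)); (-1, (x1 +i* y2, x2 +i* y2))].

Definition rect_contour1 (x1 y1 y2 : R) : contour := [:: (-1, (x1 +i* y1, x1 +i* y2))].

Lemma cauchy_int_contour x1 x2 y1 y2 g z : cauchy_int x1 x2 y1 y2 g z =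
  contour_int (rect_contour3 x1 x2 y1 y2) g z + contour_int (rect_contour1 x1 y1 y2) g z.
Proof. by rewrite /contour_int /cauchy_int /rint !big_cons !big_nil /=; ring. Qed.

Lemma contour_len3 x1 x2 y1 y2 : x1 <= x2 -> y1 <= y2 ->
  contour_len (rect_contour3 x1 x2 y1 y2) = 2 * (x2 - x1) + (y2 - y1).
Proof.
move=> x12 y12; rewrite /contour_len !big_cons big_nil; cbn [fst snd]; rewrite ?cmodN !cmod1.
by rewrite !cmod_horiz// cmod_vert//; lra.
Qed.

Lemma contour_len1 x1 y1 y2 : y1 <= y2 -> contour_len (rect_contour1 x1 y1 y2) = y2 - y1.
Proof.
by move=> y12; rewrite /contour_len !big_cons big_nil; cbn [fst snd]; rewrite ?cmodN !cmod1 cmod_vert//; lra.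
Qed.

Lemma on_contour3 x1 x2 y1 y2 z : x1 <= x2 -> y1 <= y2 ->
  on_contour (rect_contour3 x1 x2 y1 y2) z -> rbdry x1 x2 y1 y2 z.
Proof.
move=> x12 y12 [c]; rewrite !inE => /or3P[] /eqP -> [t t01 ->] /=.
- exact: rbdry_bottom.
- exact: rbdry_right.
- exact: rbdry_top.
Qed.

Lemma on_contour1 x1 x2 y1 y2 z : x1 <= x2 -> y1 <= y2 ->
  on_contour (rect_contour1 x1 y1 y2) z -> rbdry x1 x2 y1 y2 z.
Proof.
move=> x12 y12 [c]; rewrite !inE => /eqP -> [t t01 ->] /=.
exact: rbdry_left.
Qed.

Lemma contour_far3 x1 x2 y1 y2 z (r : R) : r <= x2 - Re z -> r <= Im z - y1 -> r <= y2 - Im z ->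
  contour_far (rect_contour3 x1 x2 y1 y2) z r.
Proof.
move=> r1 r2 r3 c; rewrite !inE => /or3P[] /eqP -> t _ /=.
- exact: le_trans r2 (orect_far_bottom _ _ _ _ _).
- exact: le_trans r1 (orect_far_right _ _ _ _ _).
- exact: le_trans r3 (orect_far_top _ _ _ _ _).
Qed.

Lemma contour_far1 x1 y1 y2 z (r : R) : r <= Re z - x1 ->
  contour_far (rect_contour1 x1 y1 y2) z r.
Proof.
move=> r1 c; rewrite !inE => /eqP -> t _ /=.
exact: le_trans r1 (orect_far_left _ _ _ _ _).
Qed.

Lemma winding_shrink (x1 x2 y1 y2 a1 a2 b1 b2 : R) z :
  x1 <= a1 -> a2 <= x2 -> y1 <= b1 -> b2 <= y2 -> orect a1 a2 b1 b2 z ->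
  winding x1 x2 y1 y2 z = winding a1 a2 b1 b2 z.
Proof.
move=> xa ax yb bx zR; have [/andP[? ?] /andP[? ?]] := zR.
apply: rint_shrink => //; try lra.
move=> w _ wn; have wz : w != z by apply/eqP => E; apply: wn; rewrite E.
exists (0 * (w - z)^-1 + 1 * (- 1 / (w - z) ^+ 2)).
by apply: cderivM; [exact: cderiv_cst|exact: cderiv_inv_subr].
Qed.

(** The half strips overlap in a rectangle, and the two pieces of its boundary split Cauchy's
    formula. They are unbounded so that the factors extend over the adjacent rectangles of any
    length. *)
Lemma strip_split_family (x1 x2 y1 y2 s0 : R) : 0 < s0 ->
  x1 + s0 < x2 - s0 -> y1 + s0 < y2 - s0 ->
  split_family s0 (fun s => [set z | Re z < x2 - s /\ y1 + s < Im z < y2 - s])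
    (fun s => [set z | x1 + s < Re z /\ y1 + s < Im z < y2 - s]).
Proof.
move=> s00 x12 y12.
set A := (fun s => [set z | Re z < x2 - s /\ _]).
set B := (fun s => [set z | x1 + s < Re z /\ _]).
have ABE s z : (A s `&` B s) z <-> orect (x1 + s) (x2 - s) (y1 + s) (y2 - s) z.
  by split=> [[[h1 h2] [h3 _]]|[/andP[h1 h2] h3]]; split=> //; rewrite ?h1 ?h3.
pose z0 : R[i] := ((x1 + x2) / 2) +i* ((y1 + y2) / 2).
have z0R : orect (x1 + s0) (x2 - s0) (y1 + s0) (y2 - s0) z0.
  by rewrite /z0; split=> /=; apply/andP; split; lra.
(* One constant must serve all m: it is computed in the smallest rectangle and compared with the
   others by [winding_shrink]. *)
pose W := winding (x1 + s0) (x2 - s0) (y1 + s0) (y2 - s0) z0.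
have W0 : W != 0 by exact: winding_neq0.
have L0 : 0 < 2 * (x2 - x1) + (y2 - y1) by lra.
have mx m : 0 <= m -> m < s0 -> x1 + m <= x2 - m by move=> *; lra.
have my m : 0 <= m -> m < s0 -> y1 + m <= y2 - m by move=> *; lra.
have sub s m : s < m -> crect (x1 + m) (x2 - m) (y1 + m) (y2 - m) `<=` A s `&` B s.
  by move=> sm z [/andP[? ?] /andP[? ?]]; apply/ABE; split; apply/andP; split; lra.
apply: (@contour_split_family s0 _ A B
  (fun m => rect_contour3 (x1 + m) (x2 - m) (y1 + m) (y2 - m))
  (fun m => rect_contour1 (x1 + m) (y1 + m) (y2 - m)) W L0 W0).
- move=> s z [h1 /andP[h2 h3]].
  exists (Num.min (x2 - s - Re z) (Num.min (Im z - (y1 + s)) (y2 - s - Im z))).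
    by rewrite !lt_min !subr_gt0 h1 h2.
  move=> w; rewrite !lt_min => /and3P[k1 k2 k3].
  have := cmod_Re (w - z); have := cmod_Im (w - z); rewrite !raddfB /= !ler_norml.
  by move=> /andP[? ?] /andP[? ?]; split; [lra|apply/andP; split; lra].
- move=> s z [h1 /andP[h2 h3]].
  exists (Num.min (Re z - (x1 + s)) (Num.min (Im z - (y1 + s)) (y2 - s - Im z))).
    by rewrite !lt_min !subr_gt0 h1 h2.
  move=> w; rewrite !lt_min => /and3P[k1 k2 k3].
  have := cmod_Re (w - z); have := cmod_Im (w - z); rewrite !raddfB /= !ler_norml.
  by move=> /andP[? ?] /andP[? ?]; split; [lra|apply/andP; split; lra].
- by move=> s t st z [h1 /andP[h2 h3]]; split; [lra|apply/andP; split; lra].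
- by move=> s t st z [h1 /andP[h2 h3]]; split; [lra|apply/andP; split; lra].
- by move=> m m0 ms; rewrite contour_len3 ?mx ?my//; lra.
- by move=> m m0 ms; rewrite contour_len1 ?my//; lra.
- by move=> m t m0 mt ts0 z [h1 /andP[h2 h3]]; apply: contour_far3; lra.
- by move=> m t m0 mt ts0 z [h1 /andP[h2 h3]]; apply: contour_far1; lra.
- move=> s m s_ge0 sm ms0 z /on_contour3[]; first by apply: mx => //; lra.
    by apply: my => //; lra.
  by move=> zc _; exact: sub zc.
- move=> s m s_ge0 sm ms0 z /(@on_contour1 _ (x2 - m))[]; first by apply: mx => //; lra.
    by apply: my => //; lra.
  by move=> zc _; exact: sub zc.
- move=> s m t g s_ge0 sm mt ts0 gc z /ABE zt.
  have zm : orect (x1 + m) (x2 - m) (y1 + m) (y2 - m) z.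
    by case: zt => /andP[? ?] /andP[? ?]; split; apply/andP; split; lra.
  have z0m : orect (x1 + m) (x2 - m) (y1 + m) (y2 - m) z0.
    by case: z0R => /andP[? ?] /andP[? ?]; split; apply/andP; split; lra.
  have xm : x1 + m < x2 - m by lra.
  have ym : y1 + m < y2 - m by lra.
  rewrite -cauchy_int_contour cauchy_formula//; last by move=> w /(sub s m sm)/gc.
  rewrite mulrC; congr (_ * _); rewrite (winding_const xm ym zm z0m).
  by apply/esym; apply: winding_shrink z0R; lra.
Qed.

End SplitFamilies.

Section Annulus.
Context {R : realType}.
Implicit Types (z w : R[i]) (g : R[i] -> R[i]) (r s t m : R).

(** The maximum norm, whose discs are the squares on which [rint] is defined. *)
Definition cmax z : R := Num.max `|Re z| `|Im z|.

Lemma cmax_lip z w : cmax z - cmax w <= cmod (z - w).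
Proof.
rewrite lerBlDl /cmax ge_max; apply/andP; split.
  apply: le_trans (_ : `|Re w| + `|Re (z - w)| <= _).
    by rewrite raddfB /=; apply: le_trans (ler_normD _ _); rewrite addrC subrK.
  by apply: lerD; [rewrite le_max lexx|exact: cmod_Re].
apply: le_trans (_ : `|Im w| + `|Im (z - w)| <= _).
  by rewrite raddfB /=; apply: le_trans (ler_normD _ _); rewrite addrC subrK.
by apply: lerD; [rewrite le_max lexx orbT|exact: cmod_Im].
Qed.

Lemma cmax_le_cmod z : cmax z <= cmod z.
Proof. by rewrite /cmax ge_max cmod_Re cmod_Im. Qed.

Lemma copen_cmax_lt (r : R) : copen [set z | cmax z < r].
Proof.
move=> z zA; exists (r - cmax z); first by rewrite subr_gt0.
by move=> w wz; have := cmax_lip w z => /=; lra.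
Qed.

Lemma copen_cmax_gt (r : R) : copen [set z | r < cmax z].
Proof.
move=> z zB; exists (cmax z - r); first by rewrite subr_gt0.
by move=> w; rewrite cmod_distC => wz; have := cmax_lip z w => /=; lra.
Qed.

Lemma orect_cmax r z : orect (- r) r (- r) r z <-> cmax z < r.
Proof.
by rewrite /orect /= /cmax gt_max !ltr_norml; split=> [[-> ->]|/andP[]].
Qed.

Lemma crect_cmax r z : crect (- r) r (- r) r z <-> cmax z <= r.
Proof.
by rewrite /crect /= /cmax ge_max !ler_norml; split=> [[-> ->]|/andP[]].
Qed.

Lemma rbdry_cmax r z : rbdry (- r) r (- r) r z -> cmax z = r.
Proof.
move=> [/crect_cmax zr zn]; apply/eqP; rewrite eq_le zr /= leNgt; apply/negP.
by move=> /orect_cmax.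
Qed.

Definition square_contour (c : R[i]) r : contour :=
  [:: (c, (- r +i* - r, r +i* - r)); (c, (r +i* - r, r +i* r));
      (- c, (- r +i* r, r +i* r)); (- c, (- r +i* - r, - r +i* r))].

Lemma on_square_contour c r z : 0 <= r -> on_contour (square_contour c r) z -> cmax z = r.
Proof.
move=> r0 [d]; have rr : - r <= r by lra.
rewrite !inE => /or4P[] /eqP -> [t t01 ->] /=; apply: rbdry_cmax.
- exact: rbdry_bottom.
- exact: rbdry_right.
- exact: rbdry_top.
- exact: rbdry_left.
Qed.

Lemma square_contour_int c r g z : contour_int (square_contour c r) g z =
  c * cauchy_int (- r) r (- r) r g z.
Proof. by rewrite /contour_int /cauchy_int /rint !big_cons big_nil; cbn [fst snd]; ring. Qed.

Lemma square_contour_len c r : 0 <= r -> contour_len (square_contour c r) = 8 * r * cmod c.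
Proof.
move=> r0; have rr : - r <= r by lra.
rewrite /contour_len !big_cons big_nil; cbn [fst snd].
rewrite ?cmodN !cmod_horiz// !cmod_vert//; ring.
Qed.

Lemma square_contour_far c r z e : 0 <= r ->
  (forall w, cmax w = r -> e <= cmod (w - z)) -> contour_far (square_contour c r) z e.
Proof. by move=> r0 H d dG t t01; apply: H; apply: (@on_square_contour c) => //; exists d => //; exists t. Qed.

(** Here h is (g - c) / (w - z) on the boundary; with c = g(z) this links a divided difference to
    Cauchy integrals, for z inside or outside. *)
Lemma rint_div_subr (x1 x2 y1 y2 : R) g h c z : x1 <= x2 -> y1 <= y2 ->
  (forall w, rbdry x1 x2 y1 y2 w -> w != z) -> rcont x1 x2 y1 y2 g ->
  (forall w, rbdry x1 x2 y1 y2 w -> g w = c + (w - z) * h w) ->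
  rint x1 x2 y1 y2 h = cauchy_int x1 x2 y1 y2 g z - c * winding x1 x2 y1 y2 z.
Proof.
move=> x12 y12 wz gc gE.
have ic w : rbdry x1 x2 y1 y2 w -> forall g, ccont g w -> ccont (fun w => g w / (w - z)) w.
  by move=> wb g' g'c; apply: ccont_div_subr => //; exact: wz.
have c1 : rcont x1 x2 y1 y2 (fun w => g w / (w - z)) by move=> w wb; apply: ic => //; exact: gc.
have c2 : rcont x1 x2 y1 y2 (fun w => 1 / (w - z)).
  by move=> w wb; apply: (ic w wb (fun=> 1)); exact: ccont_cst.
have c3 : rcont x1 x2 y1 y2 (fun w => - c * (1 / (w - z))).
  by move=> w wb; apply: ccontM; [exact: ccont_cst|exact: c2].
have -> : rint x1 x2 y1 y2 h = rint x1 x2 y1 y2 (fun w => g w / (w - z) + - c * (1 / (w - z))).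
  apply: rint_ext => // w wb; rewrite gE//; field.
  by rewrite subr_eq0 wz.
by rewrite (rintD x12 y12 c1 c3) (rintZ x12 y12 _ c2) mulNr.
Qed.

(** The divided difference of g at z is holomorphic on the annulus, so its integrals along the outer
    and the inner square agree. As z has winding W with respect to the outer square and 0 with
    respect to the inner one, this is Cauchy's formula for an annulus. *)
Lemma annulus_split_family (r1 r2 s0 : R) : 0 < s0 -> 0 <= r1 -> r1 + s0 < r2 - s0 ->
  split_family s0 (fun s => [set z | cmax z < r2 - s]) (fun s => [set z | r1 + s < cmax z]).
Proof.
move=> s00 r10 r12; set A := (fun s => [set z | cmax z < r2 - s]).
set B := (fun s => [set z | r1 + s < cmax z]).
have inR r : 0 < r -> orect (- r) r (- r) r 0.
  by move=> r0; apply/orect_cmax; rewrite /cmax /= normr0 maxxx.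
pose W := winding (- (r2 - s0)) (r2 - s0) (- (r2 - s0)) (r2 - s0) 0.
have W0 : W != 0 by apply: winding_neq0; [lra..|apply: inR; lra].
have L0 : 0 < 8 * r2 by lra.
have oA s : copen (A s) by exact: copen_cmax_lt.
have oB s : copen (B s) by exact: copen_cmax_gt.
apply: (@contour_split_family R s0 (8 * r2) A B (fun m => square_contour 1 (r2 - m))
  (fun m => square_contour (-1) (r1 + m)) W L0 W0) => //.
- by move=> s t st z; rewrite /A /=; lra.
- by move=> s t st z; rewrite /B /=; lra.
- by move=> m m0 ms; rewrite square_contour_len ?cmod1; lra.
- by move=> m m0 ms; rewrite square_contour_len ?cmodN ?cmod1; lra.
- move=> m t m0 mt ts0 z; rewrite /A /= => zA; apply: square_contour_far; first by lra.
  by move=> w wr; have := cmax_lip w z; lra.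
- move=> m t m0 mt ts0 z; rewrite /B /= => zA; apply: square_contour_far; first by lra.
  by move=> w wr; rewrite cmod_distC; have := cmax_lip z w; lra.
- move=> s m s_ge0 sm ms0 z /on_square_contour; rewrite /A /B /setI /= => zr.
  by have {}zr := zr ltac:(lra); lra.
- move=> s m s_ge0 sm ms0 z /on_square_contour; rewrite /A /B /setI /= => zr.
  by have {}zr := zr ltac:(lra); lra.
move=> s m t g s_ge0 sm mt ts0 gc z [zA zB].
rewrite !square_contour_int.
have zU : (A s `&` B s) z by move: zA zB; rewrite /A /B /setI /=; lra.
have [h hU hE] := divided_difference (copenI (oA s) (oB s)) gc zU.
have UE (r : R) : r1 + s < r -> r < r2 - s -> forall w, rbdry (- r) r (- r) r w -> (A s `&` B s) w.
  by move=> h1 h2 w /rbdry_cmax wr; rewrite /A /B /setI /=; lra.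
have U1 : forall w, rbdry (- (r2 - m)) (r2 - m) (- (r2 - m)) (r2 - m) w -> (A s `&` B s) w.
  by apply: UE; lra.
have U2 : forall w, rbdry (- (r1 + m)) (r1 + m) (- (r1 + m)) (r1 + m) w -> (A s `&` B s) w.
  by apply: UE; lra.
have h12 : rint (- (r2 - m)) (r2 - m) (- (r2 - m)) (r2 - m) h =
    rint (- (r1 + m)) (r1 + m) (- (r1 + m)) (r1 + m) h.
  apply: rint_shrink; try lra.
  move=> w /crect_cmax wo wi; apply: hU.
  have : r1 + m <= cmax w by rewrite leNgt; apply/negP => /orect_cmax.
  by rewrite /A /B /setI /=; lra.
have E1 := @rint_div_subr (- (r2 - m)) (r2 - m) (- (r2 - m)) (r2 - m) g h (g z) z
   ltac:(lra) ltac:(lra) _ _ (fun w wb => hE w (U1 w wb)).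
have E2 := @rint_div_subr (- (r1 + m)) (r1 + m) (- (r1 + m)) (r1 + m) g h (g z) z
   ltac:(lra) ltac:(lra) _ _ (fun w wb => hE w (U2 w wb)).
move: zA zB; rewrite /A /B /= => zA zB.
have {}E1 := E1 ltac:(move=> w /rbdry_cmax wr; apply/eqP => wz; rewrite wz in wr; lra)
  ltac:(by move=> w /U1; exact: chol_ccont gc).
have {}E2 := E2 ltac:(move=> w /rbdry_cmax wr; apply/eqP => wz; rewrite wz in wr; lra)
  ltac:(by move=> w /U2; exact: chol_ccont gc).
have W2 : winding (- (r1 + m)) (r1 + m) (- (r1 + m)) (r1 + m) z = 0.
  apply: goursat; try lra.
  move=> w /crect_cmax wr; have wz : w != z by apply/eqP => E; rewrite E in wr; lra.
  exists (0 * (w - z)^-1 + 1 * (- 1 / (w - z) ^+ 2)).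
  by apply: cderivM; [exact: cderiv_cst|exact: cderiv_inv_subr].
have W1 : winding (- (r2 - m)) (r2 - m) (- (r2 - m)) (r2 - m) z = W.
  have p1 : - (r2 - m) < r2 - m by lra.
  have zR : orect (- (r2 - m)) (r2 - m) (- (r2 - m)) (r2 - m) z by apply/orect_cmax; lra.
  have oR : orect (- (r2 - m)) (r2 - m) (- (r2 - m)) (r2 - m) 0 by apply: inR; lra.
  rewrite (winding_const p1 p1 zR oR).
  by apply: winding_shrink; [lra|lra|lra|lra|apply: inR; lra].
rewrite W1 in E1; rewrite W2 mulr0 subr0 in E2.
by move: h12; rewrite E1 E2 mul1r mulN1r => <-; ring.
Qed.

End Annulus.

(** * Frames of vector bundles on the projective line *)

Section ProjectiveLine.
Context {R : realType}.
Implicit Types (z w : R[i]) (U : set R[i]) (W V : set (P1 R)).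

Lemma cderiv_comp (f g : R[i] -> R[i]) z d d' : cderiv g z d -> cderiv f (g z) d' ->
  cderiv (fun w => f (g w)) z (d' * d).
Proof.
move=> gd fd e e0.
have L0 : 0 < cmod d + 1 by have := cmod_ge0 d; lra.
have D0 : 0 < cmod d' + 1 by have := cmod_ge0 d'; lra.
have [|r r0 rP] := fd (e / 2 / (cmod d + 1)); first by rewrite !divr_gt0.
have [|s s0 sP] := gd (e / 2 / (cmod d' + 1)); first by rewrite !divr_gt0.
have [t t0 tP] := cderiv_lip gd.
exists (Num.min s (Num.min t (r / (cmod d + 1)))); first by rewrite !lt_min s0 t0 divr_gt0.
move=> w; rewrite !lt_min => /and3P[/sP le1 /tP le2 wr].
rewrite ltr_pdivlMr// mulrC in wr.
have le3 := rP (g w) (le_lt_trans le2 wr).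
have -> : f (g w) - f (g z) - (w - z) * (d' * d) =
  (f (g w) - f (g z) - (g w - g z) * d') + (g w - g z - (w - z) * d) * d' by ring.
apply: le_trans (cmodD _ _) _.
rewrite (_ : e * cmod (w - z) = e / 2 * cmod (w - z) + e / 2 * cmod (w - z)); last by lra.
apply: lerD.
  apply: le_trans le3 _; apply: le_trans (ler_wpM2l _ le2) _; first by rewrite !divr_ge0// ltW.
  by rewrite mulrA divfK// gt_eqF.
rewrite cmodM; apply: le_trans (_ : e / 2 / (cmod d' + 1) * cmod (w - z) * (cmod d' + 1) <= _).
  by apply: ler_pM; rewrite ?cmod_ge0// lerDl.
by rewrite mulrAC divfK// gt_eqF.
Qed.

Lemma cderiv_inv z : z != 0 -> cderiv (fun w => w^-1) z (- 1 / z ^+ 2).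
Proof. by move=> z0; apply: (@cderivV _ id) => //; exact: cderiv_id. Qed.

Lemma copen_neq0 : copen [set z : R[i] | z != 0].
Proof. by apply/open_in_copenP; exact: open_in_neq0. Qed.

Lemma copen_inv U : copen U -> copen [set w | w != 0 /\ U w^-1].
Proof.
move=> oU w [w0 Uw]; have [r r0 rU] := oU _ Uw.
have r20 : 0 < r / 2 by rewrite divr_gt0.
have [s s0 sP] := @ccontV _ id w w0 (ccont_id w) _ r20.
have [t t0 tP] := copen_neq0 w0.
exists (Num.min s t); first by rewrite lt_min s0.
move=> x; rewrite lt_min => /andP[/sP le1 /tP x0]; split => //; apply: rU.
by apply: le_lt_trans le1 _; lra.
Qed.

Definition popen W := copen (@affine0 R @^-1` W) /\ copen (@affine1 R @^-1` W).

Lemma popenP W : popen W <-> P1_open W.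
Proof. by rewrite /popen /P1_open -!open_in_copenP. Qed.

Lemma popenI W V : popen W -> popen V -> popen (W `&` V).
Proof. by rewrite !popenP; exact: P1_openI. Qed.

Definition pholo m n W (M : P1 R -> 'M[R[i]]_(m, n)) :=
  cholmx (@affine0 R @^-1` W) (M \o @affine0 R) /\
  cholmx (@affine1 R @^-1` W) (M \o @affine1 R).

Lemma pholoP m n W (M : P1 R -> 'M[R[i]]_(m, n)) : P1_holo_mx W M <-> pholo W M.
Proof.
split=> -[h0 h1]; split=> i j.
- exact: (holo_cderivP _ _).1 (h0 i j).
- exact: (holo_cderivP _ _).1 (h1 i j).
- exact: (holo_cderivP _ _).2 (h0 i j).
- exact: (holo_cderivP _ _).2 (h1 i j).
Qed.

Lemma pholo_local m n W (M : P1 R -> 'M[R[i]]_(m, n)) :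
  (forall x, W x -> exists2 V, V x & pholo V M) -> pholo W M.
Proof.
move=> H; split=> i j z Wz.
  by have [V Vz [h0 _]] := H _ Wz; exact: h0 Vz.
by have [V Vz [_ h1]] := H _ Wz; exact: h1 Vz.
Qed.

Lemma pholo_subset m n W V (M : P1 R -> 'M[R[i]]_(m, n)) :
  W `<=` V -> pholo V M -> pholo W M.
Proof. by move=> WV VM; apply: pholo_local => x /WV Vx; exists V. Qed.

Lemma pholo_ext m n W (M N : P1 R -> 'M[R[i]]_(m, n)) : popen W ->
  (forall x, W x -> M x = N x) -> pholo W N -> pholo W M.
Proof.
move=> [W0 W1] MN [h0 h1]; split.
  by apply: cholmx_ext W0 _ h0 => z; exact: MN.
by apply: cholmx_ext W1 _ h1 => z; exact: MN.
Qed.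

Lemma pholoM m n p W (M : P1 R -> 'M[R[i]]_(m, n)) (N : P1 R -> 'M[R[i]]_(n, p)) :
  pholo W M -> pholo W N -> pholo W (fun x => M x *m N x).
Proof. by move=> [M0 M1] [N0 N1]; split; apply: cholmxM. Qed.

Lemma pholo_cst m n W (M : 'M[R[i]]_(m, n)) : pholo W (fun=> M).
Proof. by split; exact: cholmx_cst. Qed.

Lemma pholo_inv n W (M : P1 R -> 'M[R[i]]_n) : (forall x, W x -> M x \in unitmx) ->
  pholo W M -> pholo W (fun x => invmx (M x)).
Proof.
by move=> Mu [M0 M1]; split; apply: cholmx_inv; split => // z /Mu.
Qed.

Definition wcoord (x : P1 R) : R[i] := hcoord x 0 0 / hcoord x 0 1.

Lemma wcoord_affine1 w : wcoord (affine1 w) = w.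
Proof.
rewrite /wcoord; have [c c0 ->] := hcoord_hpoint (hvec_1_neq0 w).
by rewrite !mxE /= mulr1 mulrAC divff // mul1r.
Qed.

Lemma wcoordE x : wcoord x = (zcoord x)^-1.
Proof. by rewrite /wcoord /zcoord invfM invrK mulrC. Qed.

Lemma affine01 z : z != 0 -> affine0 z = affine1 z^-1.
Proof.
move=> z0; have h : U1 (affine0 z) by rewrite U1_affine0.
by rewrite -{1}(affine1K h) -/(wcoord _) wcoordE zcoord_affine0.
Qed.

Definition zlift U : set (P1 R) := [set x | U0 x /\ U (zcoord x)].
Definition wlift U : set (P1 R) := [set x | U1 x /\ U (wcoord x)].

Lemma zlift_affine0 U z : zlift U (affine0 z) <-> U z.
Proof. by rewrite /zlift /= U0_affine0 zcoord_affine0; split=> [[]|]. Qed.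

Lemma wlift_affine1 U z : wlift U (affine1 z) <-> U z.
Proof. by rewrite /wlift /= U1_affine1 wcoord_affine1; split=> [[]|]. Qed.

Lemma zlift_affine1 U w : zlift U (affine1 w) <-> w != 0 /\ U w^-1.
Proof. by rewrite /zlift /= U0_affine1 zcoord_affine1. Qed.

Lemma wlift_affine0 U z : wlift U (affine0 z) <-> z != 0 /\ U z^-1.
Proof. by rewrite /wlift /= U1_affine0 wcoordE zcoord_affine0. Qed.

Lemma popen_zlift U : copen U -> popen (zlift U).
Proof.
move=> oU; split.
  by move=> z /zlift_affine0/oU[r r0 rU]; exists r => // w /rU /zlift_affine0.
move=> w /zlift_affine1/(copen_inv oU)[r r0 rU]; exists r => // x /rU.
by move/zlift_affine1.
Qed.

Lemma popen_wlift U : copen U -> popen (wlift U).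
Proof.
move=> oU; split; last first.
  by move=> z /wlift_affine1/oU[r r0 rU]; exists r => // w /rU /wlift_affine1.
move=> w /wlift_affine0/(copen_inv oU)[r r0 rU]; exists r => // x /rU.
by move/wlift_affine0.
Qed.

Lemma pholo_zlift m n U (a : R[i] -> 'M[R[i]]_(m, n)) : cholmx U a ->
  pholo (zlift U) (fun x => a (zcoord x)).
Proof.
move=> aU; split=> i j z /=.
  move=> /zlift_affine0 Uz; have [d ad] := aU i j z Uz; exists d.
  by apply: cderiv_near ltr01 _ ad => w _; rewrite zcoord_affine0.
move=> /zlift_affine1[z0 Uz]; have [d ad] := aU i j _ Uz.
exists (d * (- 1 / z ^+ 2)).
apply: cderiv_near ltr01 _ (cderiv_comp (cderiv_inv z0) ad) => w _.
by rewrite zcoord_affine1.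
Qed.

Lemma pholo_wlift m n U (a : R[i] -> 'M[R[i]]_(m, n)) : cholmx U a ->
  pholo (wlift U) (fun x => a (wcoord x)).
Proof.
move=> aU; split=> i j z /=; last first.
  move=> /wlift_affine1 Uz; have [d ad] := aU i j z Uz; exists d.
  by apply: cderiv_near ltr01 _ ad => w _; rewrite wcoord_affine1.
move=> /wlift_affine0[z0 Uz]; have [d ad] := aU i j _ Uz.
exists (d * (- 1 / z ^+ 2)).
apply: cderiv_near ltr01 _ (cderiv_comp (cderiv_inv z0) ad) => w _.
by rewrite wcoordE zcoord_affine0.
Qed.

End ProjectiveLine.

Section Frames.
Context {R : realType} {n : nat} (E : bundle R n).
Implicit Types (W V : set (P1 R)).

(** A frame is described dually, by the coordinates it induces on the fibers, so that the
    trivializations of the atlas are frames as they stand. *)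
Definition coords := forall x : P1 R, fiber E x -> 'cV[R[i]]_n.
Implicit Types (phi psi chi : coords).

Definition linbij (x : P1 R) phi := linear (phi x) /\ bijective (phi x).

Definition change phi psi x : 'M[R[i]]_n :=
  xget 0 [set g : 'M[R[i]]_n | forall v, psi x v = g *m phi x v].

Lemma linear_changeP (F : lmodType R[i]) m p (f : F -> 'cV[R[i]]_m) (g : F -> 'cV[R[i]]_p) :
  linear f -> bijective f -> linear g -> exists A : 'M[R[i]]_(p, m), forall v : F, g v = A *m f v.
Proof.
move=> fl [f' fK Kf] gl.
have f'l : linear f' by move=> c u v; apply: (can_inj fK); rewrite fl !Kf.
have gl0 : g 0 = 0 by have := gl (-1) 0 0; rewrite scaler0 addr0 scaleN1r addNr.
have f'0 : f' 0 = 0 by have := f'l (-1) 0 0; rewrite scaler0 addr0 scaleN1r addNr.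
have glD u v : g (u + v) = g u + g v by have := gl 1 u v; rewrite !scale1r.
have f'D u v : f' (u + v) = f' u + f' v by have := f'l 1 u v; rewrite !scale1r.
have glZ c u : g (c *: u) = c *: g u by have := gl c u 0; rewrite gl0 !addr0.
have f'Z c u : f' (c *: u) = c *: f' u by have := f'l c u 0; rewrite f'0 !addr0.
exists (\matrix_(i, j) g (f' (delta_mx j 0)) i 0) => v.
rewrite -[in LHS](fK v); move: (f v) => y {v}.
have -> : g (f' y) = \sum_j y j 0 *: g (f' (delta_mx j 0)).
  rewrite {1}[y]matrix_sum_delta; under eq_bigr do rewrite big_ord1.
  rewrite (big_morph f' f'D f'0) (big_morph g glD gl0).
  by apply: eq_bigr => j _; rewrite f'Z glZ.
apply/matrixP => i j; rewrite ord1 summxE !mxE; apply: eq_bigr => k _.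
by rewrite !mxE mulrC.
Qed.

Lemma changeP phi psi x : linbij x phi -> linear (psi x) ->
  forall v, psi x v = change phi psi x *m phi x v.
Proof.
move=> [phil phib] psil.
exact: (@xgetPex _ 0 [set g : 'M[R[i]]_n | forall v, psi x v = g *m phi x v]
  (linear_changeP phil phib psil)).
Qed.

Lemma change_uniq p phi x (A B : 'M[R[i]]_(p, n)) : linbij x phi ->
  (forall v, A *m phi x v = B *m phi x v) -> A = B.
Proof.
move=> [_ [f fK Kf]] AB; apply/matrixP => i j.
have := AB (f (delta_mx j 0)); rewrite Kf => /colP/(_ i).
by rewrite -!colE !mxE.
Qed.

Lemma changeE phi psi x (A : 'M[R[i]]_n) : linbij x phi ->
  (forall v, psi x v = A *m phi x v) -> change phi psi x = A.
Proof.
move=> phix AE; apply: (change_uniq phix) => v.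
have psil : linear (psi x) by move=> c u w; rewrite !AE phix.1 mulmxDr scalemxAr.
by rewrite -changeP// AE.
Qed.

Lemma changeM phi psi chi x : linbij x phi -> linbij x psi -> linear (chi x) ->
  change phi chi x = change psi chi x *m change phi psi x.
Proof.
move=> px qx cx; apply: changeE => // v.
by rewrite -mulmxA -changeP//; [exact: changeP|exact: qx.1].
Qed.

Lemma change_id phi x : linbij x phi -> change phi phi x = 1%:M.
Proof. by move=> px; apply: changeE => // v; rewrite mul1mx. Qed.

Lemma change_unit phi psi x : linbij x phi -> linbij x psi -> change phi psi x \in unitmx.
Proof.
move=> px qx; have := changeM qx px qx.1; rewrite change_id// => /esym.
by case/mulmx1_unit.
Qed.

Lemma change_inv phi psi x : linbij x phi -> linbij x psi ->
  change psi phi x = invmx (change phi psi x).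
Proof.
move=> px qx; have := changeM px qx px.1; rewrite change_id// => H.
by rewrite -[RHS]mul1mx H mulmxK// change_unit.
Qed.

Definition frame W phi := (forall x, W x -> linbij x phi) /\
  forall i : chart E, pholo (W `&` dom i) (change phi (@triv _ _ E i)).

Lemma triv_linbij (i : chart E) x : dom i x -> linbij x (@triv _ _ E i).
Proof. by move=> ix; split; [exact: triv_linear|exact: triv_bij]. Qed.

Lemma popen_dom (i : chart E) : popen (dom i).
Proof. by apply/popenP; exact: dom_open. Qed.

Lemma chart_frame (i : chart E) : frame (dom i) (@triv _ _ E i).
Proof.
split=> [x|j]; first exact: triv_linbij.
have [g /pholoP gh gE] := triv_holo j i.
apply: (pholo_ext (N := g)); first exact: popenI (popen_dom i) (popen_dom j).
  move=> x [ix jx]; apply: changeE; first exact: triv_linbij.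
  exact: gE.
by apply: pholo_subset gh => x [].
Qed.

(** Near each point both frames are compared with a trivialization of the atlas, and the two
    transition matrices are combined. *)
Lemma frame_change W V phi psi : popen W -> popen V -> frame W phi -> frame V psi ->
  pholo (W `&` V) (change phi psi).
Proof.
move=> oW oV [phil phih] [psil psih]; apply: pholo_local => x [Wx Vx].
have [i ix] := dom_cover E x; exists ((W `&` V) `&` dom i); first by [].
apply: (pholo_ext (N := fun y => invmx (change psi (@triv _ _ E i) y) *m
    change phi (@triv _ _ E i) y)).
- by apply: popenI; [exact: popenI|exact: popen_dom].
- move=> y [[Wy Vy] iy]; have py := phil y Wy; have qy := psil y Vy.
  have ty := triv_linbij iy.
  by rewrite -change_inv// -changeM//; exact: qy.1.
apply: pholoM.
  apply: pholo_inv; first by move=> y [[_ Vy] iy]; apply: change_unit; [exact: psil|exact: triv_linbij].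
  by apply: pholo_subset (psih i) => y [[_ Vy] iy].
by apply: pholo_subset (phih i) => y [[Wy _] iy].
Qed.

Definition act (g : P1 R -> 'M[R[i]]_n) phi : coords := fun x v => g x *m phi x v.

Lemma linbij_act (g : P1 R -> 'M[R[i]]_n) phi x : g x \in unitmx -> linbij x phi ->
  linbij x (act g phi).
Proof.
move=> gu [phil [f fK Kf]]; split.
  by move=> c u v; rewrite /act phil mulmxDr scalemxAr.
exists (fun y => f (invmx (g x) *m y)) => v; first by rewrite /act mulKmx.
by rewrite /act Kf mulKVmx.
Qed.

Lemma frame_act W phi (g : P1 R -> 'M[R[i]]_n) : popen W -> frame W phi ->
  (forall x, W x -> g x \in unitmx) -> pholo W g -> frame W (act g phi).
Proof.
move=> oW [phil phih] gu gh; have al x : W x -> linbij x (act g phi).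
  by move=> Wx; apply: linbij_act; [exact: gu|exact: phil].
split => // i.
apply: (pholo_ext (N := fun x => change phi (@triv _ _ E i) x *m invmx (g x))).
- by apply: popenI => //; exact: popen_dom.
- move=> x [Wx ix]; apply: changeE; first exact: al.
  move=> v; rewrite /act -mulmxA mulKmx ?gu//.
  by apply: changeP; [exact: phil|exact: triv_linear].
apply: pholoM => //; apply: pholo_inv; first by move=> x [/gu].
by apply: pholo_subset gh => x [].
Qed.

Lemma frame_subset W V phi : W `<=` V -> frame V phi -> frame W phi.
Proof.
move=> WV [phil phih]; split=> [x /WV|i]; first exact: phil.
by apply: pholo_subset (phih i) => x [/WV].
Qed.

Lemma frame_ext W phi psi : popen W -> (forall x, W x -> forall v, psi x v = phi x v) ->
  frame W phi -> frame W psi.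
Proof.
move=> oW E1 [phil phih].
have psil x : W x -> linbij x psi.
  move=> Wx; have [pl [f fK Kf]] := phil x Wx; split.
    by move=> c u v; rewrite !E1//; exact: pl.
  by exists f => v; rewrite E1.
split => // i; apply: (pholo_ext (N := change phi (@triv _ _ E i))) => //.
  by apply: popenI => //; exact: popen_dom.
move=> x [Wx ix]; apply: changeE; first exact: psil.
by move=> v; rewrite E1//; apply: changeP; [exact: phil|exact: triv_linear].
Qed.

Lemma frame_glue W V phi psi : popen W -> popen V -> frame W phi -> frame V psi ->
  (forall x, W x -> V x -> forall v, phi x v = psi x v) ->
  exists chi, [/\ frame (W `|` V) chi, forall x, W x -> chi x = phi x &
    forall x, V x -> chi x = psi x].
Proof.
move=> oW oV fW fV agree.
pose chi : coords := fun x => if pselect (W x) is left _ then phi x else psi x.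
have cW x : W x -> chi x = phi x by rewrite /chi; case: pselect.
have cV x : V x -> chi x = psi x.
  move=> Vx; rewrite /chi; case: pselect => // Wx.
  by apply/funext => v; exact: agree.
exists chi; split => //.
have [cWl cWh] : frame W chi by apply: frame_ext fW => // x Wx v; rewrite cW.
have [cVl cVh] : frame V chi by apply: frame_ext fV => // x Vx v; rewrite cV.
split=> [x [/cWl|/cVl] //|i]; apply: pholo_local => x [[Wx|Vx] ix].
  by exists (W `&` dom i); [split|exact: cWh].
by exists (V `&` dom i); [split|exact: cVh].
Qed.

End Frames.

(** * Gluing frames *)

Section Gluing.
Context {R : realType}.
Implicit Types (z w : R[i]) (U V : set R[i]).

Lemma cholGL_scale n U (T : R[i] -> 'M[R[i]]_n) c : cholGL U T ->
  cholGL [set z | U (c * z)] (fun z => T (c * z)).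
Proof.
move=> [TU Tu]; split; last by move=> z /Tu.
move=> i j z Uz; have [d Td] := TU i j _ Uz.
exists (d * c); apply: cderiv_comp Td.
by apply: cderiv_eq (cderivM (cderiv_cst c z) (cderiv_id z)) _; ring.
Qed.

Lemma strip_cartan n (x1 x2 y1 y2 e : R) (T : R[i] -> 'M[R[i]]_n) : 0 < e ->
  x1 + e < x2 - e -> y1 + e < y2 - e -> cholGL (orect x1 x2 y1 y2) T ->
  exists a b, [/\ cholGL [set z | Re z < x2 - e /\ y1 + e < Im z < y2 - e] a,
    cholGL [set z | x1 + e < Re z /\ y1 + e < Im z < y2 - e] b &
    forall z, orect (x1 + e) (x2 - e) (y1 + e) (y2 - e) z -> T z = a z *m b z].
Proof.
move=> e0 x12 y12 TG.
have sf := strip_split_family e0 x12 y12.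
have [|a [b [aA bB TE]]] := cartan (T := T) sf (lexx 0) e0 (lexx e).
  apply: cholGL_subset TG => z [[z1 /andP[z2 z3]] [z4 _]].
  by split; apply/andP; split; lra.
exists a, b; split => // z [/andP[z1 z2] z3]; apply: TE.
by split; split.
Qed.

(** By the rotation z |-> i z. *)
Lemma strip_cartan_vert n (x1 x2 y1 y2 e : R) (T : R[i] -> 'M[R[i]]_n) : 0 < e ->
  x1 + e < x2 - e -> y1 + e < y2 - e -> cholGL (orect x1 x2 y1 y2) T ->
  exists a b, [/\ cholGL [set z | Im z < y2 - e /\ x1 + e < Re z < x2 - e] a,
    cholGL [set z | y1 + e < Im z /\ x1 + e < Re z < x2 - e] b &
    forall z, orect (x1 + e) (x2 - e) (y1 + e) (y2 - e) z -> T z = a z *m b z].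
Proof.
move=> e0 x12 y12 TG.
have ReI z : Re ('i * z) = - Im z by case: z => u v /=; ring.
have ImI z : Im ('i * z) = Re z by case: z => u v /=; ring.
have ReNI z : Re (- 'i * z) = Im z by case: z => u v /=; ring.
have ImNI z : Im (- 'i * z) = - Re z by case: z => u v /=; ring.
have [|||a [b [aA bB TE]]] := @strip_cartan n y1 y2 (- x2) (- x1) e (fun z => T ('i * z)) e0.
- by [].
- by lra.
- apply: cholGL_subset (cholGL_scale 'i TG) => z [/andP[z1 z2] /andP[z3 z4]].
  by rewrite /orect /= ReI ImI; split; apply/andP; split; lra.
exists (fun z => a (- 'i * z)), (fun z => b (- 'i * z)); split.
- apply: cholGL_subset (cholGL_scale (- 'i) aA) => z [z1 /andP[z2 z3]] /=.
  by rewrite ReNI ImNI; split; [|apply/andP; split]; lra.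
- apply: cholGL_subset (cholGL_scale (- 'i) bB) => z [z1 /andP[z2 z3]] /=.
  by rewrite ReNI ImNI; split; [|apply/andP; split]; lra.
move=> z [/andP[z1 z2] /andP[z3 z4]]; rewrite -TE; last first.
  by rewrite /orect /= ReNI ImNI; split; apply/andP; split; lra.
by rewrite mulrA mulrN -expr2 sqr_i opprK mul1r.
Qed.

Lemma annulus_cartan n (r1 r2 e : R) (T : R[i] -> 'M[R[i]]_n) : 0 < e -> 0 <= r1 ->
  r1 + e < r2 - e -> cholGL [set z | r1 < cmax z < r2] T ->
  exists a b, [/\ cholGL [set z | r1 + e < cmax z] a, cholGL [set z | cmax z < r2 - e] b &
    forall z, r1 + e < cmax z < r2 - e -> T z = a z *m b z].
Proof.
move=> e0 r10 r12 TG.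
have sf := split_family_sym (annulus_split_family e0 r10 r12).
have [|a [b [aA bB TE]]] := cartan (T := T) sf (lexx 0) e0 (lexx e).
  apply: cholGL_subset TG => z [z1 z2] /=; rewrite /= in z1 z2.
  by apply/andP; split; lra.
by exists a, b; split => // z /andP[z1 z2]; apply: TE.
Qed.

Variables (n : nat) (E : bundle R n).

(** From phi = a b psi on the overlap, the frames a^-1 phi and b psi agree there. *)
Lemma glue_frames U V U' V' (phi psi : coords E) (a b : R[i] -> 'M[R[i]]_n) :
  copen U' -> copen V' -> U' `<=` U -> V' `<=` V ->
  frame (zlift U) phi -> frame (zlift V) psi -> cholGL U' a -> cholGL V' b ->
  (forall z, U' z -> V' z -> change psi phi (affine0 z) = a z *m b z) ->
  exists chi : coords E, frame (zlift (U' `|` V')) chi.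
Proof.
move=> oU' oV' UU VV fU fV [ah au] [bh bu] ab.
have lsub A B : A `<=` B -> zlift (R := R) A `<=` zlift B.
  by move=> AB x [x0 /AB].
have fU' := frame_subset (lsub _ _ UU) fU; have fV' := frame_subset (lsub _ _ VV) fV.
have [|||||chi [chif _ _]] := @frame_glue R n E (zlift U') (zlift V')
  (act (fun x => invmx (a (zcoord x))) phi) (act (fun x => b (zcoord x)) psi).
- exact: popen_zlift.
- exact: popen_zlift.
- apply: frame_act => //; first exact: popen_zlift.
    by move=> x [_ Ux]; rewrite unitmx_inv au.
  apply: pholo_inv; first by move=> x [_ Ux]; rewrite au.
  exact: pholo_zlift.
- apply: frame_act => //; first exact: popen_zlift.
    by move=> x [_ Ux]; rewrite bu.
  exact: pholo_zlift.
- move=> x [x0 Ux] [_ Vx] v; rewrite /act.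
  have := @changeP R n E psi phi x (fV'.1 x (conj x0 Vx)) (fU'.1 x (conj x0 Ux)).1 v => ->.
  by rewrite -{2}(affine0K x0) ab// !mulmxA mulVmx ?au// mul1mx.
exists chi; apply: frame_subset chif => x [x0 [Ux|Vx]]; first by left.
by right.
Qed.

Lemma frame_lift_GL U V (phi psi : coords E) : copen U -> copen V ->
  frame (zlift U) phi -> frame (zlift V) psi ->
  cholGL (U `&` V) (fun z => change phi psi (affine0 z)).
Proof.
move=> oU oV fU fV.
have [h _] := frame_change (popen_zlift oU) (popen_zlift oV) fU fV.
split.
  apply: cholmx_subset h => z [Uz Vz]; split; exact/zlift_affine0.
move=> z [Uz Vz]; apply: change_unit; [apply: fU.1|apply: fV.1]; exact/zlift_affine0.
Qed.

(** The rectangles overlap in a strip of half width h about Re z = m. Shrinking by e < h still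
    leaves them overlapping, so no width is lost, only a margin e at the top and at the bottom. *)
Lemma glue_horiz (xa xb m h y1 y2 e : R) (phi psi : coords E) :
  0 < e -> e < h -> y1 + e < y2 - e -> xa <= m - h -> m + h <= xb ->
  frame (zlift (orect xa (m + h) y1 y2)) phi -> frame (zlift (orect (m - h) xb y1 y2)) psi ->
  exists chi : coords E, frame (zlift (orect xa xb (y1 + e) (y2 - e))) chi.
Proof.
move=> e0 eh y12 xam mxb fphi fpsi.
have TG := frame_lift_GL (@copen_orect _ _ _ _ _) (@copen_orect _ _ _ _ _) fpsi fphi.
have xmm : m - h + e < m + h - e by lra.
have [|a [b [aA bB ab]]] := @strip_cartan n (m - h) (m + h) y1 y2 e
    (fun z => change psi phi (affine0 z)) e0 xmm y12.
  apply: cholGL_subset TG => z [/andP[z1 z2] z3].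
  by split; split => //; apply/andP; split; lra.
have [|||||chi chif] := @glue_frames (orect xa (m + h) y1 y2) (orect (m - h) xb y1 y2)
  (orect xa (m + h - e) (y1 + e) (y2 - e)) (orect (m - h + e) xb (y1 + e) (y2 - e)) phi psi a b
  (@copen_orect _ _ _ _ _) (@copen_orect _ _ _ _ _) _ _ fphi fpsi.
- by move=> z [/andP[? ?] /andP[? ?]]; split; apply/andP; split; lra.
- by move=> z [/andP[? ?] /andP[? ?]]; split; apply/andP; split; lra.
- by apply: cholGL_subset aA => z [/andP[? ?] ?]; split.
- by apply: cholGL_subset bB => z [/andP[? ?] ?]; split.
- move=> z [/andP[z1 z2] z3] [/andP[z4 z5] _]; apply: ab.
  by split => //; rewrite z2 z4.
exists chi; apply: frame_subset chif => z [z0 [/andP[z1 z2] z3]]; split => //.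
case: (ltP (Re (zcoord z)) (m + h - e)) => zm; [left|right]; split => //.
  by rewrite z1.
by rewrite z2 andbT; lra.
Qed.

Lemma glue_vert (x1 x2 ya yb m h e : R) (phi psi : coords E) :
  0 < e -> e < h -> x1 + e < x2 - e -> ya <= m - h -> m + h <= yb ->
  frame (zlift (orect x1 x2 ya (m + h))) phi -> frame (zlift (orect x1 x2 (m - h) yb)) psi ->
  exists chi : coords E, frame (zlift (orect (x1 + e) (x2 - e) ya yb)) chi.
Proof.
move=> e0 eh x12 yam myb fphi fpsi.
have TG := frame_lift_GL (@copen_orect _ _ _ _ _) (@copen_orect _ _ _ _ _) fpsi fphi.
have ymm : m - h + e < m + h - e by lra.
have [|a [b [aA bB ab]]] := @strip_cartan_vert n x1 x2 (m - h) (m + h) e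
    (fun z => change psi phi (affine0 z)) e0 x12 ymm.
  apply: cholGL_subset TG => z [z3 /andP[z1 z2]].
  by split; split => //; apply/andP; split; lra.
have [|||||chi chif] := @glue_frames (orect x1 x2 ya (m + h)) (orect x1 x2 (m - h) yb)
  (orect (x1 + e) (x2 - e) ya (m + h - e)) (orect (x1 + e) (x2 - e) (m - h + e) yb) phi psi a b
  (@copen_orect _ _ _ _ _) (@copen_orect _ _ _ _ _) _ _ fphi fpsi.
- by move=> z [/andP[? ?] /andP[? ?]]; split; apply/andP; split; lra.
- by move=> z [/andP[? ?] /andP[? ?]]; split; apply/andP; split; lra.
- by apply: cholGL_subset aA => z [? /andP[? ?]]; split.
- by apply: cholGL_subset bB => z [? /andP[? ?]]; split.
- move=> z [z3 /andP[z1 z2]] [_ /andP[z4 z5]]; apply: ab.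
  by split => //; rewrite z2 z4.
exists chi; apply: frame_subset chif => z [z0 [z3 /andP[z1 z2]]]; split => //.
case: (ltP (Im (zcoord z)) (m + h - e)) => zm; [left|right]; split => //.
  by rewrite z1.
by rewrite z2 andbT; lra.
Qed.

Lemma zlift_subset U V : U `<=` V -> zlift (R := R) U `<=` zlift V.
Proof. by move=> UV x [x0 /UV]. Qed.

Lemma frame_square (L : R) : 0 < L -> exists phi : coords E, frame (zlift [set z | cmax z < L]) phi.
Proof.
move=> L0.
(* The frame is asked on a margin h around the square: neighbouring pieces then overlap, and each
   gluing may consume part of the margin. *)
pose P (x y s : R) := 0 <= s -> exists2 h : R, 0 < h & exists phi : coords E,
  frame (zlift (orect (x - h) (x + s * (2 * L) + h) (y - h) (y + s * (2 * L) + h))) phi.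
suff : P (- L) (- L) 1.
  move=> /(_ ler01)[h h0 [phi fphi]]; exists phi; apply: frame_subset fphi.
  apply: zlift_subset => z /= /orect_cmax[/andP[? ?] /andP[? ?]].
  by split; apply/andP; split; lra.
apply: (@quartering R (2 * L) (2 * L) (- L) (- L) P); [lra|lra| |].
  move=> x y s s0; rewrite /P.
  have s2 : 0 <= s / 2 by rewrite divr_ge0// ltW.
  have l0 : 0 <= s / 2 * (2 * L) by rewrite !mulr_ge0// ltW.
  have -> : x + s / 2 * (2 * L) + s / 2 * (2 * L) = x + s * (2 * L) by lra.
  have -> : y + s / 2 * (2 * L) + s / 2 * (2 * L) = y + s * (2 * L) by lra.
  have xeE : x + s * (2 * L) = x + s / 2 * (2 * L) + s / 2 * (2 * L) by lra.
  have yeE : y + s * (2 * L) = y + s / 2 * (2 * L) + s / 2 * (2 * L) by lra.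
  move: (x + s * (2 * L)) (y + s * (2 * L)) xeE yeE => xe ye.
  move: (s / 2 * (2 * L)) l0 => l l0 xeE yeE P1 P2 P3 P4 _.
  have {P1}[h1 h10 [f1 F1]] := P1 s2; have {P2}[h2 h20 [f2 F2]] := P2 s2.
  have {P3}[h3 h30 [f3 F3]] := P3 s2; have {P4}[h4 h40 [f4 F4]] := P4 s2.
  have [h [h0 [hh1 hh2 hh3 hh4]]] : exists h : R, 0 < h /\ [/\ h <= h1, h <= h2, h <= h3 & h <= h4].
    exists (Num.min (Num.min h1 h2) (Num.min h3 h4)); split; first by rewrite !lt_min h10 h20 h30.
    by rewrite !ge_min !lexx !orbT.
  have sub (x1 x2 y1 y2 x1' x2' y1' y2' : R) (f : coords E) : x1' <= x1 -> x2 <= x2' -> y1' <= y1 -> y2 <= y2' ->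
      frame (zlift (orect x1' x2' y1' y2')) f -> frame (zlift (orect x1 x2 y1 y2)) f.
    move=> ? ? ? ?; apply: frame_subset; apply: zlift_subset => z [/andP[? ?] /andP[? ?]].
    by split; apply/andP; split; lra.
  have {}F1 : frame (zlift (orect (x - h) (x + l + h) (y - h) (y + l + h))) f1.
    by apply: sub F1; lra.
  have {}F2 : frame (zlift (orect (x + l - h) (xe + h) (y - h) (y + l + h))) f2.
    by apply: sub F2; lra.
  have {}F3 : frame (zlift (orect (x - h) (x + l + h) (y + l - h) (ye + h))) f3.
    by apply: sub F3; lra.
  have {}F4 : frame (zlift (orect (x + l - h) (xe + h) (y + l - h) (ye + h))) f4.
    by apply: sub F4; lra.
  (* The horizontal gluings cut the vertical margin from h to h / 2; the vertical one, with loss h /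
     4, leaves a margin of at least h / 2 everywhere. *)
  have h20' : 0 < h / 2 by lra.
  have h2h : h / 2 < h by lra.
  have [|||g1 G1] := glue_horiz h20' h2h _ _ _ F1 F2; try lra.
  have [|||g2 G2] := glue_horiz h20' h2h _ _ _ F3 F4; try lra.
  have {}G1 : frame (zlift (orect (x - h) (xe + h) (y - h / 2) (y + l + h / 2))) g1.
    by apply: sub G1; lra.
  have {}G2 : frame (zlift (orect (x - h) (xe + h) (y + l - h / 2) (ye + h / 2))) g2.
    by apply: sub G2; lra.
  have h40' : 0 < h / 4 by lra.
  have h4h : h / 4 < h / 2 by lra.
  have [|||g G] := glue_vert h40' h4h _ _ _ G1 G2; try lra.
  exists (h / 2); first by lra.
  by exists g; apply: sub G; lra.
move=> p q _ _; have [i ix] := dom_cover E (affine0 (p +i* q)).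
have [od _] := popen_dom i; have [r r0 rd] := od _ ix.
(* Side less than r / 4 plus margin r / 8 keeps both coordinates within 3 r / 8 of (p, q), inside
   the disc of radius r in the chart domain. *)
exists (r / (8 * L)); first by rewrite divr_gt0// mulr_gt0.
move=> x y s /andP[s0 sr] _ _ _ _ xp yq _.
rewrite ltr_pdivlMr ?mulr_gt0// in sr.
exists (r / 8); first by rewrite divr_gt0.
exists (@triv _ _ E i); apply: frame_subset (chart_frame i) => z [z0 [/andP[z1 z2] /andP[z3 z4]]].
rewrite -(affine0K z0); apply: rd; apply: le_lt_trans (cmod_ReIm _) _; rewrite !raddfB /=.
have : `|Re (zcoord z) - p| <= 3 / 8 * r by rewrite ler_norml; lra.
have : `|Im (zcoord z) - q| <= 3 / 8 * r by rewrite ler_norml; lra.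
lra.
Qed.

End Gluing.

(** * From a Birkhoff factorization to frames over the two affine charts *)

Section Splitting.
Context {R : realType}.
Implicit Types (z w : R[i]) (U V : set R[i]).

Lemma cholmxP m n U (M : R[i] -> 'M[R[i]]_(m, n)) : holo_mx U M <-> cholmx U M.
Proof. by split=> MU i j; apply/holo_cderivP; exact: MU. Qed.

Lemma GL_holoP n U (M : R[i] -> 'M[R[i]]_n) : GL_holo U M <-> cholGL U M.
Proof.
split=> [[/cholmxP MU [N NU MN]]|MG].
  by split=> // z /MN[/mulmx1_unit[]].
split; first by apply/cholmxP; exact: MG.1.
exists (fun z => invmx (M z)); first by apply/cholmxP; exact: cholmx_inv.
by move=> z /MG.2 Mu; rewrite mulmxV// mulVmx.
Qed.

Lemma copen_cmod_lt (r : R) : copen [set z | cmod z < r].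
Proof.
move=> z zA; exists (r - cmod z); first by rewrite subr_gt0.
by move=> w wz; have := cmod_le_dist w z; rewrite cmod_distC /=; lra.
Qed.

Lemma chol_exprz (k : int) : chol [set z : R[i] | z != 0] (fun z => z ^ k).
Proof. by apply/holo_cderivP; apply: holo_on_exprz. Qed.

Lemma zpow_diag_mul n (k : 'I_n -> int) z p (M : 'M[R[i]]_(n, p)) i j :
  (zpow_diag k z *m M) i j = z ^ k i * M i j.
Proof. by rewrite /zpow_diag mul_diag_mx !mxE. Qed.

Lemma zpow_diagN n (k : 'I_n -> int) z : z != 0 ->
  zpow_diag (fun i => - k i) z *m zpow_diag k z = 1%:M.
Proof.
move=> z0; apply/matrixP => i j; rewrite zpow_diag_mul /zpow_diag !mxE.
case: eqVneq => [->|]; last by rewrite mulr0n mulr0.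
by rewrite mulr1n -expfzDr// addNr expr0z.
Qed.

Lemma cholGL_zpow_diag n (k : 'I_n -> int) : cholGL [set z : R[i] | z != 0] (zpow_diag k).
Proof.
split; last by move=> z z0; have /mulmx1_unit[] := zpow_diagN k z0.
move=> i j; have [<-|ij] := eqVneq i j.
  apply: (chol_ext copen_neq0 _ (chol_exprz (k i))) => z _.
  by rewrite /zpow_diag !mxE eqxx mulr1n.
apply: (chol_ext copen_neq0 _ (@chol_cst _ _ 0)) => z _.
by rewrite /zpow_diag !mxE (negbTE ij) mulr0n.
Qed.

Section Bundle.
Variables (n : nat) (E : bundle R n).

Lemma frame_infinity : exists2 r : R, 0 < r & exists psi : coords E,
  frame (wlift [set w | cmod w < r]) psi.
Proof.
have [i ix] := dom_cover E (affine1 0); have [_ od] := popen_dom i.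
have [r r0 rd] := od _ ix; exists r => //; exists (@triv _ _ E i).
apply: frame_subset (chart_frame i) => x [x1 xr].
by rewrite -(affine1K x1); apply: rd; rewrite subr0.
Qed.

Lemma wlift_cmod_lt (r : R) z : 0 < r -> r^-1 < cmod z ->
  wlift [set w : R[i] | cmod w < r] (affine0 z).
Proof.
move=> r0 rz; have z0 : z != 0.
  by rewrite -cmod_gt0; apply: lt_trans rz; rewrite invr_gt0.
apply/wlift_affine0; split => //=; rewrite cmodV -[ltRHS]invrK ltf_pV2 ?posrE ?invr_gt0//.
by rewrite cmod_gt0.
Qed.

Lemma frame_plane : exists phi : coords E, frame (zlift setT) phi.
Proof.
have [r r0 [psi fpsi]] := frame_infinity.
have ri0 : 0 < r^-1 by rewrite invr_gt0.
(* The annulus between r^-1 and L still has width 1 after a loss of 1 on each side, so the shrunken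
   domains cover the plane. *)
pose L := r^-1 + 3.
have [|phi fphi] := @frame_square _ _ E L; first by rewrite /L; lra.
have fpsi' : frame (zlift [set z | r^-1 < cmax z]) psi.
  apply: frame_subset fpsi => x [x0 xr]; rewrite -(affine0K x0); apply: wlift_cmod_lt => //.
  exact: lt_le_trans (cmax_le_cmod _).
have TG := frame_lift_GL (@copen_cmax_lt _ L) (@copen_cmax_gt _ r^-1) fphi fpsi'.
have [||a [b [aA bB ab]]] := @annulus_cartan _ n r^-1 L 1 (fun z => change phi psi (affine0 z))
  ltr01 (ltW ri0); first by rewrite /L; lra.
  by apply: cholGL_subset TG => z /andP[z1 z2].
have [|||||chi chif] := @glue_frames _ _ E [set z | r^-1 < cmax z] [set z | cmax z < L]
  [set z | r^-1 + 1 < cmax z] [set z | cmax z < L - 1] psi phi a b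
  (@copen_cmax_gt _ _) (@copen_cmax_lt _ _) _ _ fpsi' fphi.
- by move=> z /=; lra.
- by move=> z /=; lra.
- exact: aA.
- exact: bB.
- by move=> z z1 z2; apply: ab; rewrite z1 z2.
exists chi; apply: frame_subset chif => x [x0 _]; split => //.
by have [zm|zm] := ltP (r^-1 + 1) (cmax (zcoord x)); [left|right => /=; rewrite /L; lra].
Qed.

Lemma zlift_setTE : zlift setT = [set x : P1 R | U0 x].
Proof. by apply/seteqP; split=> x; [case|]. Qed.

(** With psi = T phi and T = P(1/z) diag(z^k) E, the frame E phi over the plane and the frame P^-1
    psi near infinity are related by diag(z^k). *)
Lemma splitting_frames : birkhoff_factorization R -> (1 <= n)%N ->
  exists (a : 'I_n -> int) (phi0 phi1 : coords E),
    [/\ frame [set x | U0 x] phi0, frame [set x | U1 x] phi1 &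
      forall x, U0 x -> U1 x -> forall v, phi0 x v = zpow_diag a (zcoord x) *m phi1 x v].
Proof.
move=> BF n1; have [phi fphi] := frame_plane; have [r r0 [psi fpsi]] := frame_infinity.
have ri0 : 0 < r^-1 by rewrite invr_gt0.
have oT : copen [set: R[i]] by move=> z _; exists 1.
have oW := popen_wlift (@copen_cmod_lt r).
have oZ := popen_zlift oT.
have TG : cholGL [set z : R[i] | (r^-1)%:C < `|z|] (fun z => change phi psi (affine0 z)).
  have inZ z : (r^-1)%:C < `|z| -> (zlift setT `&` wlift [set w | cmod w < r]) (affine0 z).
    by rewrite gtC_cmod => rz; split; [exact/zlift_affine0|exact: wlift_cmod_lt].
  have [h _] := frame_change oZ oW fphi fpsi; split.
    by apply: cholmx_subset h => z /inZ.
  move=> z /inZ[z0 zw]; apply: change_unit; [exact: fphi.1|exact: fpsi.1].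
(* With R_0 = 1/r, the factor P is holomorphic exactly on the disc of radius r in the coordinate at
   infinity where psi is a frame. *)
have [P [E' [k [/GL_holoP PG /GL_holoP EG _ TE]]]] := BF n r^-1 _ n1 ri0 ((GL_holoP _ _).2 TG).
have PG' : cholGL [set w | cmod w < r] P.
  by apply: cholGL_subset PG => w wr; rewrite /= ltC_cmod div1r invrK.
pose phi0 : coords E := act (fun x => E' (zcoord x)) phi.
have f0 : frame (zlift setT) phi0.
  apply: frame_act => //; last by apply: pholo_zlift; exact: EG.1.
  by move=> x _; exact: EG.2.
have f1 : frame (wlift [set w | cmod w < r]) (act (fun x => invmx (P (wcoord x))) psi).
  apply: frame_act => //; first by move=> x [_ xr]; rewrite unitmx_inv; exact: PG'.2.
  apply: pholo_inv; first by move=> x [_ xr]; exact: PG'.2.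
  by apply: pholo_wlift; exact: PG'.1.
(* The frame near infinity coincides with diag(z^k) phi0 where both are defined, and the latter
   exists for all z != 0; together they give a frame over the whole of U_1. *)
have f2 : frame (zlift [set z | z != 0]) (act (fun x => zpow_diag k (zcoord x)) phi0).
  apply: frame_act.
  - exact: popen_zlift copen_neq0.
  - by apply: frame_subset f0 => x [x0 _].
  - by move=> x [_ x0]; exact: (cholGL_zpow_diag k).2.
  - by apply: pholo_zlift; exact: (cholGL_zpow_diag k).1.
have [|chi [chif chi1 chi2]] := frame_glue oW (popen_zlift copen_neq0) f1 f2.
  move=> x [x1 xr] [x0 xz] v.
  have xw : wlift [set w | cmod w < r] x by split.
  have xZ : zlift setT x by split.
  rewrite /act (@changeP _ _ E phi psi x (fphi.1 x xZ) (fpsi.1 x xw).1 v).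
  have xR : (r^-1)%:C < `|zcoord x|.
    rewrite gtC_cmod; move: xr; rewrite wcoordE /= cmodV -[X in _ < X]invrK.
    by rewrite ltf_pV2 ?posrE ?invr_gt0// cmod_gt0.
  have := TE _ xR; rewrite (affine0K x0) => ->.
  rewrite div1r -wcoordE !mulmxA mulVmx; last exact: PG'.2.
  by rewrite mul1mx.
(* The glued frame is diag(z^k) phi0, so phi0 is recovered with the opposite exponents. *)
exists (fun i => - k i), phi0, chi; split.
- by rewrite -zlift_setTE.
- apply: frame_subset chif => x x1.
  have [x0|x0] := boolP (U0 x); first by right; split => //; exact: zcoord_neq0.
  left; split => //=; rewrite /wcoord; move: x0; rewrite /U0 negbK => /eqP ->.
  by rewrite mul0r cmod0.
move=> x x0 x1 v; have xz := zcoord_neq0 x0 x1.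
by rewrite chi2 /act; [rewrite mulmxA zpow_diagN// mul1mx|split].
Qed.

End Bundle.
End Splitting.

(** * Isomorphisms *)

Section Isomorphism.
Context {R : realType}.

Lemma popen_U0 : popen [set x : P1 R | U0 x].
Proof. by apply/popenP; exact: P1_open_U0. Qed.

Lemma popen_U1 : popen [set x : P1 R | U1 x].
Proof. by apply/popenP; exact: P1_open_U1. Qed.

(** With respect to either pair of frames f is the identity matrix, so in the charts of the atlases
    it is a product of two transition matrices. *)
Lemma hom_of_frames n (E F : bundle R n) (phi0 phi1 : coords E) (sig0 sig1 : coords F)
    (f : forall x, fiber E x -> fiber F x) :
  frame [set x | U0 x] phi0 -> frame [set x | U1 x] phi1 ->
  frame [set x | U0 x] sig0 -> frame [set x | U1 x] sig1 ->
  (forall x, U0 x -> forall v, sig0 x (f x v) = phi0 x v) ->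
  (forall x, U1 x -> forall v, sig1 x (f x v) = phi1 x v) ->
  bundle_hom f.
Proof.
move=> p0 p1 s0 s1 f0 f1; split.
  move=> x c u v; case/orP: (U0_or_U1 x) => xU.
    have [sl sb] := s0.1 x xU; apply: (bij_inj sb).
    by rewrite sl !f0// (p0.1 x xU).1.
  have [sl sb] := s1.1 x xU; apply: (bij_inj sb).
  by rewrite sl !f1// (p1.1 x xU).1.
move=> i j.
pose M0 x := change sig0 (@triv _ _ F j) x *m change (@triv _ _ E i) phi0 x.
pose M1 x := change sig1 (@triv _ _ F j) x *m change (@triv _ _ E i) phi1 x.
have M0E x : U0 x -> dom i x -> dom j x -> forall v, triv j (f x v) = M0 x *m triv i v.
  move=> xU ix jx v; rewrite /M0 -mulmxA -changeP; [|exact: triv_linbij|exact: (p0.1 x xU).1].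
  by rewrite -f0//; apply: changeP; [exact: s0.1|exact: triv_linear].
have M1E x : U1 x -> dom i x -> dom j x -> forall v, triv j (f x v) = M1 x *m triv i v.
  move=> xU ix jx v; rewrite /M1 -mulmxA -changeP; [|exact: triv_linbij|exact: (p1.1 x xU).1].
  by rewrite -f1//; apply: changeP; [exact: s1.1|exact: triv_linear].
pose M x := if U0 x then M0 x else M1 x.
have ME x : dom i x -> dom j x -> forall v, triv j (f x v) = M x *m triv i v.
  move=> ix jx; rewrite /M; case: ifPn => xU; first exact: M0E.
  by apply: M1E => //; have := U0_or_U1 x; rewrite (negbTE xU).
exists M; last by move=> x ix jx v; exact: ME.
apply/pholoP; apply: pholo_local => x [ix jx].
have oij := popenI (popen_dom i) (popen_dom j).
case/orP: (U0_or_U1 x) => xU.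
  exists ([set x | U0 x] `&` (dom i `&` dom j)) => //.
  apply: (pholo_ext (N := M0)); first exact: popenI popen_U0 oij.
    by move=> y [yU _]; rewrite /M ifT.
  apply: pholoM.
    apply: pholo_subset (frame_change popen_U0 (popen_dom j) s0 (chart_frame j)).
    by move=> y [yU [_ jy]].
  apply: pholo_subset (frame_change (popen_dom i) popen_U0 (chart_frame i) p0).
  by move=> y [yU [iy _]].
exists ([set x | U1 x] `&` (dom i `&` dom j)) => //.
(* Over the intersection with U_0 the value of M is that of M0, which agrees with M1 since both
   represent f. *)
apply: (pholo_ext (N := M1)); first exact: popenI popen_U1 oij.
  move=> y [yU [iy jy]]; apply: (change_uniq (triv_linbij iy)) => v.
  by rewrite -ME// -M1E.
apply: pholoM.
  apply: pholo_subset (frame_change popen_U1 (popen_dom j) s1 (chart_frame j)).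
  by move=> y [yU [_ jy]].
apply: pholo_subset (frame_change (popen_dom i) popen_U1 (chart_frame i) p1).
by move=> y [yU [iy _]].
Qed.

Definition of_coords n (E : bundle R n) (phi : coords E) x (y : 'cV[R[i]]_n) : fiber E x :=
  xget 0 [set v | phi x v = y].

Lemma of_coordsK n (E : bundle R n) (phi : coords E) x y : linbij x phi ->
  phi x (of_coords phi x y) = y.
Proof.
move=> [_ [f fK Kf]].
by apply: (@xgetPex _ 0 [set v | phi x v = y]); exists (f y); exact: Kf.
Qed.

(** Equality of coordinates defines a map over U_0 and one over U_1; as both bundles have the same
    transition matrix G, and G is invertible, the two maps agree on the intersection. *)
Lemma iso_of_frames n (E F : bundle R n) (phi0 phi1 : coords E) (sig0 sig1 : coords F)
    (G : P1 R -> 'M[R[i]]_n) :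
  frame [set x | U0 x] phi0 -> frame [set x | U1 x] phi1 ->
  frame [set x | U0 x] sig0 -> frame [set x | U1 x] sig1 ->
  (forall x, U0 x -> U1 x -> G x \in unitmx) ->
  (forall x, U0 x -> U1 x -> forall v, phi0 x v = G x *m phi1 x v) ->
  (forall x, U0 x -> U1 x -> forall v, sig0 x v = G x *m sig1 x v) ->
  bundle_iso E F.
Proof.
move=> p0 p1 s0 s1 Gu pG sG.
pose f x (v : fiber E x) : fiber F x :=
  if U0 x then of_coords sig0 x (phi0 x v) else of_coords sig1 x (phi1 x v).
pose g x (v : fiber F x) : fiber E x :=
  if U0 x then of_coords phi0 x (sig0 x v) else of_coords phi1 x (sig1 x v).
have f0 x : U0 x -> forall v, sig0 x (f x v) = phi0 x v.
  by move=> xU v; rewrite /f xU of_coordsK//; exact: s0.1.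
have g0 x : U0 x -> forall v, phi0 x (g x v) = sig0 x v.
  by move=> xU v; rewrite /g xU of_coordsK//; exact: p0.1.
have cancelG x (u w : 'cV[R[i]]_n) : U0 x -> U1 x -> G x *m u = G x *m w -> u = w.
  by move=> xU xU' /(congr1 (mulmx (invmx (G x)))); rewrite !mulKmx// Gu.
have f1 x : U1 x -> forall v, sig1 x (f x v) = phi1 x v.
  move=> xU v; have [xU0|xU0] := boolP (U0 x).
    by apply: (cancelG x) => //; rewrite -sG// -pG// f0.
  by rewrite /f (negbTE xU0) of_coordsK//; exact: s1.1.
have g1 x : U1 x -> forall v, phi1 x (g x v) = sig1 x v.
  move=> xU v; have [xU0|xU0] := boolP (U0 x).
    by apply: (cancelG x) => //; rewrite -sG// -pG// g0.
  by rewrite /g (negbTE xU0) of_coordsK//; exact: p1.1.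
exists f, g; split.
- exact: hom_of_frames p0 p1 s0 s1 f0 f1.
- exact: hom_of_frames s0 s1 p0 p1 g0 g1.
move=> x; case/orP: (U0_or_U1 x) => xU; split=> v.
- by apply: (bij_inj (p0.1 x xU).2); rewrite g0// f0.
- by apply: (bij_inj (s0.1 x xU).2); rewrite f0// g0.
- by apply: (bij_inj (p1.1 x xU).2); rewrite g1// f1.
- by apply: (bij_inj (s1.1 x xU).2); rewrite f1// g1.
Qed.

Lemma cholmx_block m n (U : set R[i]) (M : R[i] -> 'M[R[i]]_m) (N : R[i] -> 'M[R[i]]_n) :
  cholmx U M -> cholmx U N -> cholmx U (fun z => block_mx (M z) 0 0 (N z)).
Proof.
move=> MU NU a b; case: (split_ordP a) => a' ->; case: (split_ordP b) => b' ->.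
- by under [X in chol _ X]eq_fun do rewrite block_mxEul; exact: MU.
- by under [X in chol _ X]eq_fun do rewrite block_mxEur mxE; exact: chol_cst.
- by under [X in chol _ X]eq_fun do rewrite block_mxEdl mxE; exact: chol_cst.
- by under [X in chol _ X]eq_fun do rewrite block_mxEdr; exact: NU.
Qed.

Definition sum_coords m n (E : bundle R m) (F : bundle R n) (phi : coords E) (psi : coords F) :
  coords (whitney_sum E F) := fun x v => col_mx (phi x v.1) (psi x v.2).

Lemma frame_sum m n (E : bundle R m) (F : bundle R n) W (phi : coords E) (psi : coords F) :
  popen W -> frame W phi -> frame W psi -> frame W (sum_coords phi psi).
Proof.
move=> oW [pl ph] [ql qh].
have sl x : W x -> linbij x (sum_coords phi psi).
  move=> Wx; have [pxl [f fK Kf]] := pl x Wx; have [qxl [g gK Kg]] := ql x Wx; split.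
    by move=> c u v; rewrite /sum_coords /= pxl qxl scale_col_mx add_col_mx.
  exists (fun w => (f (usubmx w), g (dsubmx w))) => [[u v]|w].
    by rewrite /sum_coords /= col_mxKu col_mxKd fK gK.
  by rewrite /sum_coords /= Kf Kg vsubmxK.
split => // -[i j].
apply: (pholo_ext (N := fun x => block_mx (change phi (@triv _ _ E i) x) 0 0
    (change psi (@triv _ _ F j) x))).
- by apply: popenI => //; exact: popen_dom.
- move=> x [Wx [ix jx]]; apply: changeE; first exact: sl.
  move=> v; rewrite /sum_coords mul_block_col !mul0mx addr0 add0r.
  rewrite -changeP; [|exact: pl|exact: triv_linear].
  by rewrite -changeP; [|exact: ql|exact: triv_linear].
have [h0 h1] := ph i; have [k0 k1] := qh j.
split.
  apply: cholmx_block; first by apply: cholmx_subset h0 => z [Wz [iz jz]].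
  by apply: cholmx_subset k0 => z [Wz [iz jz]].
apply: cholmx_block; first by apply: cholmx_subset h1 => z [Wz [iz jz]].
by apply: cholmx_subset k1 => z [Wz [iz jz]].
Qed.

Lemma zpow_diag_col_mx n p (a : 'I_(1 + n) -> int) z (u : 'M[R[i]]_(1, p)) (w : 'M[R[i]]_(n, p)) :
  zpow_diag a z *m col_mx u w =
  col_mx (z ^ a ord0 *: u) (zpow_diag (fun i => a (lift ord0 i)) z *m w).
Proof.
apply/matrixP => i j; rewrite zpow_diag_mul.
case: (split_ordP i) => k ->; last first.
  by rewrite !col_mxEd zpow_diag_mul; congr (_ ^ a _ * _); exact: val_inj.
rewrite !col_mxEu mxE; congr (_ ^ a _ * _).
by apply: val_inj; rewrite /= ord1.
Qed.

Lemma OP1_sum_frames n (a : 'I_n -> int) : exists sig0 sig1 : coords (OP1_sum R a),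
  [/\ frame [set x | U0 x] sig0, frame [set x | U1 x] sig1 &
    forall x, U0 x -> U1 x -> forall v, sig0 x v = zpow_diag a (zcoord x) *m sig1 x v].
Proof.
elim: n a => [|n IH] a.
  exists (fun x v => v), (fun x v => v); split.
  - by apply: frame_subset (@chart_frame R 0 (zero_bundle R) tt).
  - by apply: frame_subset (@chart_frame R 0 (zero_bundle R) tt).
  - by move=> x _ _ v; apply/matrixP => -[].
have [s0 [s1 [f0 f1 E01]]] := IH (fun i => a (lift ord0 i)).
exists (@sum_coords 1 n (OP1 R (a ord0)) (OP1_sum R (fun i => a (lift ord0 i)))
  (@triv _ _ (OP1 R (a ord0)) false) s0).
exists (@sum_coords 1 n (OP1 R (a ord0)) (OP1_sum R (fun i => a (lift ord0 i)))
  (@triv _ _ (OP1 R (a ord0)) true) s1).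
split.
- apply: frame_sum => //; first exact: popen_U0.
  exact: (@chart_frame _ _ (OP1 R (a ord0)) false).
- apply: frame_sum => //; first exact: popen_U1.
  exact: (@chart_frame _ _ (OP1 R (a ord0)) true).
move=> x x0 x1 v; rewrite /sum_coords E01//.
apply: etrans (esym (zpow_diag_col_mx a (zcoord x) _ _)).
by congr col_mx; exact: O_transition.
Qed.

End Isomorphism.

(** * Homomorphisms between sums of line bundles and uniqueness of the weights *)

Section Uniqueness.
Context {R : realType}.

Lemma hom_matrix n l (E : bundle R n) (F : bundle R l) (f : forall x, fiber E x -> fiber F x)
    W (phi : coords E) (psi : coords F) :
  bundle_hom f -> popen W -> frame W phi -> frame W psi ->
  exists M : P1 R -> 'M[R[i]]_(l, n), pholo W M /\
    forall x, W x -> forall v, psi x (f x v) = M x *m phi x v.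
Proof.
move=> [fl fh] oW fphi fpsi.
have H x : exists A : 'M[R[i]]_(l, n), W x -> forall v, psi x (f x v) = A *m phi x v.
  have [Wx|nWx] := pselect (W x); last by exists 0.
  have [|A AE] := @linear_changeP R (fiber E x) n l (phi x) (fun v => psi x (f x v))
    (fphi.1 x Wx).1 (fphi.1 x Wx).2; last by exists A.
  by move=> c u v; rewrite fl (fpsi.1 x Wx).1.
have [M ME] := choice H; exists M; split => //.
apply: pholo_local => x Wx.
have [i ix] := dom_cover E x; have [j jx] := dom_cover F x.
have [A /pholoP Ah AE] := fh i j.
exists (W `&` (dom i `&` dom j)) => //.
apply: (pholo_ext (N := fun y => change (@triv _ _ F j) psi y *m A y *m
    change phi (@triv _ _ E i) y)).
- by apply: popenI => //; apply: popenI; exact: popen_dom.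
- move=> y [Wy [iy jy]]; apply: (change_uniq (fphi.1 y Wy)) => v.
  rewrite -ME// -mulmxA -changeP; [|exact: fphi.1|exact: triv_linear].
  rewrite -mulmxA -AE//; apply: changeP; first exact: triv_linbij.
  exact: (fpsi.1 y Wy).1.
apply: pholoM; first apply: pholoM.
- by apply: pholo_subset (frame_change (popen_dom j) oW (chart_frame j) fpsi) => y [Wy [iy jy]].
- by apply: pholo_subset Ah => y [Wy [iy jy]].
- by apply: pholo_subset (frame_change oW (popen_dom i) fphi (chart_frame i)) => y [Wy [iy jy]].
Qed.

(** The relation reads f(z) = z^(b - a) g(1/z) with a negative exponent, and g is bounded near 0, so
    f tends to 0 at infinity. In the application f and g are an entry of a homomorphism in the
    frames over U_0 and over U_1. *)
Lemma section_decay (f g : R[i] -> R[i]) (a b : int) : chol setT f -> chol setT g -> b < a ->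
  (forall z, z != 0 -> f z * z ^ a = z ^ b * g z^-1) -> forall z, f z = 0.
Proof.
move=> fT gT ba fg; apply: liouville_decay => // e e0.
have [d dE] : exists d : nat, a = b + d.+1.
  have : 0 < a - b by rewrite subr_gt0.
  case E : (a - b) => [[|d]|d] // _; exists d.
  by rewrite -E addrC subrK.
have [r r0 rP] := chol_ccont gT (I : setT 0) ltr01.
pose C := cmod (g 0) + 1.
have C0 : 0 < C by have := cmod_ge0 (g 0); rewrite /C; lra.
(* 1 gives [cmod z <= cmod z ^+ d.+1], [2 / r] puts z^-1 where g is bounded by C, and [C / e] makes
   the quotient at most e. *)
pose N := Num.max 1 (Num.max (2 / r) (C / e)).
have [N1 Nr Ne] : [/\ 1 <= N, 2 / r <= N & C / e <= N].
  by rewrite /N !le_max !lexx !orbT.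
exists N => z Nz; have cz : 0 < cmod z by lra.
have z0 : z != 0 by rewrite -cmod_gt0.
have := fg z z0; rewrite dE expfzDr// mulrCA => /(mulfI (expfz_neq0 b z0)).
move=> /(congr1 cmod); rewrite cmodM -exprnP cmodX => E.
have gC : cmod (g z^-1) <= C.
  have [] : cmod (z^-1 - 0) < r.
    rewrite subr0 cmodV -[ltRHS]invrK ltf_pV2 ?posrE ?invr_gt0//.
    have : 0 < r^-1 by rewrite invr_gt0.
    by lra.
  by move=> /rP; have := cmod_le_dist (g z^-1) (g 0); rewrite cmod_distC /C; lra.
have zd : cmod z <= cmod z ^+ d.+1.
  rewrite exprS ler_peMr ?cmod_ge0// exprn_ege1//; lra.
have : cmod (f z) * cmod z <= C.
  by apply: le_trans gC; rewrite -E ler_wpM2l ?cmod_ge0.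
rewrite -ler_pdivlMr// => h; apply: le_trans h _.
rewrite ler_pdivrMr// mulrC -ler_pdivrMr//; lra.
Qed.

(** A nonzero term of each determinant gives permutations s and t with
    a (s i) <= b i and b (t i) <= a i; summing over i shows that these are
    equalities. *)
Lemma weights_perm (K : fieldType) n l (A : 'M[K]_(l, n)) (B : 'M[K]_(n, l))
    (a : 'I_n -> int) (b : 'I_l -> int) : B *m A = 1%:M -> A *m B = 1%:M ->
  (forall i j, A i j != 0 -> a j <= b i) -> (forall i j, B i j != 0 -> b j <= a i) ->
  n = l /\ exists2 s : 'I_n -> 'I_l, bijective s & forall i, a i = b (s i).
Proof.
move=> BA AB Aab Bba.
have nl : n = l.
  apply/eqP; rewrite eqn_leq; apply/andP; split.
    by rewrite -[X in (X <= _)%N](@mxrank1 K) -BA (leq_trans (mxrankM_maxl _ _))// rank_leq_col.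
  by rewrite -[X in (X <= _)%N](@mxrank1 K) -AB (leq_trans (mxrankM_maxl _ _))// rank_leq_col.
split=> //; move: B A a b BA AB Aab Bba; rewrite {}nl => B A a b BA AB Aab Bba.
have perm_nz (M : 'M[K]_l) : M \in unitmx -> exists s : {perm 'I_l}, forall i, M i (s i) != 0.
  rewrite unitmxE unitfE /determinant => d0.
  have [s sP] : exists s : {perm 'I_l}, (-1) ^+ s * \prod_i M i (s i) != 0.
    apply/existsP; apply: contraNT d0 => /existsPn d0; rewrite big1// => s _.
    by apply/eqP; have := d0 s; rewrite negbK.
  exists s => i; apply: contraNneq sP => Mi0.
  by rewrite (bigD1 i)//= Mi0 mul0r mulr0.
have [Au Bu] := mulmx1_unit AB.
have [s sA] := perm_nz A Au; have [t tB] := perm_nz B Bu.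
have as_b i : a (s i) <= b i by exact: Aab.
have bt_a i : b (t i) <= a i by exact: Bba.
have sumE : \sum_i a (s i) = \sum_i a i by rewrite [RHS](reindex_inj (@perm_inj _ s)).
have sumE' : \sum_i b (t i) = \sum_i b i by rewrite [RHS](reindex_inj (@perm_inj _ t)).
have sums : \sum_i b i <= \sum_i a (s i).
  by rewrite sumE -sumE'; apply: ler_sum => i _; exact: bt_a.
have abE i : a (s i) = b i.
  have : \sum_i (b i - a (s i)) <= 0 by rewrite sumrB subr_le0.
  rewrite (bigD1 i)//= => h; apply/eqP; rewrite eq_le as_b /= -subr_le0.
  apply: le_trans h; rewrite lerDl; apply: sumr_ge0 => j _.
  by rewrite subr_ge0.
exists (s^-1)%g; last by move=> i; rewrite -abE permKV.
by exists s => i; rewrite ?permK ?permKV.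
Qed.

Theorem OP1_sum_iso n l (a : 'I_n -> int) (b : 'I_l -> int) :
  bundle_iso (OP1_sum R a) (OP1_sum R b) <->
  n = l /\ exists2 s : 'I_n -> 'I_l, bijective s & forall i, a i = b (s i).
Proof.
have [s0 [s1 [s0f s1f sE]]] := @OP1_sum_frames R n a.
have [t0 [t1 [t0f t1f tE]]] := @OP1_sum_frames R l b.
split; last first.
  move=> [nl [s sb ab]]; move: s0 s1 s0f s1f sE s sb ab; subst l => s0 s1 s0f s1f sE s sb ab.
  (* Permuting the coordinates of the second bundle by S turns its transition matrix into
     [zpow_diag a], and [iso_of_frames] applies. *)
  pose S : 'M[R[i]]_n := \matrix_(i, j) (j == s i)%:R.
  have SE p (M : 'M[R[i]]_(n, p)) i j : (S *m M) i j = M (s i) j.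
    rewrite mxE (bigD1 (s i))//= mxE eqxx mul1r big1 ?addr0// => k ks.
    by rewrite mxE (negbTE ks) mul0r.
  have Su : S \in unitmx.
    case: sb => s' sK Ks.
    have /mulmx1_unit[] // : S *m \matrix_(i, j) (j == s' i)%:R = 1%:M.
    by apply/matrixP => i j; rewrite SE !mxE sK eq_sym.
  have [t0f' t1f'] : frame [set x | U0 x] (act (fun=> S) t0) /\ frame [set x | U1 x] (act (fun=> S) t1).
    by split; apply: frame_act; rewrite //; [exact: popen_U0|exact: pholo_cst|exact: popen_U1|exact: pholo_cst].
  apply: (iso_of_frames (G := fun x => zpow_diag a (zcoord x)) s0f s1f t0f' t1f').
  - by move=> x x0 x1; apply: (cholGL_zpow_diag a).2; exact: zcoord_neq0.
  - exact: sE.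
  - move=> x x0 x1 v; rewrite /act tE//; apply/matrixP => i j.
    by rewrite SE !zpow_diag_mul SE ab.
move=> [f [g [fh gh fg]]].
(* An entry with d_i < c_j vanishes identically, so the constraint is already visible in the fiber
   at [1 : 0]; the comparison of determinants then concerns constant matrices. *)
have weight (p q : nat) (E : bundle R p) (F : bundle R q) (c : 'I_p -> int) (d : 'I_q -> int)
    (p0 p1 : coords E) (q0 q1 : coords F) (h : forall x, fiber E x -> fiber F x) :
    bundle_hom h ->
    frame [set x | U0 x] p0 -> frame [set x | U1 x] p1 ->
    frame [set x | U0 x] q0 -> frame [set x | U1 x] q1 ->
    (forall x, U0 x -> U1 x -> forall v, p0 x v = zpow_diag c (zcoord x) *m p1 x v) ->
    (forall x, U0 x -> U1 x -> forall v, q0 x v = zpow_diag d (zcoord x) *m q1 x v) ->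
    exists M : 'M[R[i]]_(q, p), (forall v, q0 (affine0 0) (h _ v) = M *m p0 (affine0 0) v) /\
      forall i j, M i j != 0 -> c j <= d i.
  move=> hh p0f p1f q0f q1f pE qE.
  have [M0 [[M0h _] M0E]] := hom_matrix hh popen_U0 p0f q0f.
  have [M1 [[_ M1h] M1E]] := hom_matrix hh popen_U1 p1f q1f.
  exists (M0 (affine0 0)); split; first by move=> v; apply: M0E; exact: U0_affine0.
  move=> i j; apply: contraNT; rewrite -ltNge => dc; apply/eqP.
  apply: (@section_decay (fun z => M0 (affine0 z) i j) (fun w => M1 (affine1 w) i j) _ _ _ _ dc).
  - by apply: chol_subset (M0h i j) => z _; exact: U0_affine0.
  - by apply: chol_subset (M1h i j) => z _; exact: U1_affine1.
  move=> z z0; have x0 : U0 (affine0 z) := U0_affine0 z.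
  have x1 : U1 (affine0 z) by rewrite U1_affine0.
  have : M0 (affine0 z) *m zpow_diag c z = zpow_diag d z *m M1 (affine0 z).
    apply: (change_uniq (p1f.1 _ x1)) => v.
    have pE' : p0 (affine0 z) v = zpow_diag c z *m p1 (affine0 z) v.
      by rewrite (pE _ x0 x1) zcoord_affine0.
    by rewrite -!mulmxA -(M1E _ x1) -pE' -(M0E _ x0) (qE _ x0 x1) zcoord_affine0.
  move=> /matrixP/(_ i j); rewrite zpow_diag_mul /zpow_diag mul_mx_diag !mxE.
  by rewrite (affine01 z0).
have [A [AE Aab]] := weight _ _ _ _ _ _ _ _ _ _ _ fh s0f s1f t0f t1f sE tE.
have [B [BE Bba]] := weight _ _ _ _ _ _ _ _ _ _ _ gh t0f t1f s0f s1f tE sE.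
have x0 := U0_affine0 (0 : R[i]).
apply: (@weights_perm _ n l A B) => //.
  apply: (change_uniq (s0f.1 _ x0)) => v.
  by rewrite -mulmxA -AE -BE (fg _).1 mul1mx.
apply: (change_uniq (t0f.1 _ x0)) => v.
by rewrite -mulmxA -BE -AE (fg _).2 mul1mx.
Qed.

End Uniqueness.

Theorem corollary4p31 (R : realType) :
  birkhoff_factorization R -> grothendieck_splitting R.
Proof.
move=> BF; split; last by move=> n l a b; exact: OP1_sum_iso.
move=> n E n1; have [a [p0 [p1 [p0f p1f pE]]]] := splitting_frames E BF n1.
have [s0 [s1 [s0f s1f sE]]] := @OP1_sum_frames R n a; exists a.
apply: (iso_of_frames (G := fun x => zpow_diag a (zcoord x)) p0f p1f s0f s1f) => // x x0 x1.
by apply: (cholGL_zpow_diag a).2; exact: zcoord_neq0.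
Qed.
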